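(* Let $M$ be a compact Riemannian manifold without boundary whose sectional curvature is non-negative and whose Ricci curvature is parallel. Let $U_1,U_2:M\to\mathbb{R}$ be smooth functions such that, for some constant $k\ge 0$, $$\nabla^2\left(\Delta U_1+\tfrac12|\nabla U_1|^2-2U_2\right)\le k^2 I .$$ Then any positive solution $\rho_t$ of the equation $$\dot\rho_t=\Delta\rho_t+\langle\nabla U_1,\nabla\rho_t\rangle+U_2\rho_t$$ satisfies, for every $t>0$ (in the time interval on which the solution is defined), $$\nabla^2\log\rho_t+\tfrac12\nabla^2U_1\ \ge\ -\frac{k\coth(kt)}{2}\,I ,$$ where for $k=0$ the quantity $k\coth(kt)$ is understood as $1/t$.
   Context: $\nabla^2 f$ is the Hessian of $f$, regarded as a self-adjoint operator on each tangent space; inequalities between such operators are in the sense of quadratic forms and $I$ is the identity. $\Delta$ is the Laplace-Beltrami operator ($\Delta=\mathrm{tr}\,\nabla^2$). The Ricci curvature being parallel means that its covariant derivative vanishes. The solution $\rho_t(x)$ is smooth in $(t,x)$ and defined for times starting at $0$; a dot denotes the derivative in $t$. *)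

(* Defs.v *)
From HB Require Import structures.
From mathcomp Require Import all_boot all_order all_algebra.
From mathcomp Require Import all_classical all_reals all_analysis.
Set Implicit Arguments.
Unset Strict Implicit.
Unset Printing Implicit Defensive.
Import Order.TTheory GRing.Theory Num.Theory.
Import numFieldNormedType.Exports.
Local Open Scope classical_set_scope.
Local Open Scope ring_scope.

(* C^oo on an open set U: every iterated directional derivative of f is
   Frechet differentiable at every point of U. *)
Definition smooth_on (R : realType) (V W : normedModType R)
    (U : set V) (f : V -> W) : Prop :=
  forall (vs : seq V) (x : V), U x ->
    differentiable (foldr (fun v g => 'D_v g) f vs) x.

(* C^oo on a set that need not be open (used for time intervals containing
   their endpoints): local extendability to a C^oo function. *)
Definition smooth_within (R : realType) (V W : normedModType R)
    (A : set V) (f : V -> W) : Prop :=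
  forall x, A x -> exists (O : set V) (F : V -> W),
    [/\ open O, O x, smooth_on O F & forall y, O y -> A y -> F y = f y].

(* Classical tensor calculus for a metric G given in coordinates on (an open
   subset of) R^n.  Tangent vectors are row vectors of components. *)
Section Coordinates.
Context (R : realType) (n : nat).
Implicit Types (G : 'rV[R]_n -> 'M[R]_n) (f : 'rV[R]_n -> R) (x : 'rV[R]_n)
  (u v w : 'rV[R]_n) (a b c d : 'I_n).

Definition partial a f : 'rV[R]_n -> R := 'D_(delta_mx 0 a) f.

Definition inner (A : 'M[R]_n) u v : R := (u *m A *m v^T) 0 0.

Definition form_le (A B : 'M[R]_n) : Prop := forall v, inner A v v <= inner B v v.

(* Gamma^c_{ab} *)
Definition christoffel G c a b x : R :=
  2^-1 * \sum_d invmx (G x) c d *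
    (partial a (fun y => G y b d) x + partial b (fun y => G y a d) x
     - partial d (fun y => G y a b) x).

(* R^d_{cab}, with R(e_a, e_b) e_c = sum_d R^d_{cab} e_d and
   R(X, Y) = [nabla_X, nabla_Y] - nabla_[X, Y] *)
Definition riemann G d c a b x : R :=
  partial a (christoffel G d b c) x - partial b (christoffel G d a c) x
  + \sum_e (christoffel G d a e x * christoffel G e b c x
            - christoffel G d b e x * christoffel G e a c x).

Definition curvature G x u v w : 'rV[R]_n :=
  \row_d \sum_a \sum_b \sum_c u 0 a * v 0 b * w 0 c * riemann G d c a b x.

Definition sectional G x u v : R :=
  inner (G x) (curvature G x u v v) u /
  (inner (G x) u u * inner (G x) v v - inner (G x) u v ^+ 2).

Definition ricci G b c x : R := \sum_a riemann G a c a b x.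

(* (nabla_a Ric)_{bc} *)
Definition nabla_ricci G a b c x : R :=
  partial a (ricci G b c) x
  - \sum_e christoffel G e a b x * ricci G e c x
  - \sum_e christoffel G e a c x * ricci G b e x.

Definition grad G f x : 'rV[R]_n := (\row_a partial a f x) *m invmx (G x).

(* The Hessian as a bilinear form; the self-adjoint operator it represents is
   obtained by raising an index with G. *)
Definition hessian G f x : 'M[R]_n :=
  \matrix_(a, b) (partial a (partial b f) x
                  - \sum_c christoffel G c a b x * partial c f x).

Definition laplacian G f x : R := \tr (invmx (G x) *m hessian G f x).

End Coordinates.

(* A smooth n-manifold without boundary, presented by a smooth atlas, with a
   Riemannian metric.  The maps [coord c] and [point c] are total but carry
   information only on [dom c] and its image.  No countability axiom is
   included: it is automatic for the compact manifolds considered here. *)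
Record riemannianManifold (R : realType) (n : nat) := RiemannianManifold {
  carrier :> topologicalType;
  chart : Type;
  dom : chart -> set carrier;
  coord : chart -> carrier -> 'rV[R]_n;
  point : chart -> 'rV[R]_n -> carrier;
  metric : chart -> 'rV[R]_n -> 'M[R]_n;
  carrier_hausdorff : hausdorff_space carrier;
  dom_open : forall c, open (dom c);
  dom_cover : forall p, exists c, dom c p;
  image_open : forall c, open (coord c @` dom c);
  coordK : forall c p, dom c p -> point c (coord c p) = p;
  coord_continuous : forall c p, dom c p -> {for p, continuous (coord c)};
  point_continuous : forall c x, (coord c @` dom c) x ->
    {for x, continuous (point c)};
  transition_smooth : forall c d,
    smooth_on (coord c @` (dom c `&` dom d)) (coord d \o point c);
  metric_smooth : forall c i j,
    smooth_on (coord c @` dom c) (fun x => (metric c x i j : R^o));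
  metric_sym : forall c x, (coord c @` dom c) x -> (metric c x)^T = metric c x;
  metric_pos : forall c x, (coord c @` dom c) x ->
    forall v, v != 0 -> 0 < inner (metric c x) v v;
  (* ['J f x] acts on row vectors from the right *)
  metric_transition : forall c d p, dom c p -> dom d p ->
    let J := 'J (coord d \o point c) (coord c p) in
    metric c (coord c p) = J *m metric d (coord d p) *m J^T
}.

(* The functions below, and the conditions imposed on them, are expressed in
   a chart c around the point; since the coordinate expressions are tensorial,
   conditions are always required in every chart. *)
Section Manifold.
Context (R : realType) (n : nat) (M : riemannianManifold R n).
Implicit Types (c : chart M) (f h : M -> R) (p : M).

Definition metric_at c p : 'M[R]_n := metric c (coord c p).

Definition grad_at c f p : 'rV[R]_n :=
  grad (metric c) (f \o point c) (coord c p).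

Definition hessian_at c f p : 'M[R]_n :=
  hessian (metric c) (f \o point c) (coord c p).

Definition laplacian_at c f p : R :=
  laplacian (metric c) (f \o point c) (coord c p).

Definition smooth_fun f : Prop :=
  forall c, smooth_on (coord c @` dom c) (fun x => (f (point c x) : R^o)).

Definition nonneg_sectional_curvature : Prop :=
  forall c p, dom c p -> forall u v : 'rV[R]_n, row_free (col_mx u v) ->
    0 <= sectional (metric c) (coord c p) u v.

Definition parallel_ricci : Prop :=
  forall c p, dom c p -> forall i j k : 'I_n,
    nabla_ricci (metric c) i j k (coord c p) = 0.

Definition time_interval (J : set R) : Prop :=
  [/\ is_interval J, J 0 & forall t, J t -> 0 <= t].

Definition smooth_flow (J : set R) (rho : R -> M -> R) : Prop :=
  forall c, smooth_within [set tx : R * 'rV[R]_n | J tx.1 /\ (coord c @` dom c) tx.2]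
    (fun tx => (rho tx.1 (point c tx.2) : R^o)).

(* The time derivative is taken within J, hence one-sided at the endpoints. *)
Definition solves (J : set R) (U1 U2 : M -> R) (rho : R -> M -> R) : Prop :=
  forall t, J t -> forall c p, dom c p ->
    (fun s => (s - t)^-1 * (rho s p - rho t p)) @ within (J `\ t) (nbhs t) -->
      laplacian_at c (rho t) p
      + inner (metric_at c p) (grad_at c U1 p) (grad_at c (rho t) p)
      + U2 p * rho t p.

End Manifold.

Definition coth (R : realType) (x : R) : R :=
  (expR x + expR (- x)) / (expR x - expR (- x)).

Definition kcoth (R : realType) (k t : R) : R :=
  if k == 0 then t^-1 else k * coth (k * t).

(* Main.v *)
Require Import Defs.
From HB Require Import structures.
From mathcomp Require Import all_boot all_order all_algebra.
From mathcomp Require Import all_classical all_reals all_analysis.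
From mathcomp Require Import ring lra.

(* Put phi = ln rho + U1 / 2, H = Hess phi and W = Lap U1 + |grad U1|^2 / 2 - 2 U2,
   so that phi_t = Lap phi + |grad phi|^2 - W / 2.  Commuting derivatives, with
   parallel Ricci tensor,
     H_t = (rough Laplacian of H) + 2 nabla_{grad phi} H + 2 H^2
           + 2 Rm * H - Ric H - H Ric + 2 R(., grad phi, grad phi, .) - Hess W / 2.
   The function psi t = - k coth (k t) / 2 solves psi' = 2 psi^2 - k^2 / 2 and
   tends to - oo at 0.  If H >= psi g fails, then H(v, v) / g(v, v) - psi t has a
   negative minimum over times bounded away from 0, points and directions.  At
   this minimum, with mu = H(v, v) / g(v, v) < psi, one has H v = mu v, hence
   H^2(v, v) = mu^2 g(v, v); the gradient term vanishes, the rough Laplacian is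
   nonnegative, and the curvature terms are nonnegative because H - mu g >= 0 and
   the sectional curvature is nonnegative.  Hence
   H_t(v, v) >= (2 mu^2 - k^2 / 2) g(v, v) > psi' g(v, v), whereas minimality
   with respect to earlier times gives the opposite inequality. *)

Set Implicit Arguments.
Unset Strict Implicit.
Unset Printing Implicit Defensive.
Import Order.TTheory GRing.Theory Num.Theory.
Import numFieldNormedType.Exports.
(* [coord] and [point] below are those of [riemannianManifold]. *)
Import Defs.
Local Open Scope classical_set_scope.
Local Open Scope ring_scope.

(** * Tensor calculus over an abstract differential ring *)

(** Three obstacles shape the development. The tensor identities are long, so they are proved in a
    commutative ring with commuting derivations and brought back to functions by evaluation at
    points. The unit sphere bundle is never built: minima are taken on compact boxes in charts and
    compared across charts, which makes sense because the Hessian is tensorial. The solution is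
    smooth on a time interval that may contain its endpoints, so near each point it is replaced by a
    smooth extension to an open set of space-time.

    Parallel Ricci curvature enters because commuting the Hessian with the Laplacian produces
    derivatives of the curvature applied to d phi; once contracted, they are derivatives of the
    Ricci tensor. The curvature terms have a sign because H - mu g is a sum of squares of covectors,
    each of which contributes a sectional curvature; the remaining part mu g of H contributes 2 mu
    Ric, which cancels - Ric H - H Ric on (v, v). The strict inequality at the minimum comes from mu
    < psi < 0, which gives mu^2 > psi^2. *)

Section Tensor.
Variables (A : comPzRingType) (n : nat) (d : 'I_n -> A -> A).
Hypothesis dD : forall a, {morph d a : x y / x + y}.
Hypothesis dM : forall a x y, d a (x * y) = d a x * y + x * d a y.
Hypothesis dC : forall a b x, d a (d b x) = d b (d a x).
Hypothesis double_inj : forall x : A, x + x = 0 -> x = 0.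

Lemma d0 a : d a 0 = 0.
Proof. by apply: (addIr (d a 0)); rewrite -dD !add0r. Qed.

Lemma dN a x : d a (- x) = - d a x.
Proof. by apply/eqP; rewrite -addr_eq0 -dD addNr d0. Qed.

Lemma d_sum a (I : Type) (r : seq I) (F : I -> A) :
  d a (\sum_(i <- r) F i) = \sum_(i <- r) d a (F i).
Proof. exact: (big_morph (d a) (dD a) (d0 a)). Qed.

Definition dm a m p (X : 'M[A]_(m, p)) := map_mx (d a) X.

Lemma dmE a m p (X : 'M[A]_(m, p)) i j : dm a X i j = d a (X i j).
Proof. by rewrite mxE. Qed.

Lemma dmD a m p (X Y : 'M[A]_(m, p)) : dm a (X + Y) = dm a X + dm a Y.
Proof. by apply/matrixP => i j; rewrite !mxE dD. Qed.

Lemma dmN a m p (X : 'M[A]_(m, p)) : dm a (- X) = - dm a X.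
Proof. by apply/matrixP => i j; rewrite !mxE dN. Qed.

Lemma dmM a m p q (X : 'M[A]_(m, p)) (Y : 'M[A]_(p, q)) :
  dm a (X *m Y) = dm a X *m Y + X *m dm a Y.
Proof.
apply/matrixP => i j; rewrite !mxE d_sum -big_split /=.
by apply: eq_bigr => k _; rewrite dM !mxE.
Qed.

Lemma dmT a m p (X : 'M[A]_(m, p)) : dm a X^T = (dm a X)^T.
Proof. by apply/matrixP => i j; rewrite !mxE. Qed.

Lemma dmC a b m p (X : 'M[A]_(m, p)) : dm a (dm b X) = dm b (dm a X).
Proof. by apply/matrixP => i j; rewrite !mxE dC. Qed.

Lemma dmZ a m p x (X : 'M[A]_(m, p)) : dm a (x *: X) = d a x *: X + x *: dm a X.
Proof. by apply/matrixP => i j; rewrite !mxE dM. Qed.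

Lemma addmxE m p (X Y : 'M[A]_(m, p)) i j : (X + Y) i j = X i j + Y i j.
Proof. by rewrite mxE. Qed.

Lemma oppmxE m p (X : 'M[A]_(m, p)) i j : (- X) i j = - X i j.
Proof. by rewrite mxE. Qed.

Lemma scalemxE m p x (X : 'M[A]_(m, p)) i j : (x *: X) i j = x * X i j.
Proof. by rewrite mxE. Qed.

Lemma trmxD m p (X Y : 'M[A]_(m, p)) : (X + Y)^T = X^T + Y^T.
Proof. by apply/matrixP => i j; rewrite !mxE. Qed.

Lemma trmxN m p (X : 'M[A]_(m, p)) : (- X)^T = - X^T.
Proof. by apply/matrixP => i j; rewrite !mxE. Qed.

(** * Metric and Levi-Civita connection *)

Variables (g gi : 'M[A]_n).
Hypotheses (gT : g^T = g) (giT : gi^T = gi).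
Hypotheses (ggi : g *m gi = 1%:M) (gig : gi *m g = 1%:M).
Variable half : A.
Hypothesis half2 : half + half = 1.

(* Row [b] of [lc a] holds the components of [nabla_a e_b]. *)
Definition lc a : 'M[A]_n := \matrix_(b, c)
  (half * \sum_e gi c e * (d a (g b e) + d b (g a e) - d e (g a b))).

Lemma lcC a b c : lc a b c = lc b a c.
Proof.
rewrite !mxE; congr (_ * _); apply: eq_bigr => e _; congr (_ * _).
have -> : g b a = g a b by rewrite -{1}gT mxE.
by ring.
Qed.

Lemma lc_lower a b c :
  (lc a *m g) b c = half * (d a (g b c) + d b (g a c) - d c (g a b)).
Proof.
set k := fun e => d a (g b e) + d b (g a e) - d e (g a b).
have -> : (lc a *m g) b c = half * (\sum_f (\sum_e gi f e * k e) * g f c).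
  rewrite mxE mulr_sumr; apply: eq_bigr => f _; rewrite mxE; ring.
congr (_ * _); under eq_bigr do rewrite mulr_suml.
rewrite exchange_big /= -[RHS]/(k c).
have E e : \sum_f gi f e * k e * g f c = k e * (gi *m g) e c.
  rewrite mxE mulr_sumr; apply: eq_bigr => f _.
  by rewrite -{1}giT mxE; ring.
under eq_bigr do rewrite E gig mxE.
rewrite (bigD1 c) //= eqxx mulr1 big1 ?addr0 // => e ec.
by rewrite (negbTE ec) mulr0.
Qed.

Lemma lc_metric a : dm a g = lc a *m g + g *m (lc a)^T.
Proof.
have -> : g *m (lc a)^T = (lc a *m g)^T by rewrite trmx_mul gT.
apply/matrixP => b c; rewrite dmE addmxE [_^T _ _]mxE !lc_lower.
have gC x y : g x y = g y x by rewrite -{1}gT mxE.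
rewrite (gC c b) (gC a c) (gC a b) -[LHS]mul1r -half2; ring.
Qed.

(** * Curvature of an arbitrary torsion-free metric connection *)

Variable Gam : 'I_n -> 'M[A]_n.
Hypothesis GamC : forall a b c, Gam a b c = Gam b a c.
Hypothesis dg : forall a, dm a g = Gam a *m g + g *m (Gam a)^T.

Lemma d1 a : d a 1 = 0.
Proof. by apply: (addIr (d a 1)); rewrite add0r -{3}[1]mulr1 dM mulr1 mul1r. Qed.

(** Differentiate [gi *m g = 1%:M]: the inverse metric is parallel as well. *)
Lemma dgi a : dm a gi = - ((Gam a)^T *m gi + gi *m Gam a).
Proof.
have E : dm a (gi *m g) = 0.
  by rewrite gig; apply/matrixP => i j; rewrite !mxE; case: (i == j);
     rewrite ?d0 ?d1.
have := congr1 (mulmx^~ gi) E; rewrite dmM dg mul0mx mulmxDl -mulmxA ggi mulmx1.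
rewrite mulmxDr !mulmxA gig mul1mx mulmxDl -!mulmxA ggi mulmx1.
by move=> /eqP; rewrite addr_eq0 addrC => /eqP ->; rewrite addrC.
Qed.

(* Row [c] of [rm a b] holds the components of [R(e_a, e_b) e_c]. *)
Definition rm a b : 'M[A]_n :=
  dm a (Gam b) - dm b (Gam a) + Gam b *m Gam a - Gam a *m Gam b.

Lemma rmE a b c e : rm a b c e = d a (Gam b c e) - d b (Gam a c e)
   + \sum_f (Gam a f e * Gam b c f - Gam b f e * Gam a c f).
Proof.
rewrite sumrB /rm !(addmxE, oppmxE) !dmE addrA !mxE.
by congr (_ + _ - _); apply: eq_bigr => f _; rewrite mulrC.
Qed.

Definition rml a b := rm a b *m g.

Lemma rmN a b : rm b a = - rm a b.
Proof. by apply/matrixP => i j; rewrite !(addmxE, oppmxE); ring. Qed.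

Lemma rmlN a b : rml b a = - rml a b.
Proof. by rewrite /rml rmN mulNmx. Qed.

(** The mixed second derivatives of [g] agree. Expanded by metric compatibility, their difference is
    the symmetric part of [rml a b]. *)
Lemma rml_alt a b : (rml a b)^T = - rml a b.
Proof.
have := dmC a b g; rewrite !dg !(dmD, dmM, dmT, dg) !(mulmxDl, mulmxDr) !mulmxA.
move=> /matrixP E; apply/matrixP => i j; move: (E i j).
rewrite /rml /rm trmx_mul gT !(trmxD, trmxN).
rewrite !(mulmxDl, mulmxDr, mulNmx, mulmxN). rewrite !trmx_mul !mulmxA !(addmxE, oppmxE) => {}E.
apply/eqP; rewrite -subr_eq0; move/eqP: E; rewrite -subr_eq0 => /eqP E.
by rewrite -[X in _ == X]E; apply/eqP; ring.
Qed.

(** Torsion-freeness lets the direction of the left factor change places with its row index; this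
    aligns the quadratic terms of the first Bianchi identity. *)
Lemma mulGC x (y : 'M[A]_n) z w : (Gam x *m y) z w = (Gam z *m y) x w.
Proof. by rewrite !mxE; under eq_bigr do rewrite GamC. Qed.

Lemma rm_bianchi1 a b c e : rm a b c e + rm b c a e + rm c a b e = 0.
Proof.
rewrite /rm !(addmxE, oppmxE) !dmE.
rewrite (GamC c a) (GamC c b) (GamC b a).
rewrite (mulGC c _ a) (mulGC c _ b) (mulGC b _ a).
ring.
Qed.

Lemma rml_bianchi1 a b c e : rml a b c e + rml b c a e + rml c a b e = 0.
Proof.
rewrite !mxE -!big_split /= big1 // => i _.
by rewrite -!mulrDl rm_bianchi1 mul0r.
Qed.

Lemma rml_altE a b c e : rml a b e c = - rml a b c e.
Proof. by have /matrixP/(_ c e) := rml_alt a b; rewrite !mxE. Qed.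

Lemma rmlNE a b c e : rml b a c e = - rml a b c e.
Proof. by rewrite rmlN mxE. Qed.

(** The octahedron argument: four first Bianchi identities, taken with alternating signs, add up to
    twice the difference of the two sides, and [double_inj] removes the factor. *)
Lemma rml_pair a b c e : rml a b c e = rml c e a b.
Proof.
apply/eqP; rewrite -subr_eq0; apply/eqP; apply: double_inj.
have -> : rml a b c e - rml c e a b + (rml a b c e - rml c e a b)
   = (rml a b c e + rml b c a e + rml c a b e)
   - (rml e a b c + rml a b e c + rml b e a c)
   + (rml b c e a + rml c e b a + rml e b c a)
   - (rml c e a b + rml e a c b + rml a c e b).
  rewrite (rml_altE a b c e) (rml_altE b c a e) (rml_altE c e a b).
  rewrite (rmlNE a c b e) (rmlNE b e c a) (rml_altE b e a c) (rml_altE e a b c).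
  rewrite (rml_altE a c b e); ring.
by rewrite !rml_bianchi1 !(subr0, addr0).
Qed.

Definition cor k i l : 'M[A]_n := \sum_e Gam k i e *: rm e l.

Lemma corC k i l : cor k i l = cor i k l.
Proof. by apply: eq_bigr => e _; rewrite GamC. Qed.

(* Covariant derivative of [rm]; the [cor] terms account for its first two indices. *)
Definition nrm k i l : 'M[A]_n :=
  dm k (rm i l) - Gam k *m rm i l + rm i l *m Gam k - cor k i l + cor k l i.

(** The [cor] terms cancel cyclically by [corC]. What is left is the Jacobi identity for the
    commutators of covariant derivatives. *)
Lemma nrm_bianchi2 k i l : nrm k i l + nrm i l k + nrm l k i = 0.
Proof.
rewrite /nrm (corC l k) (corC l i) (corC i k).
(* Each of the three cyclic terms is expanded separately, with mixed second derivatives in the same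
   order throughout, so that the final entrywise [ring] sees every cancellation. *)
have -> : dm k (rm i l) - Gam k *m rm i l + rm i l *m Gam k
  = dm k (dm i (Gam l)) - dm k (dm l (Gam i))
   + dm k (Gam l) *m Gam i + Gam l *m dm k (Gam i)
   - dm k (Gam i) *m Gam l - Gam i *m dm k (Gam l)
   - Gam k *m dm i (Gam l) + Gam k *m dm l (Gam i)
   - Gam k *m Gam l *m Gam i + Gam k *m Gam i *m Gam l
   + dm i (Gam l) *m Gam k - dm l (Gam i) *m Gam k
   + Gam l *m Gam i *m Gam k - Gam i *m Gam l *m Gam k.
  rewrite /rm !(dmD, dmM, dmN) !(mulmxDl, mulmxDr, mulNmx, mulmxN) !mulmxA.
  by apply/matrixP => x y; rewrite !(addmxE, oppmxE); ring.
have -> : dm i (rm l k) - Gam i *m rm l k + rm l k *m Gam i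
  = dm i (dm l (Gam k)) - dm k (dm i (Gam l))
   + dm i (Gam k) *m Gam l + Gam k *m dm i (Gam l)
   - dm i (Gam l) *m Gam k - Gam l *m dm i (Gam k)
   - Gam i *m dm l (Gam k) + Gam i *m dm k (Gam l)
   - Gam i *m Gam k *m Gam l + Gam i *m Gam l *m Gam k
   + dm l (Gam k) *m Gam i - dm k (Gam l) *m Gam i
   + Gam k *m Gam l *m Gam i - Gam l *m Gam k *m Gam i.
  rewrite (dmC k) /rm !(dmD, dmM, dmN) !(mulmxDl, mulmxDr, mulNmx, mulmxN) !mulmxA.
  by apply/matrixP => x y; rewrite !(addmxE, oppmxE); ring.
have -> : dm l (rm k i) - Gam l *m rm k i + rm k i *m Gam l
  = dm k (dm l (Gam i)) - dm i (dm l (Gam k))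
   + dm l (Gam i) *m Gam k + Gam i *m dm l (Gam k)
   - dm l (Gam k) *m Gam i - Gam k *m dm l (Gam i)
   - Gam l *m dm k (Gam i) + Gam l *m dm i (Gam k)
   - Gam l *m Gam i *m Gam k + Gam l *m Gam k *m Gam i
   + dm k (Gam i) *m Gam l - dm i (Gam k) *m Gam l
   + Gam i *m Gam k *m Gam l - Gam k *m Gam i *m Gam l.
  rewrite (dmC k) (dmC i) /rm !(dmD, dmM, dmN) !(mulmxDl, mulmxDr, mulNmx, mulmxN) !mulmxA.
  by apply/matrixP => x y; rewrite !(addmxE, oppmxE); ring.
by apply/matrixP => x y; rewrite !(addmxE, oppmxE) [RHS]mxE; ring.
Qed.

Lemma nrmN k i l : nrm k l i = - nrm k i l.
Proof.
rewrite /nrm (rmN i l) dmN mulmxN mulNmx.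
by apply/matrixP => x y; rewrite !(addmxE, oppmxE); ring.
Qed.

Definition nrml k i l : 'M[A]_n := nrm k i l *m g.

Lemma corlE k i l : cor k i l *m g = \sum_e Gam k i e *: rml e l.
Proof. by rewrite mulmx_suml; apply: eq_bigr => e _; rewrite -scalemxAl. Qed.

Lemma nrmlE k i l : nrml k i l =
  dm k (rml i l) - Gam k *m rml i l - rml i l *m (Gam k)^T
  - cor k i l *m g + cor k l i *m g.
Proof.
rewrite /rml dmM dg.
rewrite /nrml /nrm !(mulmxDl, mulmxDr, mulNmx, mulmxN) !mulmxA.
move: (cor k i l *m g) (cor k l i *m g) => c1 c2.
by apply/matrixP => x y; rewrite !(addmxE, oppmxE); ring.
Qed.

(** Pair symmetry survives covariant differentiation: it turns the connection terms of the last two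
    indices into the [cor] terms of the first two. *)
Lemma nrml_pair k i l j m : nrml k i l j m = nrml k j m i l.
Proof.
have E1 x y z w : (Gam k *m rml x y) z w = (cor k z w *m g) x y.
  rewrite corlE summxE mxE; apply: eq_bigr => e _.
  by rewrite [RHS]mxE (rml_pair x y).
have E2 x y z w : (rml x y *m (Gam k)^T) z w = - (cor k w z *m g) x y.
  rewrite corlE summxE mxE -sumrN; apply: eq_bigr => e _.
  by rewrite [in RHS]mxE [X in _ * X]mxE (rml_pair x y) rmlNE mulrC mulrN.
rewrite !nrmlE !(addmxE, oppmxE) !dmE (rml_pair i l j m) !E1 !E2.
by ring.
Qed.

(** * Ricci tensor and contracted Bianchi identity *)

Definition ric : 'M[A]_n := \matrix_(b, c) \sum_a rm a b c a.

(** Covariant derivative of a bilinear form along the coordinate field e_k. *)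
Definition nab k (X : 'M[A]_n) := dm k X - Gam k *m X - X *m (Gam k)^T.

Definition nric k : 'M[A]_n := nab k ric.

Lemma nrmE k i l x y : nrm k i l x y = d k (rm i l x y) - (Gam k *m rm i l) x y
  + (rm i l *m Gam k) x y - cor k i l x y + cor k l i x y.
Proof.
rewrite -dmE /nrm.
move: (dm k (rm i l)) (Gam k *m _) (_ *m Gam k) (cor k i l) (cor k l i) => X Y Z U V.
by rewrite !(addmxE, oppmxE).
Qed.

(** Contraction commutes with covariant differentiation: the connection terms belonging to the two
    contracted indices cancel each other. *)
Lemma nrm_trace k i j : \sum_a nrm k a i j a = nric k i j.
Proof.
have -> : \sum_a nrm k a i j a = \sum_a d k (rm a i j a)
  - \sum_a (Gam k *m rm a i) j a + \sum_a (rm a i *m Gam k) j a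
  - \sum_a cor k a i j a + \sum_a cor k i a j a.
  rewrite -!sumrN -!big_split; apply: eq_bigr => a _ /=.
  by rewrite nrmE.
have -> : \sum_a cor k a i j a = \sum_a (rm a i *m Gam k) j a.
  rewrite (eq_bigr (fun a => \sum_b Gam k a b * rm b i j a)); last first.
    by move=> a _; rewrite summxE; apply: eq_bigr => b _; rewrite [LHS]mxE.
  rewrite exchange_big; apply: eq_bigr => a _; rewrite mxE.
  by apply: eq_bigr => b _; rewrite mulrC.
have -> : \sum_a cor k i a j a = - (Gam k *m ric) i j.
  rewrite mxE -sumrN.
  rewrite (eq_bigr (fun a => \sum_b Gam k i b * rm b a j a)); last first.
    by move=> a _; rewrite summxE; apply: eq_bigr => b _; rewrite [LHS]mxE.
  rewrite exchange_big; apply: eq_bigr => b _; rewrite [ric b j]mxE -mulr_sumr -mulrN.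
  by rewrite -sumrN; congr (_ * _); apply: eq_bigr => c _; rewrite (rmN c b) oppmxE.
have -> : \sum_a (Gam k *m rm a i) j a = (ric *m (Gam k)^T) i j.
  rewrite [RHS]mxE (eq_bigr (fun a => \sum_b Gam k j b * rm a i b a)); last first.
    by move=> a _; rewrite [LHS]mxE.
  rewrite exchange_big; apply: eq_bigr => a _; rewrite [_^T _ _]mxE [ric _ _]mxE.
  by rewrite mulr_suml; apply: eq_bigr => b _; rewrite mulrC.
have -> : \sum_a d k (rm a i j a) = d k (ric i j) by rewrite mxE d_sum.
by rewrite /nric /nab !(addmxE, oppmxE) dmE; ring.
Qed.

Hypothesis ric_parallel : forall k, nric k = 0.

Lemma contract_lower (X : 'I_n -> 'M[A]_n) c :
  \sum_k \sum_l gi k l * (X k *m g) c l = \sum_k X k c k.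
Proof.
apply: eq_bigr => k _; transitivity ((X k *m g *m gi) c k).
  by rewrite [RHS]mxE; apply: eq_bigr => l _; rewrite -{1}giT mxE mulrC.
by rewrite -mulmxA ggi mulmx1.
Qed.

Lemma rml_trace b c : \sum_k \sum_l gi k l * rml b k c l = - ric b c.
Proof.
rewrite contract_lower mxE -sumrN; apply: eq_bigr => k _.
by rewrite (rmN k b) oppmxE.
Qed.

Lemma nrml_trace a b c : \sum_k \sum_l gi k l * nrml a b k c l = 0.
Proof.
rewrite contract_lower.
have -> : \sum_k nrm a b k c k = - nric a b c.
  by rewrite -nrm_trace -sumrN; apply: eq_bigr => k _; rewrite nrmN oppmxE.
by rewrite ric_parallel mxE oppr0.
Qed.

(* By the second Bianchi identity and the pair symmetry, the divergence of the
   curvature is the antisymmetrised derivative of the Ricci tensor. *)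
Lemma div_rml i j m : \sum_k \sum_l gi k l * nrml k i l j m = 0.
Proof.
have B k l : nrml k i l j m = - nrml j m k i l + nrml m j k i l.
  have E : nrm k j m = - nrm j m k + nrm m j k.
    apply/eqP; rewrite -subr_eq0 -(nrm_bianchi2 k j m) (nrmN m j k) opprD opprK.
    by rewrite addrA.
  rewrite nrml_pair /nrml E mulmxDl mulNmx.
  move: (nrm j m k *m g) (nrm m j k *m g) => X Y.
  by rewrite addmxE oppmxE.
under eq_bigr do under eq_bigr do rewrite B mulrDr mulrN.
under eq_bigr do rewrite big_split /= sumrN.
by rewrite big_split /= sumrN !nrml_trace oppr0 addr0.
Qed.

(** * Hessian and its commutation with the Laplacian *)

Definition om f : 'cV[A]_n := \col_b d b f.

Definition hes f : 'M[A]_n :=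
  \matrix_(a, b) (d a (d b f) - \sum_c Gam a b c * d c f).

Lemma hesC f a b : hes f a b = hes f b a.
Proof. by rewrite !mxE dC; under eq_bigr do rewrite GamC. Qed.

Lemma hesT f : (hes f)^T = hes f.
Proof. by apply/matrixP => a b; rewrite mxE hesC. Qed.

Lemma nabT k X : (nab k X)^T = nab k X^T.
Proof.
rewrite /nab !(trmxD, trmxN, trmx_mul) trmxK dmT.
by apply/matrixP => i j; rewrite !(addmxE, oppmxE); ring.
Qed.

Lemma nabE k X i j : nab k X i j = d k (X i j) - \sum_e Gam k i e * X e j
   - \sum_e Gam k j e * X i e.
Proof.
rewrite /nab !(addmxE, oppmxE) dmE; congr (_ - _ - _); rewrite mxE //.
by apply: eq_bigr => e _; rewrite mxE mulrC.
Qed.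

Definition hescol f i : 'cV[A]_n := \col_j hes f i j.

Lemma hescolE f i : hescol f i = dm i (om f) - Gam i *m om f.
Proof.
apply/matrixP => j z; rewrite addmxE oppmxE !mxE; congr (_ - _).
by apply: eq_bigr => c _; rewrite mxE.
Qed.

Lemma nab_hescol f a i j : nab a (hes f) i j =
  (dm a (hescol f i) - Gam a *m hescol f i) j 0 - \sum_e Gam a i e * hes f e j.
Proof.
rewrite nabE addmxE oppmxE dmE [hescol f i j 0]mxE addrAC; congr (_ - _ - _).
by rewrite [RHS]mxE; apply: eq_bigr => e _; rewrite [hescol _ _ _ _]mxE.
Qed.

(** Ricci identity for the covector [om f]: the connection term of the differentiated index is
    symmetric in [a] and [i], so exchanging them costs only a commutator. *)
Lemma codazzi f a i j :
  nab a (hes f) i j = nab i (hes f) a j - (rm a i *m om f) j 0.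
Proof.
rewrite !nab_hescol; under eq_bigr do rewrite GamC.
move: (\sum_e _) => c.
have -> : dm a (hescol f i) - Gam a *m hescol f i =
  dm i (hescol f a) - Gam i *m hescol f a - rm a i *m om f.
  rewrite !hescolE !(dmD, dmN, dmM) (dmC i) /rm.
  rewrite !(mulmxDl, mulmxDr, mulNmx, mulmxN) !mulmxA.
  by apply/matrixP => x y; rewrite !(addmxE, oppmxE); ring.
move: (rm a i *m _) => X; rewrite addmxE oppmxE; ring.
Qed.

(** Second covariant derivative: subtracting the derivative along nabla_{e_i} e_k makes it tensorial
    in [i] and [k]. *)
Definition nab2 i k X := nab i (nab k X) - \sum_e Gam i k e *: nab e X.

Lemma nab2_comm i k X :
  nab2 i k X = nab2 k i X - (rm i k *m X + X *m (rm i k)^T).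
Proof.
rewrite /nab2; under eq_bigr do rewrite GamC.
move: (\sum_e _) => c; rewrite /nab /rm !(dmD, dmN, dmM, dmT) (dmC i).
rewrite !(trmxD, trmxN, trmx_mul).
rewrite !(mulmxDl, mulmxDr, mulNmx, mulmxN) !mulmxA.
by apply/matrixP => x y; rewrite !(addmxE, oppmxE); ring.
Qed.

Lemma nab2T i k X : (nab2 i k X)^T = nab2 i k X^T.
Proof.
rewrite /nab2 trmxD trmxN nabT nabT; congr (_ - _).
apply/matrixP => x y; rewrite mxE !summxE; apply: eq_bigr => e _.
by rewrite [LHS]mxE [RHS]mxE -nabT [in RHS]mxE.
Qed.

Lemma nab2_hesC f i k a b : nab2 i k (hes f) a b = nab2 i k (hes f) b a.
Proof. by rewrite -[in LHS]hesT -nab2T mxE. Qed.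

(** This is [codazzi] differentiated once more. The derivative falls either on the curvature, giving
    [nrm], or on the differential of [f], giving a column of the Hessian. *)
Lemma nab2_swap f i j k l : nab2 i j (hes f) k l =
  nab2 i k (hes f) j l - (nrm i j k *m om f + rm j k *m hescol f i) l 0.
Proof.
have E x y z (X : 'M[A]_n) w : nab2 x y X z w = d x (nab y X z w)
   - \sum_e Gam x z e * nab y X e w - \sum_e Gam x w e * nab y X z e
   - \sum_e Gam x y e * nab e X z w.
  rewrite /nab2 addmxE oppmxE (nabE x (nab y X)) summxE; congr (_ - _).
  by apply: eq_bigr => e _; rewrite mxE.
have cdz x y z : nab x (hes f) y z - nab y (hes f) x z = - (rm x y *m om f) z 0.
  by rewrite codazzi addrAC subrr add0r.
have corE x y z : (cor x y z *m om f) l 0 =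
    \sum_e Gam x y e * (rm e z *m om f) l 0.
  rewrite /cor mulmx_suml summxE; apply: eq_bigr => e _.
  by rewrite -scalemxAl [LHS]mxE.
have -> : nrm i j k *m om f + rm j k *m hescol f i =
   dm i (rm j k *m om f) - Gam i *m (rm j k *m om f) - cor i j k *m om f
   + cor i k j *m om f.
  rewrite hescolE dmM /nrm.
  move: (cor i j k) (cor i k j) (rm j k) => X Y Z.
  rewrite !(mulmxDl, mulmxDr, mulNmx, mulmxN) !mulmxA.
  by apply/matrixP => x y; rewrite !(addmxE, oppmxE); ring.
have -> : (dm i (rm j k *m om f) - Gam i *m (rm j k *m om f) - cor i j k *m om f
   + cor i k j *m om f) l 0 = d i ((rm j k *m om f) l 0)
     - (Gam i *m (rm j k *m om f)) l 0 - (cor i j k *m om f) l 0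
     + (cor i k j *m om f) l 0.
  rewrite -dmE.
  move: (dm i _) (Gam i *m _) (cor i j k *m _) (cor i k j *m _) => X Y Z U.
  by rewrite !(addmxE, oppmxE).
rewrite !corE [(Gam i *m _) l 0]mxE.
have -> : \sum_e Gam i l e * (rm j k *m om f) e 0 =
   \sum_e Gam i l e * nab k (hes f) j e - \sum_e Gam i l e * nab j (hes f) k e.
  rewrite -sumrB; apply: eq_bigr => e _; rewrite -mulrBr; congr (_ * _).
  by rewrite -[LHS]opprK -cdz opprB.
have -> : \sum_e Gam i j e * (rm e k *m om f) l 0 =
   \sum_e Gam i j e * nab k (hes f) e l - \sum_e Gam i j e * nab e (hes f) k l.
  rewrite -sumrB; apply: eq_bigr => e _; rewrite -mulrBr; congr (_ * _).
  by rewrite -[LHS]opprK -cdz opprB.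
have -> : \sum_e Gam i k e * (rm e j *m om f) l 0 =
   \sum_e Gam i k e * nab j (hes f) e l - \sum_e Gam i k e * nab e (hes f) j l.
  rewrite -sumrB; apply: eq_bigr => e _; rewrite -mulrBr; congr (_ * _).
  by rewrite -[LHS]opprK -cdz opprB.
have -> : (rm j k *m om f) l 0 = nab k (hes f) j l - nab j (hes f) k l.
  by rewrite -[LHS]opprK -cdz opprB.
rewrite !E dD dN; ring.
Qed.

Lemma trN (X : 'M[A]_n) : \tr (- X) = - \tr X.
Proof. exact: raddfN. Qed.

(** Contraction with [gi] commutes with differentiation because [gi] is parallel. *)
Lemma d_trace a X : d a (\tr (gi *m X)) = \tr (gi *m nab a X).
Proof.
have -> : d a (\tr (gi *m X)) = \tr (dm a (gi *m X)).
  by rewrite /mxtrace d_sum; apply: eq_bigr => i _; rewrite dmE.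
rewrite dmM dgi /nab !(mulmxDr, mulmxN, mulNmx, mulmxDl) !(mxtraceD, trN) -[(Gam a)^T *m gi *m X]mulmxA mxtrace_mulC !mulmxA; ring.
Qed.

Definition lap f := \tr (gi *m hes f).

Lemma hes_lap_trace f i j : hes (lap f) i j = \tr (gi *m nab2 i j (hes f)).
Proof.
have -> : gi *m nab2 i j (hes f) =
    gi *m nab i (nab j (hes f)) - \sum_e Gam i j e *: (gi *m nab e (hes f)).
  rewrite /nab2; move: (nab i _) => X; rewrite mulmxDr mulmxN mulmx_sumr.
  by congr (_ - _); apply: eq_bigr => e _; rewrite -scalemxAr.
rewrite mxE /lap !d_trace mxtraceD trN; congr (_ - _); rewrite raddf_sum /=.
by apply: eq_bigr => e _; rewrite d_trace mxtraceZ.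
Qed.

Lemma trace_gi X : \tr (gi *m X) = \sum_k \sum_l gi k l * X k l.
Proof.
rewrite exchange_big; apply: eq_bigr => l _ /=.
by rewrite mxE; apply: eq_bigr => k _; rewrite -{1}giT mxE.
Qed.

(** The Hessian of the Laplacian is the Lichnerowicz Laplacian of the Hessian. In general there are
    also terms with derivatives of the curvature; under parallel Ricci curvature their contractions
    vanish. *)
Lemma hes_lap f i j : hes (lap f) i j =
  \sum_k \sum_l gi k l * nab2 k l (hes f) i j
  - 2 * (\sum_k (rml i k *m (gi *m hes f *m gi)) j k)
  - (hes f *m gi *m ric) j i - (hes f *m gi *m ric) i j.
Proof.
set H := hes f.
have rmE a b (m : nat) (X : 'M[A]_(n, m)) : rm a b *m X = rml a b *m (gi *m X).
  by rewrite /rml mulmxA -[_ *m g *m gi]mulmxA ggi mulmx1.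
have nrmE' a b c (m : nat) (X : 'M[A]_(n, m)) : nrm a b c *m X = nrml a b c *m (gi *m X).
  by rewrite /nrml mulmxA -[_ *m g *m gi]mulmxA ggi mulmx1.
(* Three exchanges lead from one fourth-order term to the other: [j] with [k], then the two
   derivatives [i] and [k], then [i] with [l]. Each costs curvature terms. *)
have step k l : nab2 i j H k l = nab2 k l H i j
  - ((rm i k *m H) j l + (H *m (rm i k)^T) j l)
  - ((nrm i j k *m om f) l 0 + (rm j k *m hescol f i) l 0)
  - ((nrm k i l *m om f) j 0 + (rm i l *m hescol f k) j 0).
  rewrite (nab2_swap f i j k l) (nab2_comm i k) -/H.
  have -> : (nab2 k i H - (rm i k *m H + H *m (rm i k)^T)) j l =
     nab2 k i H l j - ((rm i k *m H) j l + (H *m (rm i k)^T) j l).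
    rewrite -[nab2 k i H l j]nab2_hesC -/H.
    move: (nab2 k i H) (rm i k *m H) (H *m _) => X Y Z.
    by rewrite !(addmxE, oppmxE).
  rewrite (nab2_swap f k i l j) -/H.
  have addE (X Y : 'cV[A]_n) x : (X + Y) x 0 = X x 0 + Y x 0 by rewrite mxE.
  rewrite (addE (nrm i j k *m om f)) (addE (nrm k i l *m om f)).
  ring.
rewrite hes_lap_trace -/H trace_gi.
have -> : \sum_k \sum_l gi k l * nab2 i j H k l =
  \sum_k \sum_l gi k l * nab2 k l H i j
  - \sum_k \sum_l gi k l * (rm i k *m H) j l
  - \sum_k \sum_l gi k l * (H *m (rm i k)^T) j l
  - \sum_k \sum_l gi k l * (nrm i j k *m om f) l 0
  - \sum_k \sum_l gi k l * (rm j k *m hescol f i) l 0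
  - \sum_k \sum_l gi k l * (nrm k i l *m om f) j 0
  - \sum_k \sum_l gi k l * (rm i l *m hescol f k) j 0.
  rewrite -!sumrB; apply: eq_bigr => k _; rewrite -!sumrB; apply: eq_bigr => l _.
  rewrite step; ring.
have exch (F G : 'I_n -> 'I_n -> 'I_n -> A) (w : 'I_n -> A) :
    (forall k l m, F k l m = G k l m * w m) ->
    \sum_k \sum_l gi k l * (\sum_m F k l m) =
    \sum_m (\sum_k \sum_l gi k l * G k l m) * w m.
  move=> FG; under [RHS]eq_bigr do rewrite mulr_suml.
  rewrite [RHS]exchange_big; apply: eq_bigr => k _ /=.
  under [RHS]eq_bigr do rewrite mulr_suml.
  rewrite [RHS]exchange_big; apply: eq_bigr => l _ /=.
  by rewrite mulr_sumr; apply: eq_bigr => m _; rewrite FG mulrA.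
(* This term is a trace giving the derivative of the Ricci tensor; the other one with a derivative
   of the curvature is a divergence, killed by [div_rml]. *)
have -> : \sum_k \sum_l gi k l * (nrm i j k *m om f) l 0 = 0.
  under eq_bigr do under eq_bigr do rewrite nrmE' mxE.
  rewrite (exch _ (fun k l m => nrml i j k l m) (fun m => (gi *m om f) m 0)) //.
  rewrite big1 // => m _; rewrite (_ : \sum_k _ = 0) ?mul0r //.
  apply: etrans (_ : - (\sum_k \sum_l gi k l * nrml i m k j l) = 0); last first.
    by rewrite nrml_trace oppr0.
  rewrite -sumrN exchange_big.
  apply: eq_bigr => l _; rewrite -sumrN; apply: eq_bigr => k _ /=.
  rewrite -[in LHS]giT mxE nrml_pair /nrml (nrmN i m l) mulNmx.
  by move: (_ *m g) => X; rewrite oppmxE mulrN.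
have -> : \sum_k \sum_l gi k l * (nrm k i l *m om f) j 0 = 0.
  under eq_bigr do under eq_bigr do rewrite nrmE' mxE.
  rewrite (exch _ (fun k l m => nrml k i l j m) (fun m => (gi *m om f) m 0)) //.
  by rewrite big1 // => m _; rewrite div_rml mul0r.
have ricE b m : \sum_k \sum_l gi k l * rm b k l m = (gi *m ric) m b.
  have rmgi k l : rm b k l m = \sum_p rml b k l p * gi p m.
    have -> : rm b k = rml b k *m gi by rewrite /rml -mulmxA ggi mulmx1.
    by rewrite mxE.
  under eq_bigr do under eq_bigr do rewrite rmgi.
  rewrite (exch _ (fun k l p => rml b k l p) (fun p => gi p m)) // mxE.
  apply: eq_bigr => p _; rewrite mulrC -[in LHS]giT [gi^T _ _]mxE giT.
  congr (_ * _); rewrite -[RHS]opprK -rml_trace exchange_big -sumrN.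
  apply: eq_bigr => l _; rewrite -sumrN; apply: eq_bigr => k _ /=.
  by rewrite -[in LHS]giT [gi^T _ _]mxE rml_pair rmlNE mulrN.
have -> : \sum_k \sum_l gi k l * (rm j k *m hescol f i) l 0 = (H *m gi *m ric) i j.
  under eq_bigr do under eq_bigr do rewrite mxE.
  rewrite (exch _ (fun k l m => rm j k l m) (fun m => H i m)); last first.
    by move=> k l m; rewrite [hescol _ _ _ _]mxE.
  rewrite -mulmxA [RHS]mxE; apply: eq_bigr => m _; rewrite ricE mulrC //.
have -> : \sum_k \sum_l gi k l * (H *m (rm i k)^T) j l = (H *m gi *m ric) j i.
  under eq_bigr do under eq_bigr do rewrite mxE.
  rewrite (exch _ (fun k l m => rm i k l m) (fun m => H j m)); last first.
    by move=> k l m; rewrite [_^T _ _]mxE mulrC.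
  rewrite -mulmxA [RHS]mxE; apply: eq_bigr => m _; rewrite ricE mulrC //.
have E3 : \sum_k \sum_l gi k l * (rm i k *m H) j l =
    \sum_k (rml i k *m (gi *m H *m gi)) j k.
  apply: eq_bigr => k _; rewrite -[gi *m H *m gi]mulmxA !mulmxA -[rml i k *m gi *m H]mulmxA.
  rewrite -rmE [RHS]mxE; apply: eq_bigr => l _.
  by rewrite mulrC -[in LHS]giT [gi^T _ _]mxE.
have -> : \sum_k \sum_l gi k l * (rm i l *m hescol f k) j 0 =
    \sum_k (rml i k *m (gi *m H *m gi)) j k.
  rewrite -E3 exchange_big; apply: eq_bigr => l _; apply: eq_bigr => k _ /=.
  rewrite -[in LHS]giT [gi^T _ _]mxE; congr (_ * _).
  rewrite !mxE; apply: eq_bigr => m _; rewrite [hescol _ _ _ _]mxE.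
  by rewrite [hes f k m]hesC.
rewrite E3; ring.
Qed.

(** * Bochner formula and the equation for the logarithm *)

Definition dot (u v : 'cV[A]_n) := \tr (gi *m (u *m v^T)).

Lemma dotE u v : dot u v = \sum_k u k 0 * (gi *m v) k 0.
Proof.
rewrite /dot mxtrace_mulC -mulmxA mxtrace_mulC /mxtrace big_ord1 mxE.
have -> : v^T *m gi = (gi *m v)^T by rewrite trmx_mul giT.
by apply: eq_bigr => k _; rewrite [_^T _ _]mxE mulrC.
Qed.

Lemma dotC u v : dot u v = dot v u.
Proof. by rewrite /dot -mxtrace_tr !trmx_mul trmxK giT mxtrace_mulC. Qed.

Lemma dotDl u u' v : dot (u + u') v = dot u v + dot u' v.
Proof. by rewrite /dot mulmxDl mulmxDr mxtraceD. Qed.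

Lemma dotDr u v v' : dot u (v + v') = dot u v + dot u v'.
Proof. by rewrite dotC dotDl !(dotC u). Qed.

Lemma dotZl x u v : dot (x *: u) v = x * dot u v.
Proof. by rewrite /dot -scalemxAl -scalemxAr mxtraceZ. Qed.

Lemma dotZr x u v : dot u (x *: v) = x * dot u v.
Proof. by rewrite dotC dotZl dotC. Qed.

Definition cd a (u : 'cV[A]_n) : 'cV[A]_n := dm a u - Gam a *m u.

Lemma d_dot a u v : d a (dot u v) = dot (cd a u) v + dot u (cd a v).
Proof.
rewrite /dot d_trace -mxtraceD -mulmxDr; congr (\tr (_ *m _)).
rewrite /nab /cd dmM dmT !(trmxD, trmxN, trmx_mul, mulmxDl, mulmxDr).
rewrite !(mulmxN, mulNmx) !mulmxA.
by apply/matrixP => x y; rewrite !(addmxE, oppmxE); ring.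
Qed.

Lemma cd_om a f : cd a (om f) = hescol f a.
Proof. by rewrite hescolE. Qed.

Lemma cd_hescol i j k f :
  (cd i (hescol f j) - \sum_e Gam i j e *: hescol f e) k 0 =
  nab k (hes f) i j - (rm i k *m om f) j 0.
Proof.
have <- : nab i (hes f) j k = nab k (hes f) i j - (rm i k *m om f) j 0.
  rewrite -codazzi -[in LHS](hesT f) -nabT mxE //.
rewrite nab_hescol -/(cd i (hescol f j)) addmxE oppmxE summxE; congr (_ - _).
by apply: eq_bigr => e _; rewrite mxE [hescol _ _ _ _]mxE.
Qed.

Lemma hes_dot f i j : hes (dot (om f) (om f)) i j =
  2 * (\sum_k (gi *m om f) k 0 * nab k (hes f) i j)
  - 2 * (\sum_k (rml i k *m (gi *m om f)) j 0 * (gi *m om f) k 0)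
  + 2 * (hes f *m gi *m hes f) i j.
Proof.
have dd a : d a (dot (om f) (om f)) = 2 * dot (hescol f a) (om f).
  by rewrite d_dot cd_om [dot (om f) _]dotC; ring.
rewrite mxE; under eq_bigr do rewrite dd.
have d2 a x : d a (2 * x) = 2 * d a x by rewrite mulr_natl mulr2n dD; ring.
rewrite dd d2 d_dot cd_om.
have -> : \sum_c Gam i j c * (2 * dot (hescol f c) (om f)) =
    2 * dot (\sum_c Gam i j c *: hescol f c) (om f).
  have -> : dot (\sum_c Gam i j c *: hescol f c) (om f) =
     \sum_c dot (Gam i j c *: hescol f c) (om f).
    apply: (big_morph (fun u => dot u (om f))) => [u v|]; first exact: dotDl.
    by rewrite /dot mul0mx mulmx0 mxtrace0.
  by rewrite mulr_sumr; apply: eq_bigr => c _; rewrite dotZl; ring.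
have -> : dot (hescol f j) (hescol f i) = (hes f *m gi *m hes f) i j.
  rewrite dotC dotE -mulmxA mxE; apply: eq_bigr => k _; rewrite [hescol _ _ _ _]mxE.
  congr (_ * _); rewrite !mxE; apply: eq_bigr => l _.
  by rewrite [hescol _ _ _ _]mxE [hes f j l]hesC.
have -> : 2 * (dot (cd i (hescol f j)) (om f) + (hes f *m gi *m hes f) i j)
   - 2 * dot (\sum_c Gam i j c *: hescol f c) (om f) =
   2 * dot (cd i (hescol f j) - \sum_c Gam i j c *: hescol f c) (om f)
   + 2 * (hes f *m gi *m hes f) i j.
  have <- : -1 *: \sum_c Gam i j c *: hescol f c = - \sum_c Gam i j c *: hescol f c.
    exact: scaleN1r.
  rewrite dotDl dotZl; ring.
congr (_ + _); rewrite dotE -mulrBr; congr (2 * _).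
rewrite -sumrB; apply: eq_bigr => k _; rewrite cd_hescol mulrBl; congr (_ - _ * _).
  exact: mulrC.
by rewrite /rml mulmxA -[_ *m g *m gi]mulmxA ggi mulmx1.
Qed.

Lemma hesD x y : hes (x + y) = hes x + hes y.
Proof.
apply/matrixP => i j; rewrite !mxE !dD.
under eq_bigr do rewrite dD mulrDr.
rewrite big_split /=; ring.
Qed.

Lemma hesZ h x : (forall a, d a h = 0) -> hes (h * x) = h *: hes x.
Proof.
move=> dh; have E a y : d a (h * y) = h * d a y by rewrite dM dh mul0r add0r.
apply/matrixP => i j; rewrite !mxE !E mulrBr mulr_sumr; congr (_ - _).
by apply: eq_bigr => c _; rewrite E; ring.
Qed.

Lemma omD x y : om (x + y) = om x + om y.
Proof. by apply/matrixP => i j; rewrite !mxE dD. Qed.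

Lemma omZ h x : (forall a, d a h = 0) -> om (h * x) = h *: om x.
Proof. by move=> dh; apply/matrixP => i j; rewrite !mxE dM dh mul0r add0r. Qed.

Lemma lapD x y : lap (x + y) = lap x + lap y.
Proof. by rewrite /lap hesD mulmxDr mxtraceD. Qed.

Lemma lapZ h x : (forall a, d a h = 0) -> lap (h * x) = h * lap x.
Proof. by move=> dh; rewrite /lap hesZ // -scalemxAr mxtraceZ. Qed.

(** The hypothesis makes [f] behave as the logarithm of [r]: the Hessian of [r] is [r] times the
    Hessian of [f] plus the square of its differential. *)
Lemma lap_log r f : (forall a, d a r = r * d a f) ->
  lap r = r * (lap f + dot (om f) (om f)).
Proof.
move=> dr; rewrite /lap /dot -mxtraceD -mulmxDr -mxtraceZ scalemxAr.
congr (\tr (_ *m _)); apply/matrixP => i j; rewrite !mxE big_ord1 !mxE.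
under eq_bigr do rewrite dr mulrCA.
by rewrite -mulr_sumr dr dM dr; ring.
Qed.

(* [f] and [ft] stand for [ln r] and its time derivative, [h] for [1/2]. *)
Variables (h f ft r rt U1 U2 : A).
Hypothesis h2 : h + h = 1.
Hypothesis dr : forall a, d a r = r * d a f.
Hypothesis r_reg : forall x, r * x = 0 -> x = 0.
Hypothesis rt_eq : rt = r * ft.
Hypothesis heat : rt = lap r + dot (om U1) (om r) + U2 * r.

Lemma dh a : d a h = 0.
Proof. by apply: double_inj; rewrite -dD h2 d1. Qed.

Definition phi := f + h * U1.
Definition pot := lap U1 + h * dot (om U1) (om U1) - 2 * U2.

(** Completing the square: the drift term is the cross term of the squared gradient of [phi], and
    [pot] collects what [U1] and [U2] leave over. *)
Lemma log_heat : ft = lap phi + dot (om phi) (om phi) - h * pot.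
Proof.
have E : ft = lap f + dot (om f) (om f) + dot (om U1) (om f) + U2.
  apply/eqP; rewrite -subr_eq0; apply/eqP/r_reg; rewrite mulrBr -rt_eq heat.
  have -> : om r = r *: om f by apply/matrixP => i j; rewrite !mxE dr.
  by rewrite (lap_log dr) dotZr; ring.
rewrite E /phi /pot lapD lapZ ?omD ?omZ; [|exact: dh|exact: dh].
rewrite dotDl !dotDr !dotZl !dotZr (dotC (om f) (om U1)).
set x := dot (om U1) (om f).
(* The coefficient 1 is written as [h + h], since [ring] has no access to [h2]. *)
have -> : lap f + dot (om f) (om f) + x + U2
  = lap f + dot (om f) (om f) + (h + h) * (x + U2) by rewrite h2; ring.
ring.
Qed.

Lemma hes_log_heat i j : hes ft i j =
  \sum_k \sum_l gi k l * nab2 k l (hes phi) i j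
  - 2 * (\sum_k (rml i k *m (gi *m hes phi *m gi)) j k)
  - (hes phi *m gi *m ric) j i - (hes phi *m gi *m ric) i j
  + (2 * (\sum_k (gi *m om phi) k 0 * nab k (hes phi) i j)
  - 2 * (\sum_k (rml i k *m (gi *m om phi)) j 0 * (gi *m om phi) k 0)
  + 2 * (hes phi *m gi *m hes phi) i j)
  - h * hes pot i j.
Proof.
rewrite -hes_lap -hes_dot log_heat.
have -> : - (h * pot) = (- h) * pot by rewrite mulNr.
have dNh a : d a (- h) = 0 by rewrite dN dh oppr0.
rewrite (hesD (_ + _)) (hesD (lap phi)) (hesZ _ dNh).
move: (hes (lap _)) (hes (dot _ _)) (hes pot) => X Y Z.
by rewrite !addmxE scalemxE mulNr.
Qed.

(* When [V] is parallel at a point, the last two terms vanish there. *)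
Lemma d_form a (V : 'rV[A]_n) X : dm a (V *m X *m V^T) = V *m nab a X *m V^T
  + (dm a V + V *m Gam a) *m (X *m V^T) + V *m X *m (dm a V + V *m Gam a)^T.
Proof.
rewrite /nab !dmM dmT !(trmxD, trmxN, trmx_mul).
rewrite !(mulmxDl, mulmxDr, mulmxN, mulNmx) !mulmxA.
by apply/matrixP => x y; rewrite !(addmxE, oppmxE); ring.
Qed.

Lemma nab_metric mu a X : (forall b, d b mu = 0) -> nab a (X - mu *: g) = nab a X.
Proof.
move=> dmu; rewrite /nab dmD dmN dmZ dmu scale0r add0r dg.
rewrite !(mulmxDl, mulmxDr, mulmxN, mulNmx, scalerDr) -!scalemxAr -!scalemxAl.
by apply/matrixP => x y; rewrite !(addmxE, oppmxE); ring.
Qed.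
End Tensor.

(** * Positive semidefinite forms *)

Section Psd.
Variables (R : realType) (n : nat).
Implicit Types (A B : 'M[R]_n) (u v w : 'rV[R]_n).

Lemma innerDl A u v w : inner A (u + v) w = inner A u w + inner A v w.
Proof. by rewrite /inner !mulmxDl mxE. Qed.

Lemma innerDr A u v w : inner A u (v + w) = inner A u v + inner A u w.
Proof. by rewrite /inner linearD mulmxDr mxE. Qed.

Lemma innerZl A a u v : inner A (a *: u) v = a * inner A u v.
Proof. by rewrite /inner -!scalemxAl mxE. Qed.

Lemma innerZr A a u v : inner A u (a *: v) = a * inner A u v.
Proof. by rewrite /inner linearZ -scalemxAr mxE. Qed.

Lemma innerD A B u v : inner (A + B) u v = inner A u v + inner B u v.
Proof. by rewrite /inner mulmxDr mulmxDl mxE. Qed.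

Lemma innerZ a A u v : inner (a *: A) u v = a * inner A u v.
Proof. by rewrite /inner -scalemxAr -scalemxAl mxE. Qed.

Lemma innerN A u v : inner (- A) u v = - inner A u v.
Proof. by rewrite -scaleN1r innerZ mulN1r. Qed.

Lemma inner0l A u : inner A 0 u = 0.
Proof. by rewrite /inner !mul0mx mxE. Qed.

Lemma inner_tr A u v : inner A^T u v = inner A v u.
Proof.
rewrite /inner; have -> : u *m A^T *m v^T = (v *m A *m u^T)^T.
  by rewrite !trmx_mul trmxK mulmxA.
by rewrite mxE.
Qed.

Lemma inner_sum (I : Type) (s : seq I) (F : I -> 'M[R]_n) u v :
  inner (\sum_(i <- s) F i) u v = \sum_(i <- s) inner (F i) u v.
Proof.
apply: (big_morph (fun A => inner A u v)); first by move=> *; exact: innerD.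
by rewrite /inner mulmx0 mul0mx mxE.
Qed.

Lemma inner_dyad w u v : inner (w^T *m w) u v = (u *m w^T) 0 0 * (v *m w^T) 0 0.
Proof.
rewrite /inner mulmxA -mulmxA mxE big_ord1; congr (_ * _).
by rewrite -[v in RHS]trmxK -trmx_mul [RHS]mxE.
Qed.

Lemma innerE A u v : inner A u v = \sum_i \sum_j u 0 i * A i j * v 0 j.
Proof.
rewrite /inner mxE exchange_big; apply: eq_bigr => j _ /=.
by rewrite [_^T _ _]mxE mxE mulr_suml.
Qed.

Lemma inner_delta A i j : inner A (delta_mx 0 i) (delta_mx 0 j) = A i j.
Proof. by rewrite /inner -rowE trmx_delta -colE !mxE. Qed.

Definition psd A := forall u, 0 <= inner A u u.

(* Cauchy-Schwarz for the vectors [u] and [delta_mx 0 i]. *)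
Lemma psd_pivot A i : A^T = A -> psd A -> 0 < A i i ->
  psd (A - (A i i)^-1 *: ((row i A)^T *m row i A)).
Proof.
move=> AT pA Aii u; rewrite innerD innerN innerZ inner_dyad.
set e := delta_mx 0 i : 'rV[R]_n; set s := (u *m _) 0 0.
have ue : inner A u e = s.
  by rewrite /inner trmx_delta -colE mxE /s mxE mxE; apply: eq_bigr => j _;
     rewrite -{1}AT !mxE.
have eu : inner A e u = s by rewrite -inner_tr AT.
have := pA (u - (s / A i i) *: e).
rewrite -scaleNr !(innerDl, innerDr, innerZl, innerZr) ue eu inner_delta.
move=> H; apply: (le_trans H); rewrite le_eqVlt; apply/orP; left; apply/eqP.
by field; rewrite gt_eqF.
Qed.

(** Symmetric Gaussian elimination, by induction on the number of nonzero diagonal entries. A pivot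
    step clears one of them and, by positivity, creates none. When the diagonal is zero, the form at
    e_i + t e_j is 2 t A_ij, and t = 1, -1 force A_ij = 0. *)
Lemma psd_gram A : A^T = A -> psd A ->
  exists s : seq 'rV[R]_n, A = \sum_(w <- s) w^T *m w.
Proof.
move: {2}#|_|.+1 (ltnSn #|[set i | A i i != 0]%SET|) => m.
elim: m A => // m IHm A; rewrite ltnS => cA AT pA.
have [/existsP[i Ai]|/existsPn A0] := boolP [exists i, A i i != 0].
  have Aii : 0 < A i i by rewrite lt_def Ai -inner_delta pA.
  set w := (Num.sqrt (A i i))^-1 *: row i A.
  have dw : w^T *m w = (A i i)^-1 *: ((row i A)^T *m row i A).
    have -> : w^T = (Num.sqrt (A i i))^-1 *: (row i A)^T.
      by apply/matrixP => x y; rewrite !mxE.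
    rewrite /w -scalemxAl -scalemxAr scalerA -invfM -expr2.
    by rewrite sqr_sqrtr ?ltW.
  have pB := psd_pivot AT pA Aii; rewrite -dw in pB.
  have BT : (A - w^T *m w)^T = A - w^T *m w.
    by rewrite linearB /= AT trmx_mul trmxK.
  have [|s Es] := IHm (A - w^T *m w) _ BT pB; last first.
    by exists (w :: s); rewrite big_cons -Es addrC subrK.
  apply: leq_trans cA; apply: proper_card; apply/properP; split.
    apply/fintype.subsetP => j; rewrite !inE; apply: contra_neq => Aj.
    apply/le_anti; rewrite -{2}inner_delta pB andbT.
    by rewrite 3!mxE big_ord1 Aj add0r mxE oppr_le0 -expr2 sqr_ge0.
  exists i; rewrite !inE // negbK dw !mxE big_ord1 !mxE.
  by apply/eqP; field; rewrite gt_eqF.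
exists [::]; rewrite big_nil; apply/matrixP => i j; rewrite mxE.
have AC : A j i = A i j by rewrite -{1}AT mxE.
have D k : A k k = 0 by apply/eqP; move: (A0 k); rewrite negbK.
have E (t : R) : 0 <= t * A i j *+ 2.
  have := pA (delta_mx 0 i + t *: delta_mx 0 j).
  by rewrite !(innerDl, innerDr, innerZl, innerZr) !inner_delta AC !D; lra.
by have := E 1; have := E (-1); lra.
Qed.

(** This turns a minimising direction into an eigenvector: in a Gram decomposition a zero sum of
    squares has only zero terms. *)
Lemma psd_ker A v : A^T = A -> psd A -> inner A v v = 0 -> v *m A = 0.
Proof.
move=> AT pA; have [s ->] := psd_gram AT pA; rewrite inner_sum.
under eq_bigr do rewrite inner_dyad -expr2.
move=> /eqP; rewrite psumr_eq0 => [/allP s0|w _]; last exact: sqr_ge0.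
rewrite mulmx_sumr big_seq big1 // => w /s0 /=; rewrite sqrf_eq0 => /eqP vw.
rewrite mulmxA; suff -> : v *m w^T = 0 by rewrite mul0mx.
by apply/matrixP => i j; rewrite !ord1 vw mxE.
Qed.

Lemma psd_trace A B : psd A -> B^T = B -> psd B ->
  0 <= \sum_i \sum_j A i j * B i j.
Proof.
move=> pA BT pB; have [s ->] := psd_gram BT pB.
rewrite (_ : (\sum_i _) = \sum_(w <- s) inner A w w).
  by apply: sumr_ge0 => w _; exact: pA.
under [RHS]eq_bigr do rewrite innerE.
rewrite [RHS]exchange_big; apply: eq_bigr => i _ /=.
rewrite [RHS]exchange_big; apply: eq_bigr => j _ /=.
rewrite summxE mulr_sumr; apply: eq_bigr => w _.
by rewrite mxE big_ord1 mxE; ring.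
Qed.

(** The algebra at the minimum point. [N] and [T] stand for the second and first covariant
    derivatives of the Hessian [H], and [w] for the gradient. *)
Lemma reaction_ge (g gi H ric : 'M[R]_n) (rm N : 'I_n -> 'I_n -> 'M[R]_n)
    (T : 'I_n -> 'M[R]_n) (Hft hW : 'M[R]_n) (w : 'cV[R]_n) (h mu : R) v :
  gi^T = gi -> psd gi -> g^T = g -> g *m gi = 1%:M -> H^T = H ->
  (forall i k, rm i k = - rm k i) ->
  (forall i j, ric i j = \sum_k rm k i j k) ->
  psd (H - mu *: g) -> inner (H - mu *: g) v v = 0 ->
  0 <= \sum_k \sum_l gi k l * inner (N k l) v v ->
  (forall k, inner (T k) v v = 0) ->
  (forall u, \sum_i \sum_k v 0 i * u 0 k * inner (rm i k *m g) v u <= 0) ->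
  (forall i j, Hft i j = \sum_k \sum_l gi k l * N k l i j
    - 2 * (\sum_k (rm i k *m g *m (gi *m H *m gi)) j k)
    - (H *m gi *m ric) j i - (H *m gi *m ric) i j
    + (2 * (\sum_k w k 0 * T k i j)
       - 2 * (\sum_k (rm i k *m g *m w) j 0 * w k 0)
       + 2 * (H *m gi *m H) i j)
    - h * hW i j) ->
  2 * mu ^+ 2 * inner g v v - h * inner hW v v <= inner Hft v v.
Proof.
move=> giT pgi gT ggi HT rmN ricE; set P := H - mu *: g => pP vP N0 T0 sec HftE.
have gig : gi *m g = 1%:M by exact: mulmx1C.
have PT : P^T = P by rewrite /P linearB /= HT; congr (_ - _); apply/matrixP => i j; rewrite !mxE -{1}gT mxE.
have HP : H = P + mu *: g by rewrite subrK.
have vPE : v *m P = 0 by exact: psd_ker.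
have vH : v *m H = mu *: (v *m g) by rewrite HP mulmxDr vPE add0r scalemxAr.
have Hv : H *m v^T = mu *: (g *m v^T).
  rewrite -HT -trmx_mul vH; apply/matrixP => i j; rewrite !mxE; congr (_ * _).
  by apply: eq_bigr => k _; rewrite !mxE -{1}gT mxE mulrC.
(* At (v, v) the form [C u] is the curvature expression (R(v, u) v, u), which is nonpositive. It
   serves both for the vectors of the Gram decomposition and for the gradient. *)
pose C u : 'M[R]_n := \matrix_(i, j) \sum_k (rm i k *m g *m u^T) j 0 * u 0 k.
have C_le0 u : inner (C u) v v <= 0.
  suff -> : inner (C u) v v = \sum_i \sum_k v 0 i * u 0 k * inner (rm i k *m g) v u
    by exact: sec.
  rewrite innerE; apply: eq_bigr => i _.
  under [RHS]eq_bigr do rewrite /inner -mulmxA mxE mulr_sumr.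
  rewrite [RHS]exchange_big; apply: eq_bigr => j _ /=.
  rewrite mxE mulr_sumr mulr_suml; apply: eq_bigr => k _; ring.
have [s Ps] := psd_gram PT pP.
have giPgi : gi *m P *m gi = \sum_(x <- s) (x *m gi)^T *m (x *m gi).
  rewrite Ps mulmx_sumr mulmx_suml; apply: eq_bigr => x _.
  by rewrite trmx_mul giT !mulmxA.
(* Split [H] as [P + mu *: g]: the first part gives one [C] per Gram vector, the second gives the
   Ricci tensor, to be cancelled through [E3]. *)
have C1 : \matrix_(i, j) (\sum_k (rm i k *m g *m (gi *m H *m gi)) j k)
   = \sum_(x <- s) C (x *m gi) - mu *: ric.
  apply/matrixP => i j; rewrite !mxE summxE ricE.
  have -> : gi *m H *m gi = gi *m P *m gi + mu *: gi.
    by rewrite HP mulmxDr mulmxDl -scalemxAr -scalemxAl gig mul1mx.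
  have E k : (rm i k *m g *m (gi *m P *m gi + mu *: gi)) j k =
     \sum_(x <- s) (rm i k *m g *m (x *m gi)^T) j 0 * (x *m gi) 0 k - mu * rm k i j k.
    rewrite mulmxDr -scalemxAr -[rm i k *m g *m gi]mulmxA ggi mulmx1 addmxE giPgi.
    rewrite mulmx_sumr summxE scalemxE (rmN i k) oppmxE mulrN.
    congr (_ - _); apply: eq_bigr => x _.
    by rewrite -(rmN i k) mulmxA mxE big_ord1.
  under eq_bigr do rewrite E.
  rewrite big_split /= sumrN mulr_sumr exchange_big; congr (_ - _).
  by apply: eq_bigr => x _; rewrite mxE.
have C2 : \matrix_(i, j) (\sum_k (rm i k *m g *m w) j 0 * w k 0) = C w^T.
  by apply/matrixP => i j; rewrite !mxE; under [RHS]eq_bigr do rewrite trmxK [w^T _ _]mxE.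
have HE : Hft = \sum_k \sum_l gi k l *: N k l
   - 2 *: (\sum_(x <- s) C (x *m gi) - mu *: ric)
   - (H *m gi *m ric)^T - H *m gi *m ric
   + (2 *: \sum_k w k 0 *: T k - 2 *: C w^T + 2 *: (H *m gi *m H)) - h *: hW.
  rewrite -C1 -C2; apply/matrixP => i j; rewrite HftE.
  rewrite !(addmxE, oppmxE, scalemxE); congr (_ - _ - _ - _ + (_ - _ + _) - _).
  - rewrite summxE; apply: eq_bigr => k _; rewrite summxE.
    by apply: eq_bigr => l _; rewrite scalemxE.
  - by rewrite [in RHS]mxE.
  - by rewrite [in RHS]mxE.
  - by rewrite summxE; congr (_ * _); apply: eq_bigr => l _; rewrite scalemxE.
  - by rewrite [in RHS]mxE.
have E1 : inner (\sum_k \sum_l gi k l *: N k l) v v =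
    \sum_k \sum_l gi k l * inner (N k l) v v.
  rewrite inner_sum; apply: eq_bigr => k _; rewrite inner_sum.
  by apply: eq_bigr => l _; rewrite innerZ.
have E2 : inner (\sum_k w k 0 *: T k) v v = 0.
  by rewrite inner_sum big1 // => k _; rewrite innerZ T0 mulr0.
have E3 : inner (H *m gi *m ric) v v = mu * inner ric v v.
  by rewrite /inner !mulmxA vH -!scalemxAl -[v *m g *m gi]mulmxA ggi mulmx1 mxE.
have E4 : inner (H *m gi *m H) v v = mu ^+ 2 * inner g v v.
  rewrite /inner !mulmxA vH -!mulmxA Hv -!scalemxAl -!scalemxAr scalerA -expr2.
  by rewrite (mulmxA gi g) gig mul1mx scalemxE mulmxA.
rewrite HE !(innerD, innerN, innerZ) inner_tr E1 E2 E3 E4.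
have := C_le0 w^T.
have : inner (\sum_(x <- s) C (x *m gi)) v v <= 0.
  by rewrite inner_sum; apply: sumr_le0 => x _; exact: C_le0.
by move=> ? ?; lra.
Qed.
End Psd.

(** * Smooth functions *)

Section NearDiff.
Variables (R : realType) (V W : normedModType R).
Implicit Types (f g : V -> W) (x v : V).

Lemma near0_differentiable f x : (\near x, f x = 0) -> differentiable f x.
Proof.
move=> f0.
have E : f \o shift x = cst (f x) + (\0 : V -> W) +o_ 0 id.
  apply/eqaddoP => e e0; have fx : f x = 0 by exact: nbhs_singleton f0.
  move: f0; rewrite [X in X -> _](near_shift 0) /= subr0 => f0.
  near=> y; have fy : f (y + x) = 0 by near: y.
  rewrite (_ : (_ - _) y = 0); first by rewrite normr0 mulr_ge0 ?normr_ge0 // ltW.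
  by change (f (y + x) - (f x + 0) = 0); rewrite fx fy addr0 subr0.
have dE : 'd f x = (\0 : V -> W) :> (V -> W).
  apply: (@diff_unique _ _ _ f \0 x); last exact: E.
  by move=> y; exact: cvg_cst.
by apply/diff_locallyP; rewrite dE; split => // y; exact: cvg_cst.
Unshelve. all: by end_near. Qed.

Lemma near_eq_differentiable f g x :
  (\near x, f x = g x) -> differentiable f x -> differentiable g x.
Proof.
move=> fg df; have -> : g = f + (g - f) by rewrite addrC subrK.
apply: differentiableD => //; apply: near0_differentiable.
near=> y; have : f y = g y by near: y.
by rewrite !fctE => ->; rewrite subrr.
Unshelve. all: by end_near. Qed.

(** Closure properties of smooth functions go by induction on the order: the derivative of a
    product, an inverse or a logarithm is built from functions known to one order less. *)
Definition Ck (k : nat) (U : set V) f := forall vs x, (size vs <= k)%N -> U x ->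
  differentiable (foldr (fun v g => 'D_v g) f vs) x.

Lemma smooth_onP U f : smooth_on U f <-> forall k, Ck k U f.
Proof.
split => [sf k vs x _ Ux|sf vs x Ux]; first exact: sf.
exact: (sf (size vs)).
Qed.

Lemma Ck0 U f : Ck 0 U f <-> forall x, U x -> differentiable f x.
Proof.
split => [sf x Ux|sf vs x]; first exact: (sf [::]).
by case: vs => //= _; exact: sf.
Qed.

(** The innermost derivative is peeled off, at the end of the list, so that induction on [k] can
    change the function. *)
Lemma CkS k U f : Ck k.+1 U f <->
  (forall x, U x -> differentiable f x) /\ forall v, Ck k U ('D_v f).
Proof.
split => [sf|[df sf] vs].
  split => [x Ux|v vs x vk Ux]; first exact: (sf [::]).
  by have := sf (rcons vs v) x; rewrite foldr_rcons size_rcons ltnS => /(_ vk Ux).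
by case/lastP: vs => [x _|vs v x]; [exact: df|rewrite size_rcons foldr_rcons; exact: sf].
Qed.

Lemma eq_derive_on U f g : open U -> (forall x, U x -> f x = g x) ->
  forall v x, U x -> 'D_v f x = 'D_v g x.
Proof.
move=> oU fg v x Ux; apply: near_eq_derive.
by apply: filterS (open_nbhs_nbhs (conj oU Ux)) => y /fg.
Qed.

Lemma eq_Ck k U f g : open U -> (forall x, U x -> f x = g x) ->
  Ck k U f -> Ck k U g.
Proof.
move=> oU fg sf vs x vk Ux.
have E : forall y, U y -> foldr (fun v g => 'D_v g) f vs y =
                          foldr (fun v g => 'D_v g) g vs y.
  by elim: vs {vk} => //= v vs IH; exact: eq_derive_on.
apply: near_eq_differentiable (sf vs x vk Ux).
by apply: filterS (open_nbhs_nbhs (conj oU Ux)) => y /E.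
Qed.

Lemma Ck_le k l U f : (k <= l)%N -> Ck l U f -> Ck k U f.
Proof. by move=> kl sf vs x vk; apply: sf; exact: leq_trans vk kl. Qed.

Lemma CkD k U f g : open U -> Ck k U f -> Ck k U g -> Ck k U (f + g).
Proof.
move=> oU; elim: k f g => [|k IH] f g.
  by rewrite !Ck0 => df dg x Ux; apply: differentiableD; auto.
rewrite !CkS => -[df sf] [dg sg]; split => [x Ux|v].
  by apply: differentiableD; auto.
apply: eq_Ck oU _ (IH _ _ (sf v) (sg v)) => x Ux.
by rewrite deriveD //; apply: diff_derivable; auto.
Qed.

Lemma Ck_cst k U a : open U -> Ck k U (cst a : V -> W).
Proof.
move=> oU; elim: k a => [|k IH] a; first by rewrite Ck0.
rewrite CkS; split => // v; apply: eq_Ck oU _ (IH 0) => x Ux.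
by rewrite derive_cst.
Qed.

End NearDiff.

(** The arithmetic of [second_difference]: [A0], [A1], [A2] are values of a first derivative at the
    base point and two nearby points, [a] and [b] its derivatives along the two directions, [p] and
    [q] the norms of these directions. *)
Lemma mean_value_estimate (R : realType) (A0 A1 A2 s t a b c m p q : R) :
  0 < s -> 0 <= c -> p + q *+ 2 <= m ->
  `|A1 - A0 - (s * a + t * b)| <= c * (s * (p + q)) ->
  `|A2 - A0 - t * b| <= c * (s * q) ->
  `|(A1 - A2) * s - s ^+ 2 * a| <= c * m * s ^+ 2.
Proof.
move=> s0 c0 pq h1 h2.
have -> : (A1 - A2) * s - s ^+ 2 * a =
  s * ((A1 - A0 - (s * a + t * b)) - (A2 - A0 - t * b)) by ring.
rewrite normrM gtr0_norm // expr2 mulrCA ler_pM2l //.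
apply: le_trans (ler_normB _ _) _; apply: le_trans (lerD h1 h2) _.
have -> : c * (s * (p + q)) + c * (s * q) = c * s * (p + q *+ 2) by ring.
rewrite [c * m * s]mulrAC; apply: ler_wpM2l => //.
by apply: mulr_ge0 => //; exact: ltW.
Qed.

Lemma common_value_dist (R : realType) (z a b s e : R) :
  0 < s -> `|z - s ^+ 2 * a| <= e / 2 * s ^+ 2 ->
  `|z - s ^+ 2 * b| <= e / 2 * s ^+ 2 -> `|a - b| <= e.
Proof.
move=> s0 ha hb; have s2 : 0 < s ^+ 2 by rewrite exprn_gt0.
rewrite -(ler_pM2l s2) -[X in X * `|_|]gtr0_norm // -normrM.
have -> : s ^+ 2 * (a - b) = (z - s ^+ 2 * b) - (z - s ^+ 2 * a) by ring.
apply: le_trans (ler_normB _ _) _; apply: le_trans (lerD hb ha) _.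
by rewrite le_eqVlt; apply/orP; left; apply/eqP; field.
Qed.

Lemma slope_ge (R : realType) (x t a b e : R) :
  0 < t -> 0 <= x -> `|x - t * a| <= b -> b <= t * e -> 0 <= a + e.
Proof.
move=> t0 x0; rewrite ler_norml => /andP[_ h] be.
by rewrite -(ler_pM2l t0) mulr0 mulrDr; lra.
Qed.

Section Scalar.
Variables (R : realType) (V : normedModType R).
Implicit Types (f g : V -> R^o) (x v : V) (U : set V).

Lemma eq_CkR k U f g : open U -> (forall x, U x -> f x = g x) ->
  Ck k U f -> Ck k U g.
Proof. exact: eq_Ck. Qed.

Lemma CkM k U f g : open U -> Ck k U f -> Ck k U g ->
  Ck k U (fun x => (f x * g x : R^o)).
Proof.
move=> oU; elim: k f g => [|k IH] f g.
  by rewrite !Ck0 => df dg x Ux; apply: (differentiableM (df x Ux) (dg x Ux)).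
move=> sf sg; move: (sf) (sg); rewrite !CkS => -[df sf'] [dg sg'].
have sfk := Ck_le (leqnSn k) sf; have sgk := Ck_le (leqnSn k) sg.
split => [x Ux|v]; first by apply: (differentiableM (df x Ux) (dg x Ux)).
have S := CkD oU (IH _ _ sfk (sg' v)) (IH _ _ sgk (sf' v)).
apply: (eq_CkR oU _ S) => x Ux.
by rewrite [RHS](deriveM (diff_derivable (df x Ux)) (diff_derivable (dg x Ux))).
Qed.

Lemma CkV k U f : open U -> (forall x, U x -> f x != 0) -> Ck k U f ->
  Ck k U (fun x => ((f x)^-1 : R^o)).
Proof.
move=> oU f0; elim: k => [|k IH].
  by rewrite !Ck0 => df x Ux; apply: (differentiableV (df x Ux)); exact: f0.
move=> sf; move: (sf); rewrite !CkS => -[df sf'].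
have sfk := IH (Ck_le (leqnSn k) sf).
split => [x Ux|v]; first by apply: (differentiableV (df x Ux)); exact: f0.
have S := (CkM oU (CkM oU sfk sfk) (CkM oU (@Ck_cst R V R^o k U (-1) oU) (sf' v))).
apply: (eq_CkR oU _ S) => x Ux.
rewrite [RHS](deriveV (f0 x Ux) (diff_derivable (df x Ux))) /=.
by rewrite /GRing.scale /= /cst mulN1r mulNr mulrN expr2 invfM.
Qed.

Lemma diff_ln (y : R) : 0 < y -> differentiable (@ln R : R -> R^o) y.
Proof.
by move=> y0; apply/derivable1_diffP; apply: ex_derive; exact: is_derive1_ln.
Qed.

Lemma derive_ln_comp f x v : 0 < f x -> differentiable f x ->
  'D_v (fun x => (ln (f x) : R^o)) x = (f x)^-1 * 'D_v f x.
Proof.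
move=> fx df; have dl := diff_ln fx.
rewrite deriveE; last exact: (differentiable_comp df dl).
rewrite (diff_comp df dl) /= (diff1E dl) -deriveE // derive1E.
by rewrite (derive_val (is_derive := is_derive1_ln fx)) mulrC.
Qed.

Lemma Ck_ln k U f : open U -> (forall x, U x -> 0 < f x) -> Ck k U f ->
  Ck k U (fun x => (ln (f x) : R^o)).
Proof.
move=> oU f0; case: k => [|k].
  by rewrite !Ck0 => df x Ux; apply: (differentiable_comp (df x Ux) (diff_ln (f0 x Ux))).
move=> sf; move: (sf); rewrite !CkS => -[df sf'].
split => [x Ux|v].
  exact: (differentiable_comp (df x Ux) (diff_ln (f0 x Ux))).
have f0' x : U x -> f x != 0 by move=> /f0/lt0r_neq0.
have S := (CkM oU (CkV oU f0' (Ck_le (leqnSn k) sf)) (sf' v)).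
apply: (eq_CkR oU _ S) => x Ux.
by rewrite derive_ln_comp //; [exact: f0|exact: df].
Qed.

Lemma smoothD U f g : open U -> smooth_on U f -> smooth_on U g ->
  smooth_on U (fun x => (f x + g x : R^o)).
Proof. by move=> oU; rewrite !smooth_onP => sf sg k; exact: CkD. Qed.

Lemma smoothM U f g : open U -> smooth_on U f -> smooth_on U g ->
  smooth_on U (fun x => (f x * g x : R^o)).
Proof. by move=> oU; rewrite !smooth_onP => sf sg k; exact: CkM. Qed.

Lemma smoothV U f : open U -> (forall x, U x -> f x != 0) -> smooth_on U f ->
  smooth_on U (fun x => ((f x)^-1 : R^o)).
Proof. by move=> oU f0; rewrite !smooth_onP => sf k; exact: CkV. Qed.

Lemma smooth_ln U f : open U -> (forall x, U x -> 0 < f x) -> smooth_on U f ->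
  smooth_on U (fun x => (ln (f x) : R^o)).
Proof. by move=> oU f0; rewrite !smooth_onP => sf k; exact: Ck_ln. Qed.

Lemma smooth_cst U (a : R^o) : open U -> smooth_on U (cst a : V -> R^o).
Proof. by move=> oU; rewrite smooth_onP => k; exact: Ck_cst. Qed.

Lemma smooth_derive U f v : smooth_on U f -> smooth_on U ('D_v f).
Proof. by rewrite !smooth_onP => sf k; have /CkS[] := sf k.+1. Qed.

Lemma eq_smooth U f g : open U -> (forall x, U x -> f x = g x) ->
  smooth_on U f -> smooth_on U g.
Proof. by move=> oU fg; rewrite !smooth_onP => sf k; exact: eq_Ck (sf k). Qed.

Lemma smooth_subset U U' f : U' `<=` U -> smooth_on U f -> smooth_on U' f.
Proof. by move=> UU sf vs x /UU; exact: sf. Qed.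

Lemma smooth_diff U f x : smooth_on U f -> U x -> differentiable f x.
Proof. by move=> sf; exact: (sf [::]). Qed.

Lemma smooth_linear (l : {linear V -> R^o}) : continuous l -> smooth_on setT l.
Proof.
move=> cl; rewrite smooth_onP => -[|k].
  by rewrite Ck0 => x _; exact: linear_differentiable.
rewrite CkS; split => [x _|v]; first exact: linear_differentiable.
have S := (@Ck_cst R V R^o k setT (l v) openT).
apply: (eq_CkR openT _ S) => x _.
by rewrite deriveE; [rewrite diff_lin|exact: linear_differentiable].
Qed.

(** * Symmetry of second derivatives and local minima *)

Lemma diff_bound f x : differentiable f x -> forall e, 0 < e ->
  exists2 r, 0 < r & forall y, `|y| < r ->
    `|f (x + y) - f x - 'D_y f x| <= e * `|y|.
Proof.
move=> df e e0; have /diff_locallyP[_ /eqaddoP /(_ e e0)] := df.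
move=> /nbhs_normP[r /= r0 H]; exists r => // y yr.
have := H y; rewrite /ball_ /= sub0r normrN => /(_ yr).
rewrite (_ : (_ - _) y = f (x + y) - f x - 'd f x y); first by rewrite deriveE.
by change (f (y + x) - (f x + 'd f x y) = f (x + y) - f x - 'd f x y);
  rewrite (addrC y) opprD addrA.
Qed.

Lemma deriveZv f x (a : R) v : differentiable f x -> 'D_(a *: v) f x = a * 'D_v f x.
Proof. by move=> df; rewrite !deriveE // linearZ. Qed.

Lemma deriveDv f x u v : differentiable f x -> 'D_(u + v) f x = 'D_u f x + 'D_v f x.
Proof. by move=> df; rewrite !deriveE // linearD. Qed.

Lemma is_derive_line f x w (r : R) : differentiable f (x + r *: w) ->
  is_derive r (1 : R) (fun r => f (x + r *: w)) ('D_w f (x + r *: w)).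
Proof.
move=> df.
have dl : is_diff r (fun r : R => x + r *: w) (fun r => r *: w).
  have : is_diff r (cst x + ( *:%R^~ w) : R -> V) (0 + ( *:%R^~ w)) by apply: is_diffD.
  by rewrite add0r.
have dlr := @ex_diff _ _ _ _ _ _ _ dl.
apply: DeriveDef.
  by apply: diff_derivable; exact: (differentiable_comp dlr df).
rewrite deriveE; last exact: (differentiable_comp dlr df).
by rewrite (diff_comp dlr df) /= diff_val scale1r deriveE.
Qed.

Lemma MVT_line f x w (s : R) : 0 < s ->
  (forall r, 0 <= r <= s -> differentiable f (x + r *: w)) ->
  exists2 r, 0 < r < s & f (x + s *: w) - f x = s * 'D_w f (x + r *: w).
Proof.
move=> s0 df.
have [||r] := @MVT R (fun r => f (x + r *: w)) (fun r => 'D_w f (x + r *: w)) 0 s s0.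
- move=> r; rewrite in_itv /= => /andP[r0 rs]; apply: is_derive_line.
  by apply: df; rewrite !ltW.
- apply: derivable_within_continuous => r; rewrite in_itv /= => rs.
  by have := is_derive_line (df r rs); case.
rewrite in_itv /= => rs; rewrite scale0r addr0 subr0 => E.
by exists r => //; rewrite E mulrC.
Qed.

(** The mean value theorem along [u], applied to the difference of [f] on two parallel segments,
    leaves an increment of ['D_u f], which its differentiability at [x] evaluates. *)
Lemma second_difference f x u v :
  (\near x, differentiable f x) -> differentiable ('D_u f) x ->
  forall e, 0 < e -> exists2 r : R, 0 < r & forall s, 0 < s < r ->
  `|f (x + s *: (u + v)) - f (x + s *: u) - f (x + s *: v) + f x
     - s ^+ 2 * 'D_v ('D_u f) x| <= e * s ^+ 2.
Proof.
(* [N] is the bound [m] of [mean_value_estimate]; the added 1 keeps it positive when [u] and [v]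
   vanish. *)
move=> fnear df e e0; set N := `|v| + `|u| *+ 2 + 1.
have N0 : 0 < N by rewrite ltr_wpDl // addr_ge0 // mulrn_wge0.
have [r1 r10 H1] := diff_bound df (divr_gt0 e0 N0).
have [r2 /= r20 H2] : exists2 r, 0 < r & forall y, `|y| < r -> differentiable f (x + y).
  move/nbhs_normP: fnear => [r /= r0 H]; exists r => // y yr; apply: H.
  by rewrite /ball_ /= opprD addNKr normrN.
exists (Num.min r1 r2 / N) => [|s /andP[s0]]; first by rewrite divr_gt0 ?lt_min ?r10.
rewrite ltr_pdivlMr // lt_min => /andP[sr1 sr2].
have small a b : 0 <= a <= s -> 0 <= b <= s -> `|b *: v + a *: u| <= s * (`|v| + `|u|).
  move=> /andP[a0 a1] /andP[b0 b1]; rewrite (le_trans (ler_normD _ _)) // !normrZ.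
  by rewrite !ger0_norm // mulrDr lerD // ler_wpM2r.
have vuN : s * (`|v| + `|u|) <= s * N.
  by rewrite ler_wpM2l ?ltW // /N; have := normr_ge0 u; lra.
have ss : 0 <= s <= s by rewrite lexx ltW.
have os : 0 <= (0 : R) <= s by rewrite lexx ltW.
have dfs a b : 0 <= a <= s -> 0 <= b <= s -> differentiable f (x + b *: v + a *: u).
  move=> ha hb; rewrite -addrA; apply: H2.
  by rewrite (le_lt_trans (small a b ha hb)) // (le_lt_trans vuN).
have D r : 0 <= r <= s -> is_derive r (1 : R)
    (fun r => f (x + s *: v + r *: u) - f (x + r *: u))
    ('D_u f (x + s *: v + r *: u) - 'D_u f (x + r *: u)).
  move=> hr; apply: is_deriveB; apply: is_derive_line; first exact: dfs.
  by have := dfs r 0 hr os; rewrite scale0r addr0.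
have [||xi] := @MVT R (fun r => f (x + s *: v + r *: u) - f (x + r *: u))
  (fun r => 'D_u f (x + s *: v + r *: u) - 'D_u f (x + r *: u)) 0 s s0.
- by move=> r; rewrite in_itv /= => /andP[r0 rs]; apply: D; rewrite !ltW.
- apply: derivable_within_continuous => r; rewrite in_itv /= => rs.
  by have := D r rs; case.
rewrite in_itv /= => /andP[xi0 xis]; rewrite !scale0r !addr0 subr0 => E.
have hxi : 0 <= xi <= s by rewrite !ltW.
have -> : f (x + s *: (u + v)) - f (x + s *: u) - f (x + s *: v) + f x =
    f (x + s *: v + s *: u) - f (x + s *: u) - (f (x + s *: v) - f x).
  by rewrite scalerDr [s *: u + _]addrC addrA opprB addrA addrAC -!addrA; congr (_ + _);
     rewrite addrCA addrC addrA addrAC.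
rewrite E.
have y1 : `|s *: v + xi *: u| <= s * (`|v| + `|u|) by exact: small.
have y2 : `|xi *: u| <= s * `|u|.
  by rewrite normrZ gtr0_norm // ler_wpM2r // ltW.
have y2' : s * `|u| <= s * N.
  by rewrite ler_wpM2l ?ltW // /N; have := normr_ge0 u; have := normr_ge0 v; lra.
have := H1 (s *: v + xi *: u) (le_lt_trans y1 (le_lt_trans vuN sr1)).
have := H1 (xi *: u) (le_lt_trans y2 (le_lt_trans y2' sr1)).
rewrite deriveDv // !deriveZv // [x + (_ + _)]addrA.
set A1 := 'D_u f (x + s *: v + xi *: u); set A2 := 'D_u f (x + xi *: u).
set A0 := 'D_u f x => h2 h1.
have eN : 0 <= e / N by rewrite divr_ge0 ?ltW.
have {}h1 := le_trans h1 (ler_wpM2l eN y1).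
have {}h2 := le_trans h2 (ler_wpM2l eN y2).
have -> : e = e / N * N by rewrite divfK // gt_eqF.
by apply: (mean_value_estimate s0 eN _ h1 h2); rewrite /N lerDl ler01.
Qed.

(** The second difference is symmetric in [u] and [v], and both iterated derivatives approximate it
    to within o(s^2). *)
Lemma deriveC f x u v : (\near x, differentiable f x) ->
  differentiable ('D_u f) x -> differentiable ('D_v f) x ->
  'D_v ('D_u f) x = 'D_u ('D_v f) x.
Proof.
move=> fnear du dv; apply/eqP; rewrite -subr_eq0 -normr_le0.
apply/ler_addgt0Pl => e e0; rewrite addr0.
have e20 : 0 < e / 2 by rewrite divr_gt0.
have [r1 r10 H1] := second_difference v fnear du e20.
have [r2 r20 H2] := second_difference u fnear dv e20.
pose s := Num.min r1 r2 / 2.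
have s0 : 0 < s by rewrite divr_gt0 // lt_min r10.
have sr : s < Num.min r1 r2 by rewrite /s; move: s0; rewrite /s; lra.
have /andP[sr1 sr2] : (s < r1) && (s < r2) by rewrite -lt_min.
have := H1 s; have := H2 s; rewrite s0 sr1 sr2 => /(_ isT) h2 /(_ isT) h1.
rewrite [v + u]addrC -[_ - f (x + s *: v) - _]addrA [- f (x + s *: v) - _]addrC addrA in h2.
exact: common_value_dist s0 h1 h2.
Qed.

Lemma smooth_deriveC U f u v x : open U -> smooth_on U f -> U x ->
  'D_v ('D_u f) x = 'D_u ('D_v f) x.
Proof.
move=> oU sf Ux; apply: deriveC.
- by apply: filterS (open_nbhs_nbhs (conj oU Ux)) => y; exact: smooth_diff.
- exact: smooth_diff (smooth_derive u sf) Ux.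
- exact: smooth_diff (smooth_derive v sf) Ux.
Qed.

Lemma near_min_derive_ge0 f x w : differentiable f x ->
  (\forall y \near x, f x <= f y) -> 0 <= 'D_w f x.
Proof.
move=> df /nbhs_normP[r /= r0 H]; apply/ler_addgt0Pl => e e0; rewrite addrC.
have N0 : 0 < `|w| + 1 by rewrite ltr_wpDl.
have [r1 r10 H1] := diff_bound df (divr_gt0 e0 N0).
pose s := Num.min r r1 / (`|w| + 1) / 2.
have s0 : 0 < s by rewrite !divr_gt0 // lt_min r0.
have : s * (`|w| + 1) < Num.min r r1.
  have m0 : 0 < Num.min r r1 by rewrite lt_min r0.
  by rewrite /s mulrAC divfK ?gt_eqF //; lra.
rewrite lt_min => /andP[sr sr1].
have sw : `|s *: w| < s * (`|w| + 1).
  by rewrite normrZ gtr0_norm // ltr_pM2l // ltrDl.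
have := H1 (s *: w) (lt_trans sw sr1).
have /H fx : ball_ Num.norm x r (x + s *: w).
  by rewrite /ball_ /= opprD addNKr normrN (lt_trans sw).
rewrite deriveZv // => h.
have e1 : e / (`|w| + 1) * `|s *: w| <= s * e.
  have -> : s * e = e / (`|w| + 1) * (s * (`|w| + 1)) by field; rewrite gt_eqF.
  by apply: ler_wpM2l; rewrite ?divr_ge0 // ltW.
by apply: slope_ge s0 _ h e1; rewrite subr_ge0.
Qed.

Lemma near_min_derive f x w : differentiable f x ->
  (\forall y \near x, f x <= f y) -> 'D_w f x = 0.
Proof.
move=> df fmin; have h1 := near_min_derive_ge0 w df fmin.
have := near_min_derive_ge0 (-1 *: w) df fmin; rewrite deriveZv // => h2.
by apply/eqP; rewrite eq_le h1 andbT -oppr_ge0 -mulN1r.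
Qed.

(** The mean value theorem gives points x + t w arbitrarily near [x], with t > 0, where ['D_w f] is
    nonnegative. Since ['D_w f] vanishes at [x], its slope there cannot be negative. *)
Lemma near_min_derive2 f x w : (\near x, differentiable f x) ->
  differentiable ('D_w f) x -> (\forall y \near x, f x <= f y) ->
  0 <= 'D_w ('D_w f) x.
Proof.
move=> dfn ddf fmin; have df := nbhs_singleton dfn.
have D0 := near_min_derive w df fmin.
apply/ler_addgt0Pl => e e0; rewrite addrC.
have N0 : 0 < `|w| + 1 by rewrite ltr_wpDl.
have [r1 r10 H1] := diff_bound ddf (divr_gt0 e0 N0).
have [r /= r0 H] : exists2 r, 0 < r & forall y, `|y| < r ->
    differentiable f (x + y) /\ f x <= f (x + y).
  have /nbhs_normP[r /= r0 H] : nbhs x (fun y => differentiable f y /\ f x <= f y).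
    exact: filterI.
  exists r => // y yr.
  by apply: H; rewrite /ball_ /= opprD addNKr normrN.
pose s := Num.min r r1 / (`|w| + 1) / 2.
have s0 : 0 < s by rewrite !divr_gt0 // lt_min r0.
have : s * (`|w| + 1) < Num.min r r1.
  have m0 : 0 < Num.min r r1 by rewrite lt_min r0.
  by rewrite /s mulrAC divfK ?gt_eqF //; lra.
rewrite lt_min => /andP[sr sr1].
have sw t : 0 <= t <= s -> `|t *: w| < s * (`|w| + 1).
  move=> /andP[t0 ts]; rewrite normrZ ger0_norm //.
  by rewrite (le_lt_trans (ler_wpM2r _ ts)) // ltr_pM2l // ltrDl.
have [t ts|t /andP[t0 ts] E] := MVT_line (f := f) (x := x) (w := w) s0.
  by have [] := H (t *: w) (lt_trans (sw t ts) sr).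
have tle : 0 <= t <= s by rewrite !ltW.
have := H1 (t *: w) (lt_trans (sw t tle) sr1); rewrite D0 subr0 deriveZv // => h.
have [|_ fs] := H (s *: w); first by rewrite (lt_trans (sw s _) sr) // lexx ltW.
have A0 : 0 <= 'D_w f (x + t *: w) by rewrite -(ler_pM2l s0) mulr0 -E subr_ge0.
have e1 : e / (`|w| + 1) * `|t *: w| <= t * e.
  have -> : t * e = e / (`|w| + 1) * (t * (`|w| + 1)) by field; rewrite gt_eqF.
  apply: ler_wpM2l; first by rewrite divr_ge0 // ltW.
  by rewrite normrZ gtr0_norm // ler_wpM2l ?lerDl // ltW.
exact: slope_ge t0 A0 h e1.
Qed.
End Scalar.

(** * The differential ring of smooth functions on an open set *)

Section SmoothRing.
Variables (R : realType) (V : normedModType R) (U : set V) (oU : open U).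

(* Functions on the subtype, so that equality in the ring only sees [U]. *)
Definition extend (f : {x | U x} -> R) (x : V) : R^o :=
  if pselect (U x) is left p then f (exist _ x p) else 0.

Lemma extendE f x (p : U x) : extend f x = f (exist _ x p).
Proof.
rewrite /extend; case: pselect => [q|] //.
by congr (f (exist _ _ _)); exact: Prop_irrelevance.
Qed.

(* The dummy dependency on [oU] lets the ring structure be inferred. *)
Definition smooth_pred : {pred ({x | U x} -> R)} :=
  let _ := oU in fun f => `[< smooth_on U (extend f) >].

Lemma smooth_predP f : reflect (smooth_on U (extend f)) (f \in smooth_pred).
Proof. exact: asboolP. Qed.

Lemma smooth_subring : subring_closed smooth_pred.
Proof.
split => [|f g|f g].
- apply/smooth_predP; have S := @smooth_cst R V U 1 oU.
  by apply: (eq_smooth oU _ S) => x Ux; rewrite (extendE _ Ux).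
- move=> /smooth_predP sf /smooth_predP sg; apply/smooth_predP.
  have S := smoothD oU sf (smoothM oU (@smooth_cst R V U (-1) oU) sg).
  by apply: (eq_smooth oU _ S) => x Ux; rewrite !(extendE _ Ux) mulN1r.
- move=> /smooth_predP sf /smooth_predP sg; apply/smooth_predP.
  have S := smoothM oU sf sg.
  by apply: (eq_smooth oU _ S) => x Ux; rewrite !(extendE _ Ux).
Qed.

Record smf := Smf { sval_fun :> {x | U x} -> R ; _ : sval_fun \in smooth_pred }.
HB.instance Definition _ := [isSub of smf for sval_fun].
HB.instance Definition _ := [Choice of smf by <:].
HB.instance Definition _ :=
  GRing.SubChoice_isSubComPzRing.Build _ smooth_pred smf smooth_subring.

Definition ev (p : {x | U x}) (f : smf) : R := f p.

Lemma ev_zmod p : zmod_morphism (ev p). Proof. by []. Qed.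
Lemma ev_monoid p : monoid_morphism (ev p). Proof. by []. Qed.
HB.instance Definition _ p := GRing.isZmodMorphism.Build smf R (ev p) (ev_zmod p).
HB.instance Definition _ p := GRing.isMonoidMorphism.Build smf R (ev p) (ev_monoid p).

Lemma evD p f g : ev p (f + g) = ev p f + ev p g. Proof. by []. Qed.
Lemma evM p f g : ev p (f * g) = ev p f * ev p g. Proof. by []. Qed.

Lemma smf_ext (f g : smf) : (forall p, ev p f = ev p g) -> f = g.
Proof. by move=> fg; apply/val_inj/funext. Qed.

Lemma smf_smooth (f : smf) : smooth_on U (extend f).
Proof. by case: f => f /=; move/smooth_predP. Qed.

Definition restr (f : V -> R^o) : {x | U x} -> R := fun p => f (sval p).

Lemma extend_restr f x : U x -> extend (restr f) x = f x.
Proof. by move=> Ux; rewrite (extendE _ Ux). Qed.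

Lemma restr_smooth f : smooth_on U f -> restr f \in smooth_pred.
Proof.
move=> sf; apply/smooth_predP; apply: (eq_smooth oU _ sf) => x Ux.
by rewrite extend_restr.
Qed.

(* Junk value [0] when [f] is not smooth on [U]. *)
Definition mk (f : V -> R^o) : smf :=
  if pselect (smooth_on U f) is left sf then Smf (restr_smooth sf) else 0.

Lemma ev_mk f p : smooth_on U f -> ev p (mk f) = f (sval p).
Proof. by rewrite /mk; case: pselect. Qed.

Definition sder (v : V) (f : smf) : smf := mk ('D_v (extend f)).

Lemma ev_sder v f p : ev p (sder v f) = 'D_v (extend f) (sval p).
Proof. by rewrite ev_mk //; apply: smooth_derive; exact: smf_smooth. Qed.

Lemma ev_sder_mk v f p : smooth_on U f -> ev p (sder v (mk f)) = 'D_v f (sval p).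
Proof.
move=> sf; rewrite ev_sder; apply: (eq_derive_on oU); last exact: (svalP p).
by move=> x Ux; rewrite (extendE _ Ux) -[LHS]/(ev _ _) ev_mk.
Qed.

Lemma extend_ev (f : smf) x (Ux : U x) : extend f x = ev (exist _ x Ux) f.
Proof. exact: extendE. Qed.

Lemma extend_diff (f : smf) x : U x -> differentiable (extend f) x.
Proof. exact/smooth_diff/smf_smooth. Qed.

Lemma sderD v : {morph sder v : f g / f + g}.
Proof.
move=> f g; apply: smf_ext => -[x Ux]; rewrite evD !ev_sder /=.
rewrite -deriveD; [|exact/diff_derivable/extend_diff..].
apply: (eq_derive_on oU) => // y Uy.
by rewrite (extendE _ Uy); change (f (exist _ y Uy) + g (exist _ y Uy) = extend f y + extend g y);
   rewrite !(extendE _ Uy).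
Qed.

Lemma sderM v f g : sder v (f * g) = sder v f * g + f * sder v g.
Proof.
apply: smf_ext => -[x Ux]; rewrite evD !evM !ev_sder /=.
have := deriveM (diff_derivable (v := v) (extend_diff f Ux))
                (diff_derivable (v := v) (extend_diff g Ux)).
rewrite !(extendE _ Ux) => E.
transitivity ('D_v (extend f * extend g) x).
  apply: (eq_derive_on oU) => // y Uy; rewrite (extendE _ Uy).
  change (f (exist _ y Uy) * g (exist _ y Uy) = extend f y * extend g y).
  by rewrite !(extendE _ Uy).
by rewrite E addrC; congr (_ + _); rewrite mulrC.
Qed.

Lemma sderC u v f : sder u (sder v f) = sder v (sder u f).
Proof.
have s w : smooth_on U ('D_w (extend f)) := smooth_derive w (smf_smooth f).
apply: smf_ext => p; apply: etrans (ev_sder_mk u p (s v)) _.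
apply: etrans _ (esym (ev_sder_mk v p (s u))).
exact: (smooth_deriveC _ _ oU (smf_smooth f) (svalP p)).
Qed.

End SmoothRing.

(* The ring of smooth functions on [U] seen abstractly: [cal_ev p] evaluates at
   [p], [cal_d v] differentiates along [v]. *)
Record calculus (R : realType) (V : normedModType R) (U : set V) := Calculus {
  cal_ring :> comPzRingType;
  cal_ev : {x | U x} -> {rmorphism cal_ring -> R};
  cal_d : V -> cal_ring -> cal_ring;
  cal_ext : forall f g, (forall p, cal_ev p f = cal_ev p g) -> f = g;
  cal_dD : forall v, {morph cal_d v : f g / f + g};
  cal_dM : forall v f g, cal_d v (f * g) = cal_d v f * g + f * cal_d v g;
  cal_dC : forall u v f, cal_d u (cal_d v f) = cal_d v (cal_d u f);
  cal_evd : forall v F (f : V -> R^o) p, (forall q, cal_ev q F = f (sval q)) ->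
    cal_ev p (cal_d v F) = 'D_v f (sval p);
  cal_lift : forall f : V -> R^o, smooth_on U f ->
    exists F, forall p, cal_ev p F = f (sval p);
  cal_smooth : forall F (f : V -> R^o), (forall q, cal_ev q F = f (sval q)) ->
    smooth_on U f
}.

(** Sealed by [Qed]: later proofs reach the ring of smooth functions only through the fields of
    [calculus]. *)
Lemma smooth_calculus (R : realType) (V : normedModType R) (U : set V) :
  open U -> calculus U.
Proof.
move=> oU; apply: (@Calculus _ _ _ (smf oU) (@ev _ _ _ oU) (@sder _ _ _ oU)).
- exact: smf_ext.
- exact: sderD.
- exact: sderM.
- exact: sderC.
- move=> v F f p Ff; apply: etrans (ev_sder v F p) _.
  apply: (eq_derive_on oU); last exact: svalP.
  by move=> x Ux; rewrite (extend_ev _ Ux) Ff.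
- by move=> f sf; exists (mk oU f) => p; exact: ev_mk.
- move=> F f Ff; apply: (eq_smooth oU _ (smf_smooth F)) => x Ux.
  by rewrite (extend_ev _ Ux); exact: Ff.
Qed.

(** * Coordinate geometry *)

Section Sectional.
Variables (R : realType) (n : nat).
Implicit Types (u v w : 'rV[R]_n).

(** Strict Cauchy-Schwarz: evaluate the form at the nonzero vector (v, v) u - (u, v) v. *)
Lemma gram_gt0 (A : 'M[R]_n) u v : A^T = A ->
  (forall w, w != 0 -> 0 < inner A w w) -> row_free (col_mx u v) ->
  0 < inner A u u * inner A v v - inner A u v ^+ 2.
Proof.
move=> AT pA uv; have indep (a b : R) : a *: u + b *: v = 0 -> a = 0 /\ b = 0.
  move=> ab; have : row_mx a%:M b%:M *m col_mx u v = 0 :> 'rV_n.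
    by rewrite mul_row_col !mul_scalar_mx.
  rewrite -(mul0mx _ (col_mx u v)) => /(row_free_inj uv) /eqP.
  rewrite -row_mx0 => /eqP/eq_row_mx[/matrixP/(_ 0 0) + /matrixP/(_ 0 0)].
  by rewrite !mxE.
have v0 : v != 0.
  by apply/eqP => v0; have [] := indep 0 1; rewrite ?v0 ?scaler0 ?scale0r ?addr0 // => _ /eqP; rewrite oner_eq0.
have vv := pA _ v0.
have w0 : inner A v v *: u + (- inner A u v) *: v != 0.
  by apply/eqP => /indep[] /eqP; rewrite gt_eqF.
have := pA _ w0; rewrite !(innerDl, innerDr, innerZl, innerZr).
have -> : inner A v u = inner A u v by rewrite -inner_tr AT.
set a := inner A u u; set b := inner A v v; set c := inner A u v => H.
by rewrite -(pmulr_rgt0 _ vv) -/b; apply: lt_le_trans H _; lra.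
Qed.

Lemma dependent_pair u v : ~~ row_free (col_mx u v) ->
  v = 0 \/ exists a : R, u = a *: v.
Proof.
rewrite -kermx_eq0 => /rowV0Pn[z /sub_kermxP zuv z0].
have [v0|v0] := eqVneq v 0; [by left|right].
move: zuv; rewrite -[z]hsubmxK mul_row_col.
rewrite [lsubmx z]mx11_scalar [rsubmx z]mx11_scalar !mul_scalar_mx.
set a := lsubmx z 0 0; set b := rsubmx z 0 0 => E.
have a0 : a != 0.
  apply: contra_neq z0 => a0; move/eqP: E; rewrite a0 scale0r add0r.
  rewrite scaler_eq0 (negbTE v0) orbF => /eqP b0.
  by rewrite -[z]hsubmxK [lsubmx z]mx11_scalar [rsubmx z]mx11_scalar -/a -/b a0 b0
    !raddf0 row_mx0.
exists (- (a^-1 * b)); move/eqP: E; rewrite addr_eq0 => /eqP E.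
by rewrite scaleNr -scalerA -[b *: v]opprK -E scalerN opprK scalerA mulVf // scale1r.
Qed.

(** For independent vectors the sum is the negative of the numerator of the sectional curvature,
    whose denominator is positive. For dependent ones, where [sectional] says nothing, it vanishes
    by skew-symmetry. *)
Lemma sectional_ge0 (G : 'rV[R]_n -> 'M[R]_n) x (Rm : 'I_n -> 'I_n -> 'M[R]_n) :
  (G x)^T = G x -> (forall w, w != 0 -> 0 < inner (G x) w w) ->
  (forall a b c e, Rm a b c e = riemann G e c a b x) ->
  (forall i k, (Rm i k *m G x)^T = - (Rm i k *m G x)) ->
  (forall u v, row_free (col_mx u v) -> 0 <= sectional G x u v) ->
  forall v u, \sum_i \sum_k v 0 i * u 0 k * inner (Rm i k *m G x) v u <= 0.
Proof.
move=> GT Gp RmE alt sec v u.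
have flip (X : 'M[R]_n) : X^T = - X -> forall y z, inner X y z = - inner X z y.
  by move=> XT y z; rewrite -innerN -XT inner_tr.
set S := \sum_i _; have SE : - S = inner (G x) (curvature G x v u u) v.
  have -> : curvature G x v u u = \sum_i \sum_k (v 0 i * u 0 k) *: (u *m Rm i k).
    apply/matrixP => z e; rewrite ord1 mxE summxE; apply: eq_bigr => a _.
    rewrite summxE; apply: eq_bigr => b _; rewrite !mxE mulr_sumr.
    by apply: eq_bigr => c _; rewrite RmE mulrA.
  have -> : inner (G x) (\sum_i \sum_k (v 0 i * u 0 k) *: (u *m Rm i k)) v
     = \sum_i \sum_k (v 0 i * u 0 k) * inner (Rm i k *m G x) u v.
    rewrite /inner !mulmx_suml summxE; apply: eq_bigr => i _.
    rewrite !mulmx_suml summxE; apply: eq_bigr => k _.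
    by rewrite -!scalemxAl mxE !mulmxA.
  rewrite /S -sumrN; apply: eq_bigr => i _; rewrite -sumrN; apply: eq_bigr => k _.
  by rewrite (flip (Rm i k *m G x) (alt i k)) mulrN opprK.
rewrite -oppr_ge0 SE.
have [vu|/dependent_pair vu] := boolP (row_free (col_mx v u)).
  have gr := gram_gt0 GT Gp vu.
  by have := sec _ _ vu; rewrite /sectional pmulr_lge0 // invr_gt0.
rewrite -SE oppr_ge0 le_eqVlt; apply/orP; left; apply/eqP.
case: vu => [u0|[a va]]; rewrite /S big1 // => i _; rewrite big1 // => k _.
  by rewrite u0 mxE mulr0 mul0r.
suff E : inner (Rm i k *m G x) u u = 0 by rewrite va innerZl E !mulr0.
by have := flip (Rm i k *m G x) (alt i k) u u; lra.
Qed.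
End Sectional.

(** * Coordinate tensors as values of ring elements *)

Section Geometry.
Variables (R : realType) (n : nat) (U : set 'rV[R]_n) (C : calculus U).
Variable G : 'rV[R]_n -> 'M[R]_n.
Hypothesis G_sym : forall x, U x -> (G x)^T = G x.
Hypothesis G_pos : forall x, U x -> forall v, v != 0 -> 0 < inner (G x) v v.

Definition dc (a : 'I_n) : C -> C := cal_d (delta_mx 0 a).
Local Notation ev := (@cal_ev _ _ _ C).

Lemma dcD a : {morph dc a : x y / x + y}. Proof. exact: cal_dD. Qed.
Lemma dcM a x y : dc a (x * y) = dc a x * y + x * dc a y.
Proof. exact: cal_dM. Qed.
Lemma dcC a b x : dc a (dc b x) = dc b (dc a x). Proof. exact: cal_dC. Qed.

Lemma ev_dc a (F : C) (f : 'rV[R]_n -> R) p :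
  (forall q, ev q F = f (sval q)) -> ev p (dc a F) = partial a f (sval p).
Proof. exact: cal_evd. Qed.

Lemma dc_cst a (F : C) (x : R) : (forall q, ev q F = x) -> dc a F = 0.
Proof.
move=> Fx; apply: cal_ext => p; rewrite rmorph0.
by rewrite (@ev_dc a F (cst x) p Fx) /partial derive_cst.
Qed.

Lemma cal_double_inj (f : C) : f + f = 0 -> f = 0.
Proof.
move=> ff; apply: cal_ext => p; have := congr1 (ev p) ff.
by rewrite rmorphD rmorph0 => E; lra.
Qed.

Lemma mat_ext m k (X Y : 'M[C]_(m, k)) :
  (forall p, map_mx (ev p) X = map_mx (ev p) Y) -> X = Y.
Proof.
move=> XY; apply/matrixP => i j; apply: cal_ext => p.
by have /matrixP/(_ i j) := XY p; rewrite !mxE.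
Qed.

Lemma posdef_unit x : U x -> G x \in unitmx.
Proof.
move=> Ux; rewrite unitmxE unitfE; apply/eqP => /eqP/det0P[v v0 vG].
by have := G_pos Ux v0; rewrite /inner vG mul0mx mxE ltxx.
Qed.

Lemma posdef_psd x : U x -> psd (G x).
Proof.
move=> Ux v; have [->|v0] := eqVneq v 0; first by rewrite inner0l.
exact/ltW/G_pos.
Qed.

Lemma invmx_psd x : U x -> psd (invmx (G x)).
Proof.
move=> Ux v; have := posdef_psd Ux (v *m invmx (G x)).
rewrite /inner trmx_mul trmx_inv G_sym // mulmxKV ?posdef_unit //.
by rewrite !mulmxA.
Qed.

(** The inverse metric is lifted as the adjugate divided by the determinant, which is smooth because
    it is the value of a ring element and does not vanish on [U]. *)
Lemma lift_metric : (forall i j, smooth_on U (fun x => (G x i j : R^o))) ->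
  open U -> exists gm gim : 'M[C]_n, (forall p, map_mx (ev p) gm = G (sval p)) /\
  (forall p, map_mx (ev p) gim = invmx (G (sval p))).
Proof.
move=> Gs oU; have /choice[gm gmE] : forall ij : 'I_n * 'I_n, exists F : C,
    forall p, ev p F = G (sval p) ij.1 ij.2.
  by move=> ij; exact: (cal_lift C (Gs ij.1 ij.2)).
pose g : 'M[C]_n := \matrix_(i, j) gm (i, j).
have gE p : map_mx (ev p) g = G (sval p).
  by apply/matrixP => i j; rewrite !mxE gmE.
have detE p : ev p (\det g) = \det (G (sval p)) by rewrite -det_map_mx gE.
have dets := cal_smooth (f := fun x => (\det (G x) : R^o)) detE.
have [|iv ivE] := cal_lift C (smoothV oU _ dets).
  by move=> x Ux; rewrite -unitfE -unitmxE posdef_unit.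
exists g, (iv *: \adj g); split => // p.
rewrite map_mxZ map_mx_adj gE ivE /invmx posdef_unit //; exact: svalP.
Qed.

Variables (gm gim : 'M[C]_n) (half : C) (Gm : 'I_n -> 'M[C]_n).
Hypothesis gmE : forall p, map_mx (ev p) gm = G (sval p).
Hypothesis gimE : forall p, map_mx (ev p) gim = invmx (G (sval p)).
Hypothesis half2 : half + half = 1.
Hypothesis GmE : Gm = lc dc gm gim half.

Lemma gmT : gm^T = gm.
Proof. by apply: mat_ext => p; rewrite -map_trmx gmE G_sym //; exact: svalP. Qed.

Lemma ggi : gm *m gim = 1%:M.
Proof.
apply: mat_ext => p; rewrite map_mxM gmE gimE map_mx1 mulmxV //.
exact/posdef_unit/svalP.
Qed.

Lemma gig : gim *m gm = 1%:M.
Proof.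
apply: mat_ext => p; rewrite map_mxM gmE gimE map_mx1 mulVmx //.
exact/posdef_unit/svalP.
Qed.

Lemma giT : gim^T = gim.
Proof.
apply: mat_ext => p; rewrite -map_trmx gimE trmx_inv G_sym //; exact: svalP.
Qed.

Lemma ev_half p : ev p half = 2^-1.
Proof. by have := congr1 (ev p) half2; rewrite rmorphD rmorph1; lra. Qed.

Lemma GmC a b c : Gm a b c = Gm b a c.
Proof. by rewrite GmE lcC //; exact: gmT. Qed.

Lemma dgm a : dm dc a gm = Gm a *m gm + gm *m (Gm a)^T.
Proof. by rewrite GmE; apply: lc_metric => //; [exact: gmT|exact: giT|exact: gig]. Qed.

Lemma ev_gm p i j : ev p (gm i j) = G (sval p) i j.
Proof. by rewrite -gmE mxE. Qed.

Lemma ev_gim p i j : ev p (gim i j) = invmx (G (sval p)) i j.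
Proof. by rewrite -gimE mxE. Qed.

Lemma ev_dg a p i j :
  ev p (dc a (gm i j)) = partial a (fun y => G y i j) (sval p).
Proof. by apply: ev_dc => q; exact: ev_gm. Qed.

Lemma ev_Gm p a b c : ev p (Gm a b c) = christoffel G c a b (sval p).
Proof.
rewrite GmE mxE rmorphM ev_half rmorph_sum /=; congr (_ * _).
apply: eq_bigr => e _; rewrite rmorphM ev_gim; congr (_ * _).
by rewrite rmorphB rmorphD /= !ev_dg.
Qed.

Lemma ev_dGm p e a b c :
  ev p (dc e (Gm a b c)) = partial e (christoffel G c a b) (sval p).
Proof. by apply: ev_dc => q; exact: ev_Gm. Qed.

Lemma ev_rm p a b c e : ev p (rm dc Gm a b c e) = riemann G e c a b (sval p).
Proof.
rewrite rmE rmorphD rmorphB /= !ev_dGm rmorph_sum; congr (_ + _).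
by apply: eq_bigr => f _; rewrite rmorphB !rmorphM /= !ev_Gm.
Qed.

Lemma ev_ric p b c : ev p (ric dc Gm b c) = ricci G b c (sval p).
Proof. by rewrite mxE rmorph_sum; apply: eq_bigr => a _; exact: ev_rm. Qed.

Lemma nric0 : (forall x, U x -> forall i j k, nabla_ricci G i j k x = 0) ->
  forall k, nric dc Gm k = 0.
Proof.
move=> h k; apply/matrixP => i j; rewrite nabE [RHS]mxE; apply: cal_ext => p.
rewrite rmorph0; apply: etrans _ (h _ (svalP p) k i j).
rewrite !rmorphB !rmorph_sum /nabla_ricci.
congr (_ - _ - _).
- by apply: ev_dc => q; exact: ev_ric.
- by apply: eq_bigr => e _; rewrite rmorphM /= ev_Gm ev_ric.
- by apply: eq_bigr => e _; rewrite rmorphM /= ev_Gm ev_ric.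
Qed.

Lemma ev_hes p (F : C) (f : 'rV[R]_n -> R) : (forall q, ev q F = f (sval q)) ->
  map_mx (ev p) (hes dc Gm F) = hessian G f (sval p).
Proof.
move=> Ff; apply/matrixP => a b; rewrite !mxE rmorphB rmorph_sum; congr (_ - _).
  by apply: ev_dc => q; exact: ev_dc.
by apply: eq_bigr => c _; rewrite rmorphM /= ev_Gm (ev_dc _ _ Ff).
Qed.

Lemma ev_lap p (F : C) (f : 'rV[R]_n -> R) : (forall q, ev q F = f (sval q)) ->
  ev p (lap dc gim Gm F) = laplacian G f (sval p).
Proof. by move=> Ff; rewrite /lap -trace_map_mx map_mxM gimE (ev_hes _ Ff). Qed.

Lemma ev_dot p (F K : C) (f h : 'rV[R]_n -> R) :
  (forall q, ev q F = f (sval q)) -> (forall q, ev q K = h (sval q)) ->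
  ev p (dot gim (om dc F) (om dc K)) =
  inner (G (sval p)) (grad G f (sval p)) (grad G h (sval p)).
Proof.
move=> Ff Kh; rewrite /dot -trace_map_mx !map_mxM gimE.
set r := \row_a partial a f (sval p); set s := \row_a partial a h (sval p).
have -> : map_mx (ev p) (om dc F) = r^T.
  by apply/matrixP => i j; rewrite !mxE (ev_dc _ _ Ff).
have -> : map_mx (ev p) (om dc K)^T = s.
  by apply/matrixP => i j; rewrite !mxE (ev_dc _ _ Kh).
rewrite /grad /inner -/r -/s trmx_mul trmx_inv (G_sym (svalP p)).
rewrite -[r *m _ *m _]mulmxA mulVmx ?mulmx1; last exact/posdef_unit/svalP.
rewrite mulmxA mxtrace_mulC mulmxA -mxtrace_tr trmx_mul trmxK /mxtrace big_ord1.
by rewrite trmx_mul trmx_inv (G_sym (svalP p)) ?mulmxA.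
Qed.

Lemma cal_cst x : exists F : C, forall q, ev q F = x.
Proof.
have sx : smooth_on U (cst x : 'rV[R]_n -> R^o).
  by move=> vs y _; apply: (@smooth_cst _ _ setT x openT vs y).
by have [F FE] := cal_lift C sx; exists F.
Qed.

Lemma cal_coord a : exists F : C, (forall q, ev q F = sval q 0 a) /\
  forall b q, ev q (dc b F) = (b == a)%:R.
Proof.
pose f := fun x : 'rV[R]_n => (x 0 a : R^o).
have fl : linear f by move=> c x y; rewrite /f !mxE.
pose fL := GRing.isLinear.Build _ _ _ _ _ fl.
pose l : {linear 'rV[R]_n -> R^o} := HB.pack f fL.
have cl : continuous l.
  by move=> x; apply: differentiable_continuous; exact: differentiable_coord.
have sl : smooth_on U l by move=> vs y _; exact: smooth_linear cl vs y I.
have [F FE] := cal_lift C sl; exists F; split => // b q.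
rewrite (@ev_dc b F l q FE) /partial deriveE; last exact: linear_differentiable.
by rewrite diff_lin //= /f mxE eqxx eq_sym.
Qed.

(** Extend [v] affinely in the coordinates, with slope - v Gm_a in direction a. Plain derivatives at
    [p] of a form evaluated on [V] are then covariant derivatives of the form. *)
Lemma parallel_row p (v : 'rV[R]_n) : exists V : 'rV[C]_n,
  map_mx (ev p) V = v /\
  forall a, map_mx (ev p) (dm dc a V + V *m Gm a) = 0.
Proof.
have /choice[cc ccE] := cal_cst; have /choice[X XE] := cal_coord.
have dcc a x : dc a (cc x) = 0 by exact: dc_cst (ccE x).
pose m a := v *m map_mx (ev p) (Gm a).
pose V : 'rV[C]_n := \row_i (cc (v 0 i)
  - \sum_a cc (m a 0 i) * (X a - cc (sval p 0 a))).
have VE : map_mx (ev p) V = v.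
  apply/matrixP => i j; rewrite ord1 !mxE rmorphB rmorph_sum /= ccE big1 ?subr0 //.
  by move=> a _; rewrite rmorphM rmorphB /= !ccE (XE a).1 subrr mulr0.
exists V; split => // a; rewrite map_mxD map_mxM VE -/(m a).
apply/matrixP => i j; rewrite ord1 2!mxE dmE mxE.
rewrite dcD (dN dcD) (d_sum dcD) dcc add0r raddfN raddf_sum /=.
rewrite (bigD1 a) //= big1 => [|b ba]; rewrite dcM dcc mul0r add0r dcD (dN dcD) dcc.
  by rewrite subr0 addr0 rmorphM /= ccE (XE a).2 eqxx mulr1 addNr [RHS]mxE.
by rewrite subr0 rmorphM /= (XE b).2 eq_sym (negbTE ba) mulr0.
Qed.

Lemma ev_calD (F : C) w p : ev p (cal_d w F) = \sum_a w 0 a * ev p (dc a F).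
Proof.
pose f := extend (fun q => ev q F).
have Ff q : ev q F = f (sval q) by case: q => x Ux; rewrite /f (extendE _ Ux).
have df := smooth_diff (cal_smooth Ff) (svalP p).
rewrite (cal_evd w p Ff) deriveE // {1}(row_sum_delta w) linear_sum.
by apply: eq_bigr => a _; rewrite linearZ (ev_dc a p Ff) /partial deriveE.
Qed.

(** With [V] extending [v] and parallel at [p], the scalar X(V, V) is nonnegative and vanishes at
    [p]; its first and second order minimum conditions are the two conclusions. *)
Lemma parallel_min p (X : 'M[C]_n) v : open U -> X^T = X ->
  (forall q, psd (map_mx (ev q) X)) -> v *m map_mx (ev p) X = 0 ->
  (forall a, inner (map_mx (ev p) (nab dc Gm a X)) v v = 0) /\
  0 <= \sum_k \sum_l invmx (G (sval p)) k l *
         inner (map_mx (ev p) (nab2 dc Gm k l X)) v v.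
Proof.
move=> oU XT pX vX; have [V [VE DV]] := parallel_row p v.
pose Q := (V *m X *m V^T) 0 0; pose f := extend (fun q => ev q Q).
have Qf q : ev q Q = f (sval q) by case: q => x Ux; rewrite /f (extendE _ Ux).
have QE q : ev q Q = inner (map_mx (ev q) X) (map_mx (ev q) V) (map_mx (ev q) V).
  by rewrite /inner map_trmx -!map_mxM [RHS]mxE.
have fmin : \forall y \near sval p, f (sval p) <= f y.
  apply: filterS (open_nbhs_nbhs (conj oU (svalP p))) => y Uy.
  rewrite -Qf -(Qf (exist _ y Uy)) !QE VE {1}/inner vX mul0mx mxE.
  exact: pX.
have sf := cal_smooth Qf.
have fdiff : \forall y \near sval p, differentiable f y.
  apply: filterS (open_nbhs_nbhs (conj oU (svalP p))) => y Uy.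
  exact: smooth_diff sf Uy.
have Xv : map_mx (ev p) X *m v^T = 0.
  by rewrite -[LHS]trmxK trmx_mul trmxK map_trmx XT vX trmx0.
have D1 a Y : map_mx (ev p) (dm dc a (V *m Y *m V^T)) =
    v *m map_mx (ev p) (nab dc Gm a Y) *m v^T.
  rewrite (d_form dcD dcM Gm); move: (nab dc Gm a Y) => N.
  move: (dm dc a V + V *m Gm a) (DV a) => E E0.
  by rewrite !map_mxD !map_mxM -!map_trmx E0 trmx0 mulmx0 mul0mx !addr0 VE.
have D1E a Y : ev p (dc a ((V *m Y *m V^T) 0 0)) = inner (map_mx (ev p) (nab dc Gm a Y)) v v.
  by rewrite /inner -D1 [RHS]mxE dmE.
(* The second derivatives of [V] are multiplied by [X *m V^T] or [V *m X], which vanish at [p]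
   because [v] lies in the kernel. *)
have D2 k l : ev p (dc k (dc l Q)) = inner (map_mx (ev p) (nab dc Gm k (nab dc Gm l X))) v v.
  have -> : dc l Q = (dm dc l (V *m X *m V^T)) 0 0 by rewrite dmE.
  rewrite -D1E -[LHS]/(ev p (dc k (dm dc l (V *m X *m V^T) 0 0))) -!dmE.
  rewrite (d_form dcD dcM Gm) (dmD dcD) (dmD dcD) [dm _ _ (_ *m (X *m _))](dmM dcD dcM).
  rewrite [dm _ _ (V *m X *m _)](dmM dcD dcM) dmT.
  set E := dm dc l V + V *m Gm l; set Y := V *m nab dc Gm l X *m V^T.
  have E0 : map_mx (ev p) E = 0 by exact: DV.
  move: E E0 Y => E E0 Y.
  have -> : ev p ((dm dc k Y + (dm dc k E *m (X *m V^T) + E *m dm dc k (X *m V^T)) +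
    (dm dc k (V *m X) *m E^T + V *m X *m (dm dc k E)^T)) 0 0) =
    map_mx (ev p) (dm dc k Y + (dm dc k E *m (X *m V^T) + E *m dm dc k (X *m V^T)) +
    (dm dc k (V *m X) *m E^T + V *m X *m (dm dc k E)^T)) 0 0 by rewrite [RHS]mxE.
  rewrite !map_mxD !map_mxM -!map_trmx E0 VE vX Xv.
  by rewrite !(mul0mx, mulmx0, trmx0, addr0) mxE.
have Dw w q : 'D_w f (sval q) = ev q (cal_d w Q) by rewrite (cal_evd w q Qf).
have ddf w : differentiable ('D_w f) (sval p).
  exact: smooth_diff (smooth_derive w sf) (svalP p).
have D1z a : ev p (dc a Q) = 0.
  by rewrite -Dw (near_min_derive _ (nbhs_singleton fdiff) fmin).
have nabz a : inner (map_mx (ev p) (nab dc Gm a X)) v v = 0 by rewrite -D1E D1z.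
split => //.
(* The coordinate Hessian of the scalar is positive semidefinite, so its trace against the inverse
   metric is nonnegative. The connection terms in [nab2] drop out by the first order condition. *)
pose B : 'M[R]_n := \matrix_(k, l) ev p (dc k (dc l Q)).
have BT : B^T = B by apply/matrixP => i j; rewrite !mxE dcC.
have pB : psd B.
  move=> w; have := near_min_derive2 fdiff (ddf w) fmin.
  have -> : 'D_w ('D_w f) (sval p) = ev p (cal_d w (cal_d w Q)).
    by apply/esym/cal_evd => q; exact: esym (Dw w q).
  rewrite ev_calD innerE.
  suff -> : \sum_a w 0 a * ev p (dc a (cal_d w Q)) =
    \sum_i \sum_j w 0 i * B i j * w 0 j by [].
  apply: eq_bigr => a _; rewrite /dc cal_dC ev_calD mulr_sumr.
  by apply: eq_bigr => b _; rewrite [B a b]mxE (dcC a b) /dc; ring.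
have := psd_trace (invmx_psd (svalP p)) BT pB; congr (0 <= _).
apply: eq_bigr => k _; apply: eq_bigr => l _; congr (_ * _).
rewrite mxE D2 /nab2.
have -> : map_mx (ev p) (nab dc Gm k (nab dc Gm l X) - \sum_e Gm k l e *: nab dc Gm e X)
  = map_mx (ev p) (nab dc Gm k (nab dc Gm l X))
    - \sum_e ev p (Gm k l e) *: map_mx (ev p) (nab dc Gm e X).
  move: (nab dc Gm k _) (fun e => nab dc Gm e X) => Y Z.
  rewrite map_mxB; congr (_ - _); apply/matrixP => i j.
  rewrite mxE !summxE raddf_sum; apply: eq_bigr => e _.
  by rewrite /= !scalemxE rmorphM [in RHS]mxE.
rewrite innerD innerN inner_sum big1 ?subr0 // => e _.
by rewrite innerZ nabz mulr0.
Qed.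
End Geometry.

(** * Spatial minimum of the Hessian *)

(** Carries the ring identity [hes_log_heat] through evaluation at a point, into the shape expected
    by [reaction_ge]. *)
Lemma map_reaction (C : comPzRingType) (R : realType) (f : {rmorphism C -> R}) n
  (g gi H ric : 'M[C]_n) (rm N : 'I_n -> 'I_n -> 'M[C]_n) (T : 'I_n -> 'M[C]_n)
  (Hft hW : 'M[C]_n) (w : 'cV[C]_n) (h : C) i j :
  Hft i j = \sum_k \sum_l gi k l * N k l i j
    - 2 * (\sum_k (rm i k *m g *m (gi *m H *m gi)) j k)
    - (H *m gi *m ric) j i - (H *m gi *m ric) i j
    + (2 * (\sum_k w k 0 * T k i j)
       - 2 * (\sum_k (rm i k *m g *m w) j 0 * w k 0)
       + 2 * (H *m gi *m H) i j)
    - h * hW i j ->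
  let m p q (X : 'M[C]_(p, q)) := map_mx f X in
  m n n Hft i j = \sum_k \sum_l m n n gi k l * m n n (N k l) i j
    - 2 * (\sum_k (m n n (rm i k) *m m n n g *m
                    (m n n gi *m m n n H *m m n n gi)) j k)
    - (m n n H *m m n n gi *m m n n ric) j i
    - (m n n H *m m n n gi *m m n n ric) i j
    + (2 * (\sum_k m n 1%N w k 0 * m n n (T k) i j)
       - 2 * (\sum_k (m n n (rm i k) *m m n n g *m m n 1%N w) j 0 * m n 1%N w k 0)
       + 2 * (m n n H *m m n n gi *m m n n H) i j)
    - f h * m n n hW i j.
Proof.
move=> E m; rewrite /m -!map_mxM [LHS]mxE E.
have f2 x : f (2 * x) = 2 * f x by rewrite rmorphM rmorph_nat.
have fE p q (X : 'M[C]_(p, q)) a b : f (X a b) = map_mx f X a b by rewrite mxE.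
have fsum (F G : 'I_n -> _) : (forall k, f (F k) = G k) ->
    f (\sum_k F k) = \sum_k G k.
  by move=> FG; rewrite raddf_sum; apply: eq_bigr => k _; exact: FG.
have fN x : f (- x) = - f x by exact: rmorphN.
have fD x y : f (x + y) = f x + f y by exact: rmorphD.
have fM x y : f (x * y) = f x * f y by exact: rmorphM.
rewrite !(fN, fD, f2) fM -!fE; congr (_ - 2 * _ - _ - _ + (2 * _ - 2 * _ + 2 * _) - _).
- by apply: (fsum) => k; apply: (fsum) => l; rewrite fM !fE.
- by apply: fsum => k; rewrite -!map_mxM fE.
- by apply: fsum => k; rewrite fM !fE.
- by apply: fsum => k; rewrite -!map_mxM fM !fE.
Qed.

Section Spatial.
Variables (R : realType) (n : nat) (U : set 'rV[R]_n) (oU : open U).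
Variable G : 'rV[R]_n -> 'M[R]_n.
Hypothesis G_smooth : forall i j, smooth_on U (fun x => (G x i j : R^o)).
Hypothesis G_sym : forall x, U x -> (G x)^T = G x.
Hypothesis G_pos : forall x, U x -> forall v, v != 0 -> 0 < inner (G x) v v.
Hypothesis ric_par : forall x, U x -> forall i j k, nabla_ricci G i j k x = 0.

Definition potential (U1 U2 : 'rV[R]_n -> R) x :=
  laplacian G U1 x + 2^-1 * inner (G x) (grad G U1 x) (grad G U1 x) - 2 * U2 x.

(** Time is frozen here: [rt] stands for the time derivative of [r], so [rt / r] is that of [ln r].
    As [U1] does not move, the Hessian of [rt / r] is the time derivative of [H]. *)
Lemma hessian_ge_at_min (U1 U2 r rt : 'rV[R]_n -> R^o) x0 (k mu : R) v :
  smooth_on U U1 -> smooth_on U U2 -> smooth_on U r -> smooth_on U rt ->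
  (forall x, U x -> 0 < r x) ->
  (forall x, U x -> rt x = laplacian G r x
     + inner (G x) (grad G U1 x) (grad G r x) + U2 x * r x) ->
  U x0 ->
  (forall u w, row_free (col_mx u w) -> 0 <= sectional G x0 u w) ->
  inner (hessian G (potential U1 U2) x0) v v <= k ^+ 2 * inner (G x0) v v ->
  let H x := hessian G (fun y => ln (r y)) x + 2^-1 *: hessian G U1 x in
  (forall x, U x -> psd (H x - mu *: G x)) ->
  inner (H x0 - mu *: G x0) v v = 0 ->
  (2 * mu ^+ 2 - k ^+ 2 / 2) * inner (G x0) v v <=
    inner (hessian G (fun y => rt y / r y) x0) v v.
Proof.
move=> sU1 sU2 sr srt rpos heat Ux0 sec hesW H pH zH.
have C := smooth_calculus oU.
have [gm [gim [gmE gimE]]] := lift_metric C G_pos G_smooth oU.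
have [half halfE] := cal_cst C 2^-1; have [cmu muE] := cal_cst C mu.
have half2 : half + half = 1.
  by apply: cal_ext => p; rewrite rmorphD rmorph1 /= halfE; lra.
pose Gm := lc (@dc R n U C) gm gim half.
have GmE : Gm = lc (@dc R n U C) gm gim half by [].
have [F FE] := cal_lift C (smooth_ln oU rpos sr).
have [r' rE] := cal_lift C sr; have [rt' rtE] := cal_lift C srt.
have [u1 u1E] := cal_lift C sU1; have [u2 u2E] := cal_lift C sU2.
have r0 x : U x -> r x != 0 by move/rpos/lt0r_neq0.
have [ft ftE] := cal_lift C (smoothM oU srt (smoothV oU r0 sr)).
have GmC a b c : Gm a b c = Gm b a c by exact: (GmC G_sym gmE GmE).
have dgmE a : dm (@dc R n U C) a gm = Gm a *m gm + gm *m (Gm a)^T by exact: (dgm G_sym G_pos gmE gimE half2 GmE).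
have gmT : gm^T = gm by exact: (gmT G_sym gmE).
have giT : gim^T = gim by exact: (giT G_sym gimE).
have ggi : gm *m gim = 1%:M by exact: (ggi G_pos gmE gimE).
have gig : gim *m gm = 1%:M by exact: (gig G_pos gmE gimE).
have nric0 : forall a, nric (@dc R n U C) Gm a = 0.
  by exact: (nric0 gmE gimE half2 GmE ric_par).
have lapE p (K : C) (f : 'rV[R]_n -> R) : (forall q, cal_ev C q K = f (sval q)) ->
  cal_ev C p (lap (@dc R n U C) gim Gm K) = laplacian G f (sval p).
  by exact: (ev_lap gmE gimE half2 GmE).
have dotE p (K L : C) (f h : 'rV[R]_n -> R) :
  (forall q, cal_ev C q K = f (sval q)) -> (forall q, cal_ev C q L = h (sval q)) ->
  cal_ev C p (dot gim (om (@dc R n U C) K) (om (@dc R n U C) L)) =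
  inner (G (sval p)) (grad G f (sval p)) (grad G h (sval p)).
  by exact: (ev_dot G_sym G_pos gimE).
have hesE p (K : C) (f : 'rV[R]_n -> R) : (forall q, cal_ev C q K = f (sval q)) ->
  map_mx (cal_ev C p) (hes (@dc R n U C) Gm K) = hessian G f (sval p).
  by exact: (ev_hes gmE gimE half2 GmE).
have rmE p a b c e :
  cal_ev C p (rm (@dc R n U C) Gm a b c e) = riemann G e c a b (sval p).
  by exact: (ev_rm gmE gimE half2 GmE).
have pmin := parallel_min G_sym G_pos Gm.
(* From here on the connection is known only through the properties just collected. *)
move: Gm {GmE} GmC dgmE nric0 lapE hesE rmE pmin => Gm GmC dgmE nric0 lapE hesE rmE pmin.
have dr a : dc a r' = r' * dc a F.
  apply: cal_ext => p; have e1 := ev_dc a p rE.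
  have e2 : cal_ev C p (dc a F) = partial a (fun x => ln (r x)) (sval p).
    exact: ev_dc.
  rewrite rmorphM /= e1 e2 rE /partial derive_ln_comp; last first.
  - exact: smooth_diff sr (svalP p).
  - exact: rpos (svalP p).
  by rewrite mulVKf // r0 //; exact: svalP.
have rreg x : r' * x = 0 -> x = 0.
  move=> rx; apply: cal_ext => p; have /eqP := congr1 (cal_ev C p) rx.
  rewrite rmorphM !rmorph0 /= rE mulf_eq0 (negbTE (r0 _ (svalP p))) /=.
  by move/eqP.
have rtft : rt' = r' * ft.
  apply: cal_ext => p; rewrite rmorphM /= rtE rE ftE mulrC divfK //.
  by rewrite r0 //; exact: svalP.
have heat' : rt' = lap (@dc R n U C) gim Gm r'
    + dot gim (om (@dc R n U C) u1) (om (@dc R n U C) r') + u2 * r'.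
  apply: cal_ext => p; rewrite !rmorphD rmorphM /= rtE u2E rE heat; last exact: svalP.
  by rewrite (lapE _ _ _ rE) (dotE _ _ _ _ _ u1E rE).
have dcst := @dc_cst R n U C.
pose p0 : {x | U x} := exist _ x0 Ux0; pose e := cal_ev C p0.
have Fo i j := map_reaction e (hes_log_heat (@dcD R n U C) (@dcM R n U C) (@dcC R n U C)
  (@cal_double_inj R n U C) gmT giT ggi gig GmC dgmE nric0 half2 dr rreg rtft heat' i j).
have hesphi q : map_mx (cal_ev C q) (hes (@dc R n U C) Gm (phi half F u1)) = H (sval q).
  rewrite /phi (hesD (@dcD R n U C)) (hesZ (@dcM R n U C)); last first.
    by move=> a; exact: dcst a _ _ halfE.
  have hF : map_mx (cal_ev C q) (hes (@dc R n U C) Gm F) =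
    hessian G (fun y => ln (r y)) (sval q) by exact: hesE.
  by rewrite map_mxD map_mxZ /= halfE hF (hesE _ _ _ u1E).
have hespot : map_mx e (hes (@dc R n U C) Gm (pot (@dc R n U C) gim Gm half u1 u2))
    = hessian G (potential U1 U2) x0.
  apply: (hesE p0 _ (potential U1 U2)) => q.
  rewrite /pot rmorphB rmorphD !rmorphM /= rmorph_nat halfE u2E.
  by rewrite (lapE _ _ _ u1E) (dotE _ _ _ _ _ u1E u1E).
have hesft : map_mx e (hes (@dc R n U C) Gm ft) = hessian G (fun y => rt y / r y) x0.
  by apply: (hesE p0 _ (fun y => rt y / r y)) => q; rewrite ftE.
pose Hm := hes (@dc R n U C) Gm (phi half F u1); pose X := Hm - cmu *: gm.
have XE q : map_mx (cal_ev C q) X = H (sval q) - mu *: G (sval q).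
  by rewrite /X map_mxB map_mxZ muE hesphi gmE.
have HmT : Hm^T = Hm by exact: (hesT (@dcC R n U C) GmC).
have XT : X^T = X.
  by rewrite /X -[in RHS]gmT -[in RHS]HmT; apply/matrixP => i j; rewrite !mxE.
have HT : (H x0)^T = H x0 by rewrite -(hesphi p0) map_trmx HmT.
have GT := G_sym Ux0.
have PT : (H x0 - mu *: G x0)^T = H x0 - mu *: G x0.
  by rewrite -(XE p0) map_trmx XT.
have vX : v *m map_mx (cal_ev C p0) X = 0.
  by rewrite XE; apply: psd_ker PT (pH _ Ux0) zH.
have pX q : psd (map_mx (cal_ev C q) X) by rewrite XE; exact: pH (svalP q).
have dmu a : dc a cmu = 0 by exact: dcst a _ _ muE.
have nabX a : nab (@dc R n U C) Gm a X = nab (@dc R n U C) Gm a Hm.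
  exact: (nab_metric (@dcD R n U C) (@dcM R n U C) dgmE).
have nab2X a b : nab2 (@dc R n U C) Gm a b X = nab2 (@dc R n U C) Gm a b Hm.
  by rewrite /nab2 nabX; congr (_ - _); apply: eq_bigr => c _; rewrite nabX.
have [nabz N0] := pmin p0 X v oU XT pX vX.
have Kalt i j : (rml (@dc R n U C) gm Gm i j)^T = - rml (@dc R n U C) gm Gm i j.
  exact: (rml_alt (@dcD R n U C) (@dcM R n U C) (@dcC R n U C) gmT dgmE).
have sec' := @sectional_ge0 R n G x0 (fun i k => map_mx e (rm (@dc R n U C) Gm i k)) GT
  (G_pos Ux0).
have -> : (2 * mu ^+ 2 - k ^+ 2 / 2) * inner (G x0) v v =
  2 * mu ^+ 2 * inner (G x0) v v - 2^-1 * (k ^+ 2 * inner (G x0) v v) by ring.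
apply: le_trans (_ : 2 * mu ^+ 2 * inner (G x0) v v
  - 2^-1 * inner (hessian G (potential U1 U2) x0) v v <= _).
  by rewrite lerD2l lerN2 ler_pM2l.
apply: (@reaction_ge R n (G x0) (invmx (G x0)) (H x0) (map_mx e (ric (@dc R n U C) Gm))
  (fun i k => map_mx e (rm (@dc R n U C) Gm i k))
  (fun i k => map_mx e (nab2 (@dc R n U C) Gm i k Hm))
  (fun k => map_mx e (nab (@dc R n U C) Gm k Hm)) _ _
  (map_mx e (gim *m om (@dc R n U C) (phi half F u1))) 2^-1 mu v) => //.
- by rewrite trmx_inv GT.
- exact: (invmx_psd G_sym G_pos Ux0).
- by rewrite mulmxV // (posdef_unit G_pos Ux0).
- move=> i k0; rewrite (rmN (@dc R n U C) Gm k0 i).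
  by apply/matrixP => a b; rewrite !mxE rmorphN.
- move=> i j; rewrite mxE [ric _ _ _ _]mxE raddf_sum.
  by apply: eq_bigr => a _; rewrite [RHS]mxE.
- exact: pH.
- by move: N0; under eq_bigr do under eq_bigr do rewrite nab2X.
- by move=> a; rewrite -nabX; exact: nabz.
- apply: sec'; last exact: sec.
    by move=> a b c f; rewrite mxE rmE.
  move=> i k0; have -> : map_mx e (rm (@dc R n U C) Gm i k0) *m G x0 =
    map_mx e (rml (@dc R n U C) gm Gm i k0) by rewrite /rml map_mxM gmE.
  by rewrite map_trmx Kalt map_mxN.
- move=> i j; have := Fo i j; rewrite /= hesft hespot hesphi gmE gimE halfE.
  exact.
Qed.
End Spatial.

(** * Tensoriality of the Hessian *)

Section LeviCivita.
Variables (R : realType) (n : nat).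

(** Lowered by [g], the tensor [B] is symmetric in its first two indices and skew in its last two.
    Alternating these exchanges three times returns to the start with sign -1. *)
Lemma levi_civita_unique (g : 'M[R]_n) (B : 'I_n -> 'M[R]_n) :
  g^T = g -> g \in unitmx -> (forall a b c, B a b c = B b a c) ->
  (forall a, B a *m g + g *m (B a)^T = 0) -> forall a, B a = 0.
Proof.
move=> gT gu Bs Bm a; suff K0 : B a *m g = 0.
  by rewrite -[B a](mulmxK gu) K0 mul0mx.
have Ks x y z : (B x *m g) y z = (B y *m g) x z.
  by rewrite !mxE; apply: eq_bigr => e _; rewrite Bs.
have Ka x y z : (B x *m g) y z = - (B x *m g) z y.
  have /matrixP/(_ y z) := Bm x.
  have -> : g *m (B x)^T = (B x *m g)^T by rewrite trmx_mul gT.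
  rewrite addmxE [_^T _ _]mxE [X in _ = X]mxE => /eqP.
  by rewrite addr_eq0 => /eqP.
apply/matrixP => b c; rewrite [RHS]mxE.
have E : (B a *m g) b c = - (B a *m g) b c.
  by rewrite {1}Ks {1}Ka {1}Ks {1}Ka opprK {1}Ks {1}Ka.
by lra.
Qed.

Definition gamma (G : 'rV[R]_n -> 'M[R]_n) x a : 'M[R]_n :=
  \matrix_(b, c) christoffel G c a b x.

Variables (U : set 'rV[R]_n) (G : 'rV[R]_n -> 'M[R]_n).
Hypothesis oU : open U.
Hypothesis G_smooth : forall i j, smooth_on U (fun x => (G x i j : R^o)).
Hypothesis G_sym : forall x, U x -> (G x)^T = G x.
Hypothesis G_pos : forall x, U x -> forall v, v != 0 -> 0 < inner (G x) v v.

Lemma gamma_levi_civita x : U x ->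
  (forall a b c, gamma G x a b c = gamma G x b a c) /\
  forall a, \matrix_(b, c) partial a (fun y => G y b c) x =
            gamma G x a *m G x + G x *m (gamma G x a)^T.
Proof.
move=> Ux; have C := smooth_calculus oU.
have [gm [gim [gmE gimE]]] := lift_metric C G_pos G_smooth oU.
have [half halfE] := cal_cst C 2^-1.
have half2 : half + half = 1.
  by apply: cal_ext => p; rewrite rmorphD rmorph1 /= halfE; lra.
pose Gm := lc (@dc R n U C) gm gim half.
have GmE : Gm = lc (@dc R n U C) gm gim half by [].
move: Gm GmE => Gm GmE.
pose p : {x | U x} := exist _ x Ux.
have gE a : map_mx (cal_ev C p) (Gm a) = gamma G x a.
  by apply/matrixP => b c; rewrite !mxE (ev_Gm gmE gimE half2 GmE).
split => [a b c|a].
  by rewrite -!gE !mxE (GmC G_sym gmE GmE).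
rewrite -gE -(gmE p) -map_mxM map_trmx -map_mxM -map_mxD.
rewrite -(dgm G_sym G_pos gmE gimE half2 GmE).
apply/matrixP => b c; rewrite mxE [RHS]mxE dmE; exact: (esym (ev_dg gmE a p b c)).
Qed.
End LeviCivita.

Section Change.
Variables (R : realType) (n : nat) (Uc Ud : set 'rV[R]_n).
Hypotheses (oUc : open Uc) (oUd : open Ud).
Variable t : 'rV[R]_n -> 'rV[R]_n.
Hypothesis t_smooth : smooth_on Uc t.
Hypothesis tU : forall x, Uc x -> Ud (t x).

Let tc i : 'rV[R]_n -> R^o := fun x => t x 0 i.

Lemma derive_coord m (h : 'rV[R]_n -> 'rV[R]_m) i v x : differentiable h x ->
  differentiable (fun y => (h y 0 i : R^o)) x /\
  'D_v (fun y => (h y 0 i : R^o)) x = 'D_v h x 0 i.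
Proof.
move=> dh; pose c := fun y : 'rV[R]_m => (y 0 i : R^o).
have cl : linear c by move=> a y z; rewrite /c !mxE.
pose cL := GRing.isLinear.Build _ _ _ _ _ cl.
pose l : {linear 'rV[R]_m -> R^o} := HB.pack c cL.
have cont : continuous l.
  by move=> y; apply: differentiable_continuous; exact: differentiable_coord.
have dl : differentiable l (h x) by exact: linear_differentiable.
have dc := differentiable_comp dh dl; split; first exact: dc.
by rewrite (deriveE v dc) (diff_comp dh dl) /= (diff_lin (h x) cont) deriveE.
Qed.

Lemma smooth_coord i : smooth_on Uc (tc i).
Proof.
move=> vs x Ux.
have E : forall y, Uc y -> foldr (fun v g => 'D_v g) (tc i) vs y =
    (foldr (fun v g => 'D_v g) t vs y) 0 i.
  elim: vs => //= v vs IH y Uy.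
  have [_ <-] := derive_coord i v (t_smooth vs Uy).
  exact: (eq_derive_on oUc IH).
apply: near_eq_differentiable (derive_coord i 0 (t_smooth vs Ux)).1.
by apply: filterS (open_nbhs_nbhs (conj oUc Ux)) => y /E.
Qed.

Lemma jacobian_coord x a i : Uc x -> ('J t x) a i = partial a (tc i) x.
Proof.
move=> Ux; have dt : differentiable t x := t_smooth [::] Ux.
rewrite /partial (derive_coord i _ dt).2 deriveEjacobian // -rowE.
by rewrite [RHS]mxE.
Qed.

Lemma partial_comp (h : 'rV[R]_n -> R^o) a x : Uc x -> differentiable h (t x) ->
  differentiable (h \o t) x /\
  partial a (h \o t) x = \sum_i ('J t x) a i * partial i h (t x).
Proof.
move=> Ux dh; have dt : differentiable t x := t_smooth [::] Ux.
have dht := differentiable_comp dt dh; split; first exact: dht.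
rewrite /partial deriveE // (diff_comp dt dh) /= -[X in 'd h _ X]deriveE //.
rewrite deriveEjacobian // -rowE {1}[row a _]row_sum_delta linear_sum.
by apply: eq_bigr => i _; rewrite linearZ mxE deriveE.
Qed.

Lemma partial_sum m (F : 'I_m -> 'rV[R]_n -> R^o) a x :
  (forall i, differentiable (F i) x) ->
  partial a (fun y => \sum_i F i y) x = \sum_i partial a (F i) x.
Proof.
move=> dF; rewrite /partial -[RHS]derive_sum; last by move=> i; exact: diff_derivable.
congr ('D_ _ _ x); apply/funext => y.
by rewrite fct_sumE.
Qed.

Lemma differentiable_sumR m (F : 'I_m -> 'rV[R]_n -> R^o) x :
  (forall i, differentiable (F i) x) -> differentiable (fun y => (\sum_i F i y : R^o)) x.
Proof.
move=> dF; have -> : (fun y => (\sum_i F i y : R^o)) = \sum_(i < m) F i.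
  by apply/funext => y; rewrite fct_sumE.
exact: differentiable_sum.
Qed.

Lemma partialM (f h : 'rV[R]_n -> R^o) a x : differentiable f x -> differentiable h x ->
  partial a (fun y => f y * h y) x = partial a f x * h x + f x * partial a h x.
Proof.
move=> df dh; rewrite /partial.
have := deriveM (diff_derivable (v := delta_mx 0 a) df)
                (diff_derivable (v := delta_mx 0 a) dh).
move=> E; apply: etrans E _; rewrite addrC; congr (_ + _).
by rewrite /GRing.scale /= mulrC.
Qed.

Variables Gc Gd : 'rV[R]_n -> 'M[R]_n.
Hypothesis Gc_smooth : forall i j, smooth_on Uc (fun x => (Gc x i j : R^o)).
Hypothesis Gd_smooth : forall i j, smooth_on Ud (fun x => (Gd x i j : R^o)).
Hypothesis Gc_sym : forall x, Uc x -> (Gc x)^T = Gc x.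
Hypothesis Gd_sym : forall x, Ud x -> (Gd x)^T = Gd x.
Hypothesis Gc_pos : forall x, Uc x -> forall v, v != 0 -> 0 < inner (Gc x) v v.
Hypothesis Gd_pos : forall x, Ud x -> forall v, v != 0 -> 0 < inner (Gd x) v v.
Hypothesis G_change : forall x, Uc x -> Gc x = 'J t x *m Gd (t x) *m ('J t x)^T.

Lemma partial_diff i b y : Uc y -> differentiable (partial b (tc i) : _ -> R^o) y.
Proof. by move=> Uy; exact: smooth_diff (smooth_derive _ (smooth_coord i)) Uy. Qed.

Lemma metric_partial_change a x : Uc x ->
  \matrix_(b, c) partial a (fun y => Gc y b c) x =
  (\matrix_(b, i) partial a (partial b (tc i)) x) *m Gd (t x) *m ('J t x)^T +
  'J t x *m (\sum_k 'J t x a k *: \matrix_(b, c) partial k (fun y => Gd y b c) (t x))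
     *m ('J t x)^T +
  'J t x *m Gd (t x) *m (\matrix_(b, i) partial a (partial b (tc i)) x)^T.
Proof.
move=> Ux; apply/matrixP => b c; rewrite mxE.
have dG i j : differentiable ((fun y => (Gd y i j : R^o)) \o t) x.
  by apply: (partial_comp 0 Ux _).1 || apply: (partial_comp a Ux _).1;
     exact: smooth_diff (Gd_smooth i j) (tU Ux).
pose F i j y := partial b (tc i) y * Gd (t y) i j * partial c (tc j) y : R^o.
have -> : partial a (fun y => Gc y b c) x = partial a (fun y => \sum_i \sum_j F i j y) x.
  apply: (eq_derive_on oUc _ _ Ux) => y Uy; rewrite G_change // -[LHS]mulr1.
  rewrite mulr1 mxE exchange_big; apply: eq_bigr => j _ /=.
  rewrite mxE mulr_suml; apply: eq_bigr => i _.
  by rewrite [_^T _ _]mxE /F !(jacobian_coord _ _ Uy).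
have dP i : differentiable (partial b (tc i) : _ -> R^o) x by exact: partial_diff.
have dP' i : differentiable (partial c (tc i) : _ -> R^o) x by exact: partial_diff.
have dPG i j : differentiable (fun y => (partial b (tc i) y * Gd (t y) i j : R^o)) x.
  exact: (differentiableM (dP i) (dG i j)).
have dF i j : differentiable (F i j) x.
  exact: (differentiableM (dPG i j) (dP' j)).
rewrite partial_sum; last by move=> i; apply: differentiable_sumR => j; exact: dF.
have E i j : partial a (F i j) x =
  partial a (partial b (tc i)) x * Gd (t x) i j * 'J t x c j
  + 'J t x b i * (\sum_k 'J t x a k * partial k (fun y => Gd y i j) (t x)) * 'J t x c j
  + 'J t x b i * Gd (t x) i j * partial a (partial c (tc j)) x.
  rewrite (partialM a (dPG i j) (dP' j)) (partialM a (dP i) (dG i j)).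
  have [_ ->] := partial_comp a Ux (smooth_diff (Gd_smooth i j) (tU Ux)).
  by rewrite !jacobian_coord //= mulrDl.
have triple (X Y Z : 'M[R]_n) : (X *m Y *m Z^T) b c = \sum_i \sum_j X b i * Y i j * Z c j.
  rewrite mxE exchange_big; apply: eq_bigr => j _ /=.
  by rewrite mxE mulr_suml; apply: eq_bigr => i _; rewrite [_^T _ _]mxE.
rewrite !addmxE !triple -!big_split /=; apply: eq_bigr => i _.
rewrite partial_sum; last by move=> j; exact: dF.
rewrite -!big_split /=; apply: eq_bigr => j _; rewrite E.
congr (_ * _ * _ + _ * _ * _ + _ * _ * _); rewrite ?mxE // summxE.
by apply: eq_bigr => k _; rewrite !mxE.
Qed.

Definition second_jacobian x a : 'M[R]_n :=
  \matrix_(b, i) partial a (partial b (tc i)) x.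

(* Transformation law of the Christoffel symbols: the right-hand side, divided
   by the Jacobian, is symmetric and metric, hence the Levi-Civita connection. *)
Lemma gamma_change a x : Uc x -> gamma Gc x a *m 'J t x =
  second_jacobian x a + 'J t x *m \sum_k 'J t x a k *: gamma Gd (t x) k.
Proof.
move=> Ux; have Utx := tU Ux; set J := 'J t x; set gd := Gd (t x).
have [cs cm] := gamma_levi_civita oUc Gc_smooth Gc_sym Gc_pos Ux.
have [ds dmet] := gamma_levi_civita oUd Gd_smooth Gd_sym Gd_pos Utx.
have gcu : Gc x \in unitmx by exact: (posdef_unit Gc_pos).
have Ju : J \in unitmx.
  have /mulmx1_unit[] // : J *m (gd *m J^T *m invmx (Gc x)) = 1%:M.
  by rewrite !mulmxA -G_change // mulmxV.
pose L a := \sum_k J a k *: gamma Gd (t x) k.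
pose P a := second_jacobian x a + J *m L a.
pose B a := gamma Gc x a - P a *m invmx J.
have Ls b c e : \sum_l J b l * L c l e = \sum_l J c l * L b l e.
  have LE p q : \sum_l J p l * L q l e =
      \sum_l \sum_k J p l * (J q k * gamma Gd (t x) k l e).
    apply: eq_bigr => l _; rewrite /L summxE mulr_sumr.
    by apply: eq_bigr => k _; rewrite scalemxE.
  rewrite !LE exchange_big; apply: eq_bigr => l _; apply: eq_bigr => k _ /=.
  by rewrite (ds l k e) mulrCA.
have Ps b c e : P b c e = P c b e.
  have PE p q : P p q e = partial p (partial q (tc e)) x + \sum_l J q l * L p l e.
    rewrite /P; move: (L p) => X; rewrite addmxE; congr (_ + _); first by rewrite mxE.
    by rewrite mxE.
  apply: etrans (PE b c) _; apply: etrans _ (esym (PE c b)).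
  move: (Ls c b e); set S1 := \sum_l _; set S2 := \sum_l _ => ->.
  apply: (congr1 (+%R^~ S2)).
  exact: (smooth_deriveC _ _ oUc (smooth_coord e) Ux).
have Bs b c e : B b c e = B c b e.
  rewrite /B !addmxE !oppmxE cs; congr (_ - _); rewrite !mxE.
  by apply: eq_bigr => i _; rewrite Ps.
have Lm b : L b *m gd + gd *m (L b)^T =
    \sum_k J b k *: \matrix_(i, c) partial k (fun y => Gd y i c) (t x).
  rewrite /L mulmx_suml raddf_sum mulmx_sumr -big_split; apply: eq_bigr => k _ /=.
  rewrite dmet scalerDr -scalemxAl; congr (_ + _).
  by rewrite scalemxAr; congr (_ *m _); apply/matrixP => i j; rewrite !mxE.
have Bm b : B b *m Gc x + Gc x *m (B b)^T = 0.
  have Pg : P b *m invmx J *m Gc x = P b *m gd *m J^T.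
    by rewrite G_change // !mulmxA mulmxKV.
  have gP : Gc x *m (P b *m invmx J)^T = J *m gd *m (P b)^T.
    rewrite -{1}(Gc_sym Ux) -trmx_mul Pg !trmx_mul trmxK mulmxA.
    by rewrite (Gd_sym Utx).
  rewrite /B mulmxBl linearB /= mulmxBr Pg gP.
  have -> : gamma Gc x b *m Gc x - P b *m gd *m J^T
    + (Gc x *m (gamma Gc x b)^T - J *m gd *m (P b)^T) =
    (gamma Gc x b *m Gc x + Gc x *m (gamma Gc x b)^T)
    - (P b *m gd *m J^T + J *m gd *m (P b)^T).
    by apply/matrixP => i j; rewrite !(addmxE, oppmxE); ring.
  rewrite -cm metric_partial_change // -Lm /P -/(second_jacobian x b) -/J -/gd.
  rewrite trmxD trmx_mul !mulmxDl !mulmxDr !mulmxDl !mulmxA.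
  by apply/matrixP => i j; rewrite !(addmxE, oppmxE) [RHS]mxE; ring.
have /(_ a) := levi_civita_unique (Gc_sym Ux) gcu Bs Bm.
by move/eqP; rewrite subr_eq0 => /eqP ->; rewrite mulmxKV.
Qed.

(** The second derivatives of [t] appear both in the second partials of [f \o t] and, by
    [gamma_change], in the connection term; they cancel. *)
Lemma hessian_change (f : 'rV[R]_n -> R^o) x : smooth_on Ud f -> Uc x ->
  hessian Gc (f \o t) x = 'J t x *m hessian Gd f (t x) *m ('J t x)^T.
Proof.
move=> sf Ux; apply/matrixP => a b; rewrite mxE; set J := 'J t x.
have df y : Uc y -> differentiable f (t y).
  by move=> Uy; exact: smooth_diff sf (tU Uy).
have ddf i : differentiable (partial i f : _ -> R^o) (t x).
  exact: smooth_diff (smooth_derive _ sf) (tU Ux).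
have E1 : partial a (partial b (f \o t)) x =
    \sum_i (second_jacobian x a b i * partial i f (t x)
            + J b i * \sum_k J a k * partial k (partial i f) (t x)).
  pose F i y := partial b (tc i) y * partial i f (t y) : R^o.
  have -> : partial a (partial b (f \o t)) x = partial a (fun y => \sum_i F i y) x.
    apply: (eq_derive_on oUc _ _ Ux) => y Uy.
    rewrite (partial_comp b Uy (df y Uy)).2; apply: eq_bigr => i _.
    by rewrite (jacobian_coord _ _ Uy).
  have dc i : differentiable ((partial i f : _ -> R^o) \o t) x.
    exact: (partial_comp a Ux (ddf i)).1.
  rewrite partial_sum => [|i]; last first.
    exact: (differentiableM (partial_diff i b Ux) (dc i)).
  apply: eq_bigr => i _; rewrite (partialM a (partial_diff i b Ux) (dc i)).
  rewrite (partial_comp a Ux (ddf i)).2 /second_jacobian mxE.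
  by rewrite /J (jacobian_coord b i Ux).
have E2 : \sum_c christoffel Gc c a b x * partial c (f \o t) x =
   \sum_i (gamma Gc x a *m J) b i * partial i f (t x).
  under eq_bigr do rewrite (partial_comp _ Ux (df x Ux)).2 mulr_sumr.
  rewrite exchange_big; apply: eq_bigr => i _; rewrite [X in X * _]mxE mulr_suml.
  by apply: eq_bigr => c _; rewrite [gamma _ _ _ _ _]mxE mulrA.
rewrite E1 E2 gamma_change // -sumrB -/J.
transitivity (\sum_i J b i * \sum_k J a k * hessian Gd f (t x) k i).
  pose c i := \sum_k J a k * \sum_l christoffel Gd l k i (t x) * partial l f (t x).
  transitivity (\sum_i J b i * (\sum_k J a k * partial k (partial i f) (t x))
     - \sum_i J b i * c i); last first.
    rewrite -sumrB; apply: eq_bigr => i _; rewrite -mulrBr -sumrB; congr (_ * _).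
    by apply: eq_bigr => k _; rewrite [hessian _ _ _ _ _]mxE mulrBr.
  have -> : \sum_i J b i * c i = \sum_i
     (J *m \sum_k J a k *: gamma Gd (t x) k) b i * partial i f (t x).
    under [RHS]eq_bigr do rewrite mxE mulr_suml.
    rewrite [RHS]exchange_big; apply: eq_bigr => i _ /=.
    rewrite /c; under [RHS]eq_bigr do rewrite -mulrA.
    rewrite -mulr_sumr; congr (_ * _).
    under [RHS]eq_bigr do rewrite summxE mulr_suml.
    rewrite [RHS]exchange_big; apply: eq_bigr => k _ /=; rewrite mulr_sumr.
    by apply: eq_bigr => l _; rewrite scalemxE [gamma _ _ _ _ _]mxE mulrA.
  rewrite -sumrB; apply: eq_bigr => i _; rewrite addmxE mulrDl.
  by rewrite opprD addrA [_ + _ * _]addrC addrK.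
rewrite mxE; apply: eq_bigr => i _; rewrite [_^T _ _]mxE mulrC; congr (_ * _).
by rewrite mxE.
Qed.
End Change.

(** * The Riccati comparison function *)

Section Riccati.
Variables (R : realType) (k : R).
Hypothesis k_ge0 : 0 <= k.

Lemma sinh_pos (x : R) : 0 < x -> 0 < expR x - expR (- x).
Proof. by move=> x0; rewrite subr_gt0 ltr_expR; lra. Qed.

(** A crude bound that gives both positivity and blow-up at 0. For k > 0, with x = k t, it follows
    from 1 - exp (-2x) <= 2x. *)
Lemma kcoth_ge (t : R) : 0 < t -> (2 * t)^-1 <= kcoth k t.
Proof.
move=> t0; rewrite /kcoth; case: eqVneq => [_|k0].
  by rewrite lef_pV2 ?posrE; lra.
have kp : 0 < k by rewrite lt_def k0.
have kt : 0 < k * t by rewrite mulr_gt0.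
rewrite /coth; have D := sinh_pos kt; set x := k * t in kt D *.
rewrite mulrA ler_pdivlMr // mulrC ler_pdivrMr; last lra.
have e2 : expR (- x) = expR x * expR (- (2 * x)).
  by rewrite -expRD; congr expR; ring.
have h1 := expR_ge1Dx (- (2 * x)); have ex := expR_gt0 x.
have h2 := expR_gt0 (- x).
have : expR x - expR (- x) <= expR x * (2 * x).
  by rewrite e2 -{1}[expR x]mulr1 -mulrBr ler_pM2l //; lra.
move=> /le_trans; apply.
rewrite (_ : k * _ * (2 * t) = (expR x + expR (- x)) * (2 * x)); last by rewrite /x; ring.
by rewrite ler_pM2r //; lra.
Qed.

Lemma kcoth_gt0 (t : R) : 0 < t -> 0 < kcoth k t.
Proof. by move=> t0; apply: lt_le_trans (kcoth_ge t0); rewrite invr_gt0; lra. Qed.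

Lemma kcoth_derive (t : R) : 0 < t ->
  is_derive t 1 (kcoth k) (k ^+ 2 - kcoth k t ^+ 2).
Proof.
move=> t0; rewrite /kcoth; case: eqVneq => [->|k0].
  have tn : t != 0 by rewrite gt_eqF.
  have D : is_derive t 1 (fun t : R => t^-1) (- t ^- 2 *: 1).
    exact: is_deriveV.
  by apply: is_derive_eq; rewrite /GRing.scale /= mulr1 expr0n /= sub0r exprVn.
have kp : 0 < k by rewrite lt_def k0.
have kt : 0 < k * t by rewrite mulr_gt0.
have Dl (a : R) : is_derive t 1 (fun t : R => a * t) a.
  have D : is_derive t (1 : R) (a \*: (id : R -> R)) (a *: 1) by apply: is_deriveZ.
  by apply: is_derive_eq; exact: mulr1.
have De (a : R) : is_derive t 1 (fun t => expR (a * t)) (expR (a * t) * a).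
  exact: (@is_derive1_comp R expR (fun t => a * t) t _ _ (is_derive_expR _) (Dl a)).
pose N (s : R) := expR (k * s) + expR (- k * s).
pose D (s : R) := expR (k * s) - expR (- k * s).
have DN : is_derive t 1 N (expR (k * t) * k + expR (- k * t) * - k).
  exact: (is_deriveD (De k) (De (- k))).
have DD : is_derive t 1 D (expR (k * t) * k - expR (- k * t) * - k).
  exact: (is_deriveB (De k) (De (- k))).
have D0 : D t != 0 by rewrite /D mulNr gt_eqF // sinh_pos.
have DV : is_derive t 1 (fun s => (D s)^-1)
    (- (D t) ^- 2 *: (expR (k * t) * k - expR (- k * t) * - k)).
  exact: is_deriveV.
have DQ : is_derive t 1 (k \*: (N * (fun s => (D s)^-1)))
    (k *: (N t *: (- (D t) ^- 2 *: (expR (k * t) * k - expR (- k * t) * - k)) +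
           (D t)^-1 *: (expR (k * t) * k + expR (- k * t) * - k))).
  by apply: is_deriveZ; exact: is_deriveM.
have -> : (fun t => k * coth (k * t)) = k \*: (N * (fun s => (D s)^-1)).
  by apply/funext => s; rewrite /coth -mulNr.
apply: is_derive_eq.
move: D0; rewrite /coth /GRing.scale /= /D /N -!mulNr.
by move: (expR (k * t)) (expR (- k * t)) => x y xy; field.
Qed.

Lemma half_kcoth_derive (t : R) : 0 < t ->
  is_derive t 1 (fun s => - (kcoth k s / 2)) (2 * (kcoth k t / 2) ^+ 2 - k ^+ 2 / 2).
Proof.
move=> t0; have K := kcoth_derive t0.
have D : is_derive t 1 ((- 2^-1) \*: kcoth k) ((- 2^-1) *: (k ^+ 2 - kcoth k t ^+ 2)).
  exact: is_deriveZ.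
have -> : (fun s => - (kcoth k s / 2)) = (- 2^-1) \*: kcoth k.
  by apply/funext => s; rewrite mulrC -mulNr.
by apply: is_derive_eq; rewrite /GRing.scale /=; field.
Qed.
End Riccati.

(** * Space-time derivatives *)

Section Slices.
Variables (R : realType) (n : nat).
Local Notation V := 'rV[R]_n.
Implicit Types (O : set (R * V)) (F : R * V -> R^o).

Definition dir_x (a : 'I_n) : R * V := (0, delta_mx 0 a).
Definition dir_t : R * V := (1, 0).

Lemma slice_derive F t (v y : V) : differentiable F (t, y) ->
  differentiable (fun y => F (t, y)) y /\
  'D_v (fun y => F (t, y)) y = 'D_(0, v) F (t, y).
Proof.
move=> dF; have dp : is_diff y (fun y : V => (t, y)) (fun v => (0, v)).
  exact: is_diff_pair.
have dpy := @ex_diff _ _ _ _ _ _ _ dp.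
have dc := differentiable_comp dpy dF; split; first exact: dc.
by rewrite deriveE // (diff_comp dpy dF) /= diff_val deriveE.
Qed.

Lemma time_derive F t (y : V) : differentiable F (t, y) ->
  is_derive t (1 : R) (fun s => F (s, y)) ('D_dir_t F (t, y)).
Proof.
move=> dF; have dp : is_diff t (fun s : R => (s, y)) (fun s => (s, 0)).
  exact: is_diff_pair.
have dpy := @ex_diff _ _ _ _ _ _ _ dp.
have dc := differentiable_comp dpy dF.
apply: DeriveDef; first exact: diff_derivable.
by rewrite deriveE // (diff_comp dpy dF) /= diff_val deriveE.
Qed.

Lemma open_slice O t : open O -> open [set y | O (t, y)].
Proof.
move=> oO; have c : continuous (fun y : V => (t, y)).
  move=> y; apply: differentiable_continuous.
  have dp : is_diff y (fun y : V => (t, y)) (fun v => (0, v)) by exact: is_diff_pair.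
  exact: (@ex_diff _ _ _ _ _ _ _ dp).
by move/continuousP : c; apply.
Qed.

Lemma near_slice O t (y : V) : open O -> O (t, y) -> \forall z \near y, O (t, z).
Proof.
move=> oO Oy; have N : open_nbhs y [set z | O (t, z)].
  by split; [exact: open_slice|exact: Oy].
exact: open_nbhs_nbhs N.
Qed.

Lemma slice_smooth O F t : open O -> smooth_on O F ->
  smooth_on [set y | O (t, y)] (fun y => (F (t, y) : R^o)).
Proof.
move=> oO sF vs y /= Oy.
have E : forall y, O (t, y) -> foldr (fun v g => 'D_v g) (fun y => (F (t, y) : R^o)) vs y
    = foldr (fun v g => 'D_v g) F (map (fun v => (0, v)) vs) (t, y).
  elim: vs => //= v vs IH z Oz.
  have [_ <-] := slice_derive v (sF [seq (0, v) | v <- vs] _ Oz).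
  apply: near_eq_derive.
  by apply: filterS (near_slice oO Oz) => w; exact: IH.
have [+ _] := slice_derive 0 (sF [seq (0, v) | v <- vs] _ Oy).
apply: near_eq_differentiable.
by apply: filterS (near_slice oO Oy) => z /E.
Qed.

Lemma slice_partial O F a t y : smooth_on O F -> O (t, y) ->
  partial a (fun y => F (t, y)) y = 'D_(dir_x a) F (t, y).
Proof. by move=> sF Oy; have [] := slice_derive (delta_mx 0 a) (sF [::] _ Oy). Qed.

(** The Hessian of a time slice in terms of space-time derivatives: in this form it is visibly
    continuous in (t, x) and can be differentiated in time. *)
Definition flow_hessian (G : V -> 'M[R]_n) F (z : R * V) : 'M[R]_n :=
  \matrix_(a, b) ('D_(dir_x a) ('D_(dir_x b) F) z
     - \sum_c christoffel G c a b z.2 * 'D_(dir_x c) F z).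

Lemma hessian_slice O F (G : V -> 'M[R]_n) t y : open O -> smooth_on O F -> O (t, y) ->
  hessian G (fun y => F (t, y)) y = flow_hessian G F (t, y).
Proof.
move=> oO sF Oy; apply/matrixP => a b.
rewrite [LHS]mxE.
rewrite [RHS]mxE.
apply: (congr2 (fun u w : R => u - w)).
  rewrite -(slice_partial a (smooth_derive (dir_x b) sF) Oy).
  have S z : O (t, z) -> partial b (fun y => F (t, y)) z = 'D_(dir_x b) F (t, z).
    exact: slice_partial.
  apply: near_eq_derive.
  by apply: filterS (near_slice oO Oy) => w; exact: S.
by apply: eq_bigr => c _; rewrite (slice_partial c sF Oy).
Qed.

(** The metric does not depend on time, so the time derivative falls on [F] alone and commutes with
    the spatial ones. *)
Lemma flow_hessian_time O F (G : V -> 'M[R]_n) a b t y : open O -> smooth_on O F ->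
  O (t, y) -> is_derive t (1 : R) (fun s => flow_hessian G F (s, y) a b)
    (hessian G (fun y => 'D_dir_t F (t, y)) y a b).
Proof.
move=> oO sF Oy.
rewrite (hessian_slice G oO (smooth_derive dir_t sF) Oy) mxE.
have -> : (fun s => flow_hessian G F (s, y) a b) =
  (fun s => 'D_(dir_x a) ('D_(dir_x b) F) (s, y))
  - \sum_(c < n) (christoffel G c a b y \*: (fun s => 'D_(dir_x c) F (s, y))).
  apply/funext => s; rewrite mxE /=; rewrite !fctE fct_sumE; congr (_ - _).
have C1 u v (H : R * V -> R^o) : smooth_on O H -> 'D_u ('D_v H) (t, y) = 'D_v ('D_u H) (t, y).
  by move=> sH; apply: (smooth_deriveC v u oO sH Oy).
apply: is_deriveB.
  have E1 := C1 dir_t (dir_x a) ('D_(dir_x b) F) (smooth_derive _ sF).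
  have E2 : 'D_(dir_x a) ('D_dir_t ('D_(dir_x b) F)) (t, y) = 'D_(dir_x a) ('D_(dir_x b) ('D_dir_t F)) (t, y).
    have S z : O z -> 'D_dir_t ('D_(dir_x b) F) z = 'D_(dir_x b) ('D_dir_t F) z.
      by move=> Oz; apply: (smooth_deriveC (dir_x b) dir_t oO sF Oz).
    apply: near_eq_derive.
    by apply: filterS (open_nbhs_nbhs (conj oO Oy)) => w; exact: S.
  rewrite -E2 -E1; apply: time_derive.
  exact: smooth_diff (smooth_derive (dir_x a) (smooth_derive (dir_x b) sF)) Oy.
apply: is_derive_sum => c; apply: is_deriveZ.
have E1 := C1 dir_t (dir_x c) F sF; rewrite -E1; apply: time_derive.
exact: smooth_diff (smooth_derive (dir_x c) sF) Oy.
Qed.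
End Slices.

(** * The flow on the manifold *)

Section OneVariable.
Variable R : realType.

(** One-sided, because the minimum may occur at the last time considered. *)
Lemma left_min_derive (g : R -> R) (t D : R) : is_derive t (1 : R) g D ->
  (exists2 e, 0 < e & forall s, t - e < s < t -> g t <= g s) -> D <= 0.
Proof.
move=> [dg Dg] [e e0 gmin]; have df : differentiable (g : R -> R^o) t.
  exact/derivable1_diffP.
apply/ler_addgt0Pl => d d0; rewrite addr0 -subr_ge0 addrC.
have [r r0 H] := diff_bound df d0.
pose s := Num.min e r / 2.
have m0 : 0 < Num.min e r by rewrite lt_min e0.
have s0 : 0 < s by rewrite divr_gt0.
have : s < Num.min e r by rewrite /s; lra.
rewrite lt_min => /andP[se sr].
have Hs := H (- s); rewrite normrN gtr0_norm // in Hs.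
have dE : 'D_(- s) (g : R -> R^o) t = - s * D.
  transitivity ('D_(- s *: (1 : R)) (g : R -> R^o) t); last by rewrite (deriveZv _ _ df) Dg.
  by congr ('D_ _ _ _); rewrite [RHS]mulr1.
have {}Hs := Hs sr; rewrite dE in Hs.
have gs : g t <= g (t + - s) by apply: gmin; apply/andP; split; lra.
have H2 : `|(g (t + - s) - g t) - s * - D| <= d * s by rewrite mulrN -mulNr.
by apply: (slope_ge s0 _ H2); rewrite ?subr_ge0 // mulrC.
Qed.

(** [g] is a two-sided extension of [h], while the limit is taken within [J]. Both are compared on
    difference quotients from the left, where [J] contains a whole interval. *)
Lemma cvg_left_derive (J : set R) (g h : R -> R) (t D l : R) :
  is_derive t (1 : R) g D -> 0 < t -> (forall s, 0 <= s <= t -> J s) ->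
  (\forall s \near t, J s -> g s = h s) ->
  (fun s => (s - t)^-1 * (h s - h t)) @ within (J `\ t) (nbhs t) --> l -> D = l.
Proof.
move=> [dg Dg] t0 Jt gh hl.
have df : differentiable (g : R -> R^o) t by exact/derivable1_diffP.
have ght : g t = h t by apply: (nbhs_singleton gh); apply: Jt; rewrite lexx ltW.
apply/eqP; rewrite -subr_eq0 -normr_le0; apply/ler_addgt0Pl => e e0; rewrite addr0.
have e20 : 0 < e / 2 by rewrite divr_gt0.
have [r r0 H] := diff_bound df e20.
have /cvgrPdist_le /(_ _ e20) := hl; rewrite near_withinE => H2.
have [d d0 Hd] : exists2 d, 0 < d & forall s, `|t - s| < d ->
    (J s -> g s = h s) /\
    (J s -> s <> t -> `|l - (s - t)^-1 * (h s - h t)| <= e / 2).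
  have N : nbhs t (fun s => (J s -> g s = h s) /\
    ((J `\ t) s -> `|l - (s - t)^-1 * (h s - h t)| <= e / 2)) by exact: filterI.
  move/nbhs_normP: N => [d /= d0 Hd]; exists d => // s ts.
  by have [h1 h2] := Hd s ts; split => // Js st; apply: h2; split.
pose s := Num.min (Num.min r d) t / 2.
have m0 : 0 < Num.min (Num.min r d) t by rewrite !lt_min r0 d0.
have s0 : 0 < s by rewrite divr_gt0.
have : s < Num.min (Num.min r d) t by rewrite /s; lra.
rewrite !lt_min => /andP[/andP[sr sd] st].
have bt : `|t - (t - s)| < d by rewrite opprB addrC subrK gtr0_norm.
have Jts : J (t - s) by apply: Jt; apply/andP; split; lra.
have tsn : t - s != t by rewrite -subr_eq0 addrAC subrr add0r oppr_eq0 gt_eqF.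
have [gs hs] := Hd _ bt.
have {}hs := hs Jts (fun E => negP tsn (introT eqP E)).
have Hs := H (- s); rewrite normrN gtr0_norm // in Hs.
have dE : 'D_(- s) (g : R -> R^o) t = - s * D.
  transitivity ('D_(- s *: (1 : R)) (g : R -> R^o) t); last by rewrite (deriveZv _ _ df) Dg.
  by congr ('D_ _ _ _); rewrite [RHS]mulr1.
have {}Hs := Hs sr; rewrite dE (gs Jts) ght in Hs.
have q : (t - s - t)^-1 * (h (t - s) - h t) = - ((h (t - s) - h t) / s).
  by rewrite addrAC subrr add0r invrN mulNr mulrC.
rewrite q opprK in hs.
set w := h (t - s) - h t in Hs hs.
have {}Hs : `|w / s + D| <= e / 2.
  have E : w / s + D = (w - - s * D) / s by field; rewrite gt_eqF.
  by rewrite E normrM normfV (gtr0_norm s0) ler_pdivrMr.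
have -> : D - l = (w / s + D) - (l + w / s) by ring.
rewrite (splitr e); apply: le_trans (ler_normB _ _) (lerD Hs hs).
Qed.
End OneVariable.

Section ManifoldFlow.
Variables (R : realType) (n : nat) (M : riemannianManifold R n).
Implicit Types (c : chart M) (p : M) (x y v : 'rV[R]_n).

Definition img c := coord c @` dom c.

Lemma open_img c : open (img c). Proof. exact: image_open. Qed.

Lemma img_coord c p : dom c p -> img c (coord c p).
Proof. by move=> cp; exists p. Qed.

Lemma dom_point c x : img c x -> dom c (point c x).
Proof. by case=> p cp <-; rewrite coordK. Qed.

Lemma pointK c x : img c x -> coord c (point c x) = x.
Proof. by case=> p cp <-; rewrite coordK. Qed.

Lemma hessian_near_eq (G : 'rV[R]_n -> 'M[R]_n) (f g : 'rV[R]_n -> R) x :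
  (\forall y \near x, f y = g y) -> hessian G f x = hessian G g x.
Proof.
move=> fg; have E b : \forall y \near x, partial b f y = partial b g y.
  move: fg; rewrite -nbhs_nearE => /nbhs_interior fg.
  by apply: filterS fg => y fgy; exact: near_eq_derive.
apply/matrixP => a b; rewrite [LHS]mxE [RHS]mxE.
apply: (congr2 (fun u w : R => u - w)); first exact: near_eq_derive (E b).
by apply: eq_bigr => e _; rewrite (nbhs_singleton (E e)).
Qed.

Variables (J : set R) (rho : R -> M -> R).
Hypothesis rho_smooth : smooth_flow J rho.
Hypothesis rho_pos : forall t p, J t -> 0 < rho t p.

(** A smooth extension of the solution, in a chart, to an open set of space-time. Positivity is
    required on the whole set, so that the logarithm is smooth outside [J] too. *)
Definition local_flow c (O : set (R * 'rV[R]_n)) (F : R * 'rV[R]_n -> R^o) :=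
  [/\ open O, smooth_on O F, forall z, O z -> img c z.2, forall z, O z -> 0 < F z &
    forall s y, O (s, y) -> J s -> F (s, y) = rho s (point c y)].

Lemma local_flow_exists c t x : J t -> img c x ->
  exists O F, local_flow c O F /\ O (t, x).
Proof.
move=> Jt cx; have [ O [F [oO Ox sF FE]]] := @rho_smooth c (t, x) (conj Jt cx).
exists [set z | [/\ O z, img c z.2 & 0 < F z]], F; split; last first.
  by split => //; rewrite FE //; exact: rho_pos.
split.
- rewrite openE => z [Oz iz Fz]; rewrite /interior.
  have n1 : \forall w \near z, O w by exact: (open_nbhs_nbhs (conj oO Oz)).
  have n2 : \forall w \near z, img c w.2.
    have N : nbhs z.2 (img c) by exact: (open_nbhs_nbhs (conj (@open_img c) iz)).
    exact: (cvg_snd N).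
  have n3 : \forall w \near z, 0 < F w.
    have cF := differentiable_continuous (smooth_diff sF Oz).
    have N : nbhs (F z : R) [set y | 0 < y].
      by apply: open_nbhs_nbhs; split; [exact: open_gt|exact: Fz].
    exact: (cF _ N).
  near=> w; split; near: w; [exact: n1|exact: n2|exact: n3].
- by apply: smooth_subset sF => z [].
- by move=> z [].
- by move=> z [].
- by move=> s y [Oz iz _] Js; exact: FE.
Unshelve. all: by end_near. Qed.
End ManifoldFlow.

Section Regularity.
Variables (R : realType) (n : nat) (U : set 'rV[R]_n) (oU : open U).
Variable G : 'rV[R]_n -> 'M[R]_n.
Hypothesis G_smooth : forall i j, smooth_on U (fun x => (G x i j : R^o)).
Hypothesis G_sym : forall x, U x -> (G x)^T = G x.
Hypothesis G_pos : forall x, U x -> forall v, v != 0 -> 0 < inner (G x) v v.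

(** With the connection and the Hessian as ring elements, smoothness of their coordinate expressions
    is an instance of [cal_smooth]. *)
Lemma connection_lift : exists (C : calculus U) (Gm : 'I_n -> 'M[C]_n),
  (forall p a b c, @cal_ev _ _ _ C p (Gm a b c) = christoffel G c a b (sval p)) /\
  forall (F : C) (f : 'rV[R]_n -> R), (forall q, @cal_ev _ _ _ C q F = f (sval q)) ->
    forall p, map_mx (@cal_ev _ _ _ C p) (hes (@dc R n U C) Gm F) = hessian G f (sval p).
Proof.
have C := smooth_calculus oU; exists C.
have [gm [gim [gmE gimE]]] := lift_metric C G_pos G_smooth oU.
have [half halfE] := cal_cst C 2^-1.
have half2 : half + half = 1.
  by apply: cal_ext => p; rewrite rmorphD rmorph1 /= halfE; lra.
exists (lc (@dc R n U C) gm gim half); split.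
  by move=> p a b c; exact: (ev_Gm gmE gimE half2 erefl).
by move=> F f Ff p; exact: (ev_hes gmE gimE half2 erefl).
Qed.

Lemma christoffel_smooth a b c : smooth_on U (christoffel G c a b : _ -> R^o).
Proof.
have [C [Gm [GmE _]]] := connection_lift.
by apply: (cal_smooth (c := C) (F := Gm a b c)) => q; exact: GmE.
Qed.

Lemma hessian_smooth (f : 'rV[R]_n -> R^o) a b : smooth_on U f ->
  smooth_on U (fun x => (hessian G f x a b : R^o)).
Proof.
move=> sf; have [C [Gm [_ hE]]] := connection_lift.
have [F Ff] := cal_lift C sf.
apply: (cal_smooth (c := C) (F := hes (@dc R n U C) Gm F a b)) => q.
by rewrite -(hE F f Ff q) [RHS]mxE.
Qed.
End Regularity.

Section FlowFacts.
Variables (R : realType) (n : nat) (M : riemannianManifold R n).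
Variables (U1 U2 : M -> R) (J : set R) (rho : R -> M -> R).
Hypothesis J_interval : time_interval J.
Hypothesis rho_sol : solves J U1 U2 rho.
Implicit Types (c : chart M) (F : R * 'rV[R]_n -> R^o) (O : set (R * 'rV[R]_n)).

Definition log_hessian c t p : 'M[R]_n :=
  hessian_at c (fun q => ln (rho t q)) p + 2^-1 *: hessian_at c U1 p.

Lemma local_flow_ln c O F : local_flow J rho c O F ->
  smooth_on O (fun z => (ln (F z) : R^o)).
Proof. by case=> oO sF _ F0 _; exact: smooth_ln. Qed.

Lemma log_hessian_flow c O F t y : local_flow J rho c O F -> O (t, y) -> J t ->
  log_hessian c t (point c y) =
  flow_hessian (metric c) (fun z => (ln (F z) : R^o)) (t, y) +
  2^-1 *: hessian (metric c) (U1 \o point c) y.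
Proof.
move=> L Oy Jt; have sl := local_flow_ln L; have [oO sF iO _ FE] := L.
rewrite /log_hessian /hessian_at (pointK (iO _ Oy)); congr (_ + _).
rewrite -(hessian_slice _ oO sl Oy); apply: hessian_near_eq.
by apply: filterS (near_slice oO Oy) => z Oz /=; rewrite (FE _ _ Oz Jt).
Qed.

Lemma near_time_slice O (t : R) (y : 'rV[R]_n) : open O -> O (t, y) ->
  \forall s \near t, O (s, y).
Proof.
move=> oO Oy; have dp : is_diff t (fun s : R => (s, y)) (fun s => (s, 0)).
  exact: is_diff_pair.
have cp := differentiable_continuous (@ex_diff _ _ _ _ _ _ _ dp).
exact: (cp _ (open_nbhs_nbhs (conj oO Oy))).
Qed.

Lemma flow_heat c O F t y : local_flow J rho c O F -> O (t, y) -> J t -> 0 < t ->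
  'D_(dir_t R n) F (t, y) = laplacian (metric c) (fun y => F (t, y)) y
    + inner (metric c y) (grad (metric c) (U1 \o point c) y)
        (grad (metric c) (fun y => F (t, y)) y)
    + U2 (point c y) * F (t, y).
Proof.
move=> L Oy Jt t0; have [oO sF iO _ FE] := L.
have cp := dom_point (iO _ Oy).
have sol := rho_sol Jt cp.
have Js s : 0 <= s <= t -> J s.
  by case: J_interval => iJ J0 _ st; exact: (iJ _ _ J0 Jt).
have ext : \forall s \near t, J s -> F (s, y) = rho s (point c y).
  by apply: filterS (near_time_slice oO Oy) => s Os; exact: FE.
have -> := cvg_left_derive (time_derive (smooth_diff sF Oy)) t0 Js ext sol.
have slice : \forall z \near y, (rho t \o point c) z = F (t, z).
  by apply: filterS (near_slice oO Oy) => z Oz /=; rewrite FE.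
rewrite /laplacian_at /metric_at /grad_at (pointK (iO _ Oy)) (FE _ _ Oy Jt).
apply: (congr2 (fun u w : R => u + w + _)).
  by rewrite /laplacian (hessian_near_eq _ slice).
apply: (congr1 (fun w => inner _ _ w)); congr (_ *m _); apply/rowP => a; rewrite [LHS]mxE [RHS]mxE.
exact: near_eq_derive.
Qed.
End FlowFacts.

Section TimeDerivative.
Variables (R : realType) (n : nat) (M : riemannianManifold R n).
Variables (J : set R) (rho : R -> M -> R).

Lemma log_hessian_time (G : 'rV[R]_n -> 'M[R]_n) (X : 'M[R]_n) (c : chart M) O F t y v :
  local_flow J rho c O F -> O (t, y) ->
  is_derive t (1 : R)
    (fun s => inner (flow_hessian G (fun z => (ln (F z) : R^o)) (s, y) + X) v v)
    (inner (hessian G (fun y => 'D_(dir_t R n) F (t, y) / F (t, y)) y) v v).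
Proof.
move=> L Oy; have sl := local_flow_ln L; have [oO sF iO F0 FE] := L.
set l := fun z => _ in sl *.
have -> : hessian G (fun y => 'D_(dir_t R n) F (t, y) / F (t, y)) y =
          hessian G (fun y => 'D_(dir_t R n) l (t, y)) y.
  apply: hessian_near_eq; apply: filterS (near_slice oO Oy) => z Oz.
  have E := derive_ln_comp (dir_t R n) (F0 _ Oz) (smooth_diff sF Oz).
  by apply: etrans (esym E); exact: (@mulrC R).
have D a b := flow_hessian_time G a b oO sl Oy.
have -> : (fun s => inner (flow_hessian G l (s, y) + X) v v) =
  (\sum_a \sum_b (v 0 a * v 0 b) \*: (fun s => flow_hessian G l (s, y) a b))
   + cst (inner X v v).
  apply/funext => s; rewrite innerD innerE !fctE !fct_sumE; congr (_ + _).
  apply: eq_bigr => a _; rewrite fct_sumE; apply: eq_bigr => b _.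
  by rewrite mulrAC.
set h := hessian _ _ _.
have -> : inner h v v = (\sum_a \sum_b (v 0 a * v 0 b) *: h a b) + 0.
  rewrite addr0 innerE; apply: eq_bigr => a _; apply: eq_bigr => b _.
  by rewrite mulrAC.
apply: is_deriveD; apply: is_derive_sum => a; apply: is_derive_sum => b.
Qed.
End TimeDerivative.

Section ChartChange.
Variables (R : realType) (n : nat) (M : riemannianManifold R n).
Variables (U1 : M -> R) (J : set R) (rho : R -> M -> R).
Hypothesis U1_smooth : smooth_fun U1.
Hypothesis rho_smooth : smooth_flow J rho.
Hypothesis rho_pos : forall t p, J t -> 0 < rho t p.
Implicit Types (c d : chart M) (p : M).

Lemma slice_flow_smooth c t : J t ->
  smooth_on (img c) (fun x => (ln (rho t (point c x)) : R^o)).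
Proof.
move=> Jt vs x cx.
have [ O [F [L Ox]]] := local_flow_exists rho_smooth rho_pos Jt cx.
have [oO _ _ _ FE] := L.
have S : smooth_on [set y | O (t, y)] (fun y => (ln (F (t, y)) : R^o)).
  exact: (slice_smooth oO (local_flow_ln L)).
have E y : O (t, y) -> ln (F (t, y)) = ln (rho t (point c y)).
  by move=> Oy; rewrite FE.
have oS : open [set y | O (t, y)] by exact: open_slice.
have := eq_smooth oS _ S; apply; [exact: E|exact: Ox].
Qed.

Lemma open_overlap c d : open (coord c @` (dom c `&` dom d)).
Proof.
rewrite openE => x [p [cp dp] <-]; rewrite /interior.
have N1 : nbhs (coord c p) (img c).
  exact: (open_nbhs_nbhs (conj (@open_img _ _ _ c) (img_coord cp))).
have N2 : nbhs (coord c p) (point c @^-1` dom d).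
  apply: (point_continuous (img_coord cp)).
  by rewrite coordK //; apply: open_nbhs_nbhs; split => //; exact: dom_open.
apply: filterS (filterI N1 N2) => y [cy dy].
by exists (point c y); [split; [exact: dom_point|]|exact: pointK].
Qed.

Lemma hessian_at_change c d p (f : M -> R) : dom c p -> dom d p ->
  smooth_on (img d) (fun x => (f (point d x) : R^o)) ->
  let D := 'J (coord d \o point c) (coord c p) in
  hessian_at c f p = D *m hessian_at d f p *m D^T.
Proof.
move=> cp dp sf D.
set Uc := coord c @` (dom c `&` dom d).
have sub : Uc `<=` img c by move=> x [q [cq _] <-]; exact: img_coord.
have xU : Uc (coord c p) by exists p.
have tU x : Uc x -> img d ((coord d \o point c) x).
  by move=> [q [cq dq] <-] /=; rewrite coordK //; exact: img_coord.
have Gs i j : smooth_on Uc (fun x => (metric c x i j : R^o)).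
  by apply: smooth_subset sub _; exact: metric_smooth.
have E := @hessian_change R n Uc (img d) (@open_overlap c d) (@open_img _ _ _ d)
  (coord d \o point c) (@transition_smooth _ _ M c d) tU (metric c) (metric d) Gs
  (@metric_smooth _ _ M d) (fun x Ux => metric_sym (sub x Ux)) (@metric_sym _ _ M d)
  (fun x Ux => metric_pos (sub x Ux)) (@metric_pos _ _ M d).
rewrite /hessian_at; have -> : coord d p = (coord d \o point c) (coord c p).
  by rewrite /= coordK.
rewrite -E //; last first.
  by move=> x [q [cq dq] <-] /=; rewrite coordK //; exact: metric_transition.
apply: hessian_near_eq; apply: filterS (open_nbhs_nbhs (conj (@open_overlap c d) xU)).
by move=> x [q [cq dq] <-] /=; rewrite !coordK.
Qed.

Lemma log_hessian_change c d t p : J t -> dom c p -> dom d p ->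
  let D := 'J (coord d \o point c) (coord c p) in
  log_hessian U1 rho c t p = D *m log_hessian U1 rho d t p *m D^T.
Proof.
move=> Jt cp dp D; rewrite /log_hessian.
rewrite (hessian_at_change cp dp (slice_flow_smooth (c := d) Jt)).
rewrite (hessian_at_change cp dp (U1_smooth (c := d))) -/D.
by rewrite mulmxDr mulmxDl -scalemxAr -scalemxAl.
Qed.
End ChartChange.

(** * Minimisation over times, points and directions *)

Section InnerContinuity.
Variables (R : realType) (n : nat).

Lemma cvg_sumR (T : Type) (F : set_system T) (FF : Filter F) m (f : 'I_m -> T -> R)
  (l : 'I_m -> R) : (forall i, f i @ F --> l i) ->
  (fun x => \sum_i f i x) @ F --> \sum_i l i.
Proof. by move=> fl; apply: cvg_big => //; exact: add_continuous. Qed.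

Lemma inner_continuous (T : topologicalType) (E : T -> 'M[R]_n) (u : T -> 'rV[R]_n) w :
  (forall i j, (fun x => E x i j) @ w --> E w i j) ->
  (forall i, (fun x => u x 0 i) @ w --> u w 0 i) ->
  (fun x => inner (E x) (u x) (u x)) @ w --> inner (E w) (u w) (u w).
Proof.
move=> cE cu; rewrite innerE; under eq_fun do rewrite innerE.
apply: (@cvg_sumR _ (nbhs w) _ _ _ _ _) => i; apply: (@cvg_sumR _ (nbhs w) _ _ _ _ _) => j.
by apply: cvgM; [apply: cvgM|].
Qed.

End InnerContinuity.

Section Rate.
Variables (R : realType) (n : nat) (M : riemannianManifold R n).
Variables (U1 : M -> R) (J : set R) (rho : R -> M -> R).
Hypothesis U1_smooth : smooth_fun U1.
Hypothesis rho_smooth : smooth_flow J rho.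
Hypothesis rho_pos : forall t p, J t -> 0 < rho t p.
Implicit Types (c d : chart M) (p : M).

(** The Rayleigh quotient of the Hessian of phi with respect to the metric. *)
Definition rate c t p v : R :=
  inner (log_hessian U1 rho c t p) v v / inner (metric_at c p) v v.

Lemma inner_congruence (A D : 'M[R]_n) v :
  inner (D *m A *m D^T) v v = inner A (v *m D) (v *m D).
Proof. by rewrite /inner trmx_mul !mulmxA. Qed.

Lemma metric_at_gt0 c p v : dom c p -> v != 0 -> 0 < inner (metric_at c p) v v.
Proof. by move=> cp v0; apply: metric_pos; first exact: img_coord. Qed.

(** Hessian and metric undergo the same congruence by the Jacobian, so only the direction changes,
    to [v *m D]. It is nonzero since the metric is positive on [v]. *)
Lemma rate_change c d t p v : J t -> dom c p -> dom d p -> v != 0 ->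
  exists2 w, w != 0 & rate c t p v = rate d t p w.
Proof.
move=> Jt cp dp v0; have E := log_hessian_change U1_smooth rho_smooth rho_pos Jt cp dp.
set D := 'J _ _ in E; have m := metric_at_gt0 cp v0.
have G : metric_at c p = D *m metric_at d p *m D^T by exact: metric_transition.
exists (v *m D).
  by apply: contraTneq m => vD; rewrite G inner_congruence vD inner0l ltxx.
by rewrite /rate E G !inner_congruence.
Qed.

Lemma rateZ c t p (a : R) v : a != 0 -> rate c t p (a *: v) = rate c t p v.
Proof.
by move=> a0; rewrite /rate !innerZl !innerZr -!mulf_div divff // !mul1r.
Qed.

Lemma differentiable_snd (f : 'rV[R]_n -> R^o) (z : R * 'rV[R]_n) :
  differentiable f z.2 -> {for z, continuous (fun w => f w.2)}.
Proof.
move=> df; apply: (@continuous_comp _ _ _ snd f); first exact: cvg_snd.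
exact: differentiable_continuous.
Qed.

Lemma flow_hessian_continuous c O F z i j : local_flow J rho c O F -> O z ->
  {for z, continuous (fun w => flow_hessian (metric c) (fun z => (ln (F z) : R^o)) w i j)}.
Proof.
move=> L Oz; have sl := local_flow_ln L; have [oO sF iO F0 FE] := L.
have D (H : R * 'rV[R]_n -> R^o) : smooth_on O H -> {for z, continuous H}.
  by move=> sH; apply: differentiable_continuous; exact: smooth_diff sH Oz.
rewrite /prop_for /continuous_at; under eq_fun do rewrite mxE.
rewrite mxE; apply: cvgB.
  exact: D (smooth_derive _ (smooth_derive _ sl)).
apply: (@cvg_sumR _ _ (nbhs z) _ _ _ _) => k; apply: cvgM; last exact: D (smooth_derive _ sl).
apply: (differentiable_snd (f := christoffel (metric c) k i j)).
have S := @christoffel_smooth R n _ (@open_img _ _ _ c) _ (@metric_smooth _ _ M c)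
  (@metric_pos _ _ M c) i j k.
exact: smooth_diff S (iO _ Oz).
Qed.

Lemma rate_continuous c O F t y v : local_flow J rho c O F -> O (t, y) -> v != 0 ->
  {for ((t, y), v), continuous (fun w : (R * 'rV[R]_n) * 'rV[R]_n =>
    inner (flow_hessian (metric c) (fun z => (ln (F z) : R^o)) w.1
           + 2^-1 *: hessian (metric c) (U1 \o point c) w.1.2) w.2 w.2
    / inner (metric c w.1.2) w.2 w.2)}.
Proof.
move=> L Oy v0; have [oO sF iO F0 FE] := L.
set w := (_, _).
have cv i : (fun x : (R * 'rV[R]_n) * 'rV[R]_n => x.2 0 i) @ w --> w.2 0 i.
  apply: (@cvg_comp _ _ _ snd (fun u : 'rV[R]_n => u 0 i) _ (nbhs w.2)); first exact: cvg_snd.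
  have [dc _] := derive_coord (h := id) i 0 (@ex_diff _ _ _ _ _ _ _ (is_diff_id w.2)).
  exact: (differentiable_continuous dc).
have cm (f : R * 'rV[R]_n -> R) : {for w.1, continuous f} ->
    (fun x : (R * 'rV[R]_n) * 'rV[R]_n => f x.1) @ w --> f w.1.
  by move=> cf; apply: (@cvg_comp _ _ _ fst f _ (nbhs w.1)); first exact: cvg_fst.
have iy := iO _ Oy.
rewrite /prop_for /continuous_at; apply: cvgM.
  apply: (inner_continuous (E := fun x => _ + 2^-1 *: _)) cv => i j.
  apply: (cm (fun z => (flow_hessian (metric c) (fun z => (ln (F z) : R^o)) z
    + 2^-1 *: hessian (metric c) (U1 \o point c) z.2) i j)).
  have E (X Y : R * 'rV[R]_n -> 'M[R]_n) :
      (fun z => (X z + 2^-1 *: Y z) i j) = fun z => X z i j + 2^-1 * Y z i j.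
    by apply/funext => z; rewrite addmxE scalemxE.
  rewrite E /prop_for /continuous_at.
  apply: cvgD; first exact: flow_hessian_continuous L Oy.
  apply: cvgM; first exact: cvg_cst.
  apply: (differentiable_snd (f := fun x => hessian (metric c) (U1 \o point c) x i j)).
  have S := @hessian_smooth R n _ (@open_img _ _ _ c) _ (@metric_smooth _ _ M c)
    (@metric_pos _ _ M c) _ i j (@U1_smooth c).
  exact: smooth_diff S iy.
apply: cvgV; first by rewrite gt_eqF //; exact: metric_pos iy _ v0.
apply: (inner_continuous (E := fun x => metric c x.1.2)) cv => i j.
apply: (cm (fun z => metric c z.2 i j)).
apply: (differentiable_snd (f := fun x => metric c x i j)).
exact: smooth_diff (@metric_smooth _ _ M c i j) iy.
Qed.
End Rate.

Section CompactMinimum.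
Variables (R : realType) (T : topologicalType) (A : T -> R -> Prop).

(** Plays the part of compactness of the sphere bundle; [A p z] reads: [z] is a value over [p]. Each
    local lower bound must itself be a value, though possibly over another point. *)
Lemma compact_attained_min : compact [set: T] -> (exists p z, A p z) ->
  (forall p : T, exists z0, (exists q, A q z0) /\
     \forall q \near p, forall z, A q z -> z0 <= z) ->
  exists q z0, A q z0 /\ forall p z, A p z -> z0 <= z.
Proof.
move=> /compact_near_coveringP cT [p1 [z1 A1]] loc.
pose Z z := exists p, A p z.
(* Sets containing all sufficiently small values form a filter. By compactness the local bounds hold
   uniformly along it, so some value lies below all values. *)
pose F : set_system R := fun S => exists2 z0, Z z0 & forall z, Z z -> z <= z0 -> S z.
have FF : Filter F.
  constructor.
  - by exists z1; first exists p1.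
  - move=> P Q [zP ZP hP] [zQ ZQ hQ]; exists (Num.min zP zQ).
      by rewrite /Num.min; case: ifP.
    by move=> z Zz; rewrite le_min => /andP[zp zq]; split; [exact: hP|exact: hQ].
  - by move=> P Q PQ [z0 Z0 h]; exists z0 => // z Zz zz; exact/PQ/h.
have [|z0 [q Aq] h] := cT R F (fun i p => forall z, A p z -> i <= z) FF.
  move=> p _; have [z0 [Z0 N]] := loc p.
  exists ((fun q => forall z, A q z -> z0 <= z), [set i | i <= z0]).
    by split; [exact: N|exists z0].
  by move=> [q i] /= [hq iz] z Az; exact: le_trans iz (hq z Az).
by exists q, z0; split => // p z Az; apply: (h z0 _ (lexx _) p I z Az); exists q.
Qed.
End CompactMinimum.

Section RateMinimum.
Variables (R : realType) (n : nat) (M : riemannianManifold R n).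
Hypothesis M_compact : compact [set: M].
Variables (U1 : M -> R) (J : set R) (rho : R -> M -> R).
Hypothesis U1_smooth : smooth_fun U1.
Hypothesis rho_smooth : smooth_flow J rho.
Hypothesis rho_pos : forall t p, J t -> 0 < rho t p.
Implicit Types (c d : chart M) (p : M).
Local Notation rate := (rate U1 rho).

Variables (a b : R) (psi : R -> R).
Hypothesis Jab : forall s, a <= s <= b -> J s.
Hypothesis psi_continuous : forall s, a <= s <= b -> {for s, continuous psi}.

Lemma rate_chart_continuous c (K : set ((R * 'rV[R]_n) * 'rV[R]_n)) :
  (forall w, K w -> [/\ a <= w.1.1 <= b, img c w.1.2 & w.2 != 0]) ->
  {within K, continuous (fun w : (R * 'rV[R]_n) * 'rV[R]_n =>
    rate c w.1.1 (point c w.1.2) w.2 - psi w.1.1)}.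
Proof.
move=> hK; apply/subspace_continuousP => -[[t y] v] Kw.
have [/= tab cy v0] := hK _ Kw; have Jt := Jab tab.
have [ O [F [L Oy]]] := local_flow_exists rho_smooth rho_pos Jt cy.
have [oO sF iO F0 FE] := L.
have C := rate_continuous U1_smooth L Oy v0.
set g := (fun w : (R * 'rV[R]_n) * 'rV[R]_n => _ / _) in C.
have gE w : J w.1.1 -> O w.1 -> rate c w.1.1 (point c w.1.2) w.2 = g w.
  case: w => [[s z] u] /= Js Oz.
  by rewrite /rate (log_hessian_flow _ L Oz Js) /metric_at (pointK (iO _ Oz)).
set w := (t, y, v); rewrite [X in _ --> X](_ : _ = g w - psi t); last first.
  by rewrite -(gE w Jt Oy).
have cpsi : (fun x : (R * 'rV[R]_n) * 'rV[R]_n => psi x.1.1) @ w --> psi t.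
  apply: (@cvg_comp _ _ _ (fun x => x.1.1) psi _ (nbhs t)); last exact: psi_continuous.
  exact: (@cvg_comp _ _ _ fst fst _ (nbhs (t, y)) (nbhs t) cvg_fst cvg_fst).
have cg : (fun x => g x - psi x.1.1) @ w --> g w - psi t by apply: cvgB.
apply: cvg_trans (cvg_within_filter _ cg).
apply: near_eq_cvg; rewrite near_withinE.
have NO : \forall x \near w, O x.1 by exact: (cvg_fst (open_nbhs_nbhs (conj oO Oy))).
apply: filterS NO => x Ox Kx. rewrite /from_subspace gE //.
by have [xab _ _] := hK _ Kx; exact: Jab.
Qed.

Lemma sphere_compact : compact [set v : 'rV[R]_n | `|v| = 1].
Proof.
apply: bounded_closed_compact.
  by exists 1; split => // x x1 v /= ->; exact: ltW.
have -> : [set v : 'rV[R]_n | `|v| = 1] = Num.norm @^-1` [set x : R | x = 1] by [].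
by apply: closed_comp; [move=> v _; exact: norm_continuous|exact: closed_eq].
Qed.

Lemma chart_ball_compact c p : dom c p -> exists2 B : set 'rV[R]_n,
  compact B /\ B `<=` img c & nbhs (coord c p) B.
Proof.
move=> cp; have : nbhs (coord c p) (img c).
  exact: (open_nbhs_nbhs (conj (@open_img _ _ _ c) (img_coord cp))).
move/nbhs_closedballP => [r rB]; exists (closed_ball (coord c p) r%:num).
  split => //; apply: bounded_closed_compact; last exact: closed_ball_closed.
  rewrite closed_ballE //; exists (`|coord c p| + r%:num); split => // x xl v vB.
  apply: ltW; apply: le_lt_trans xl.
  rewrite -[v](subrK (coord c p)) addrC; apply: le_trans (ler_normD _ _) _.
  by rewrite lerD2l distrC.
by apply/nbhs_closedballP; exists r.
Qed.

Definition attained p z := exists c t v,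
  [/\ dom c p, a <= t <= b, v != 0 & z = rate c t p v - psi t].

(** In one chart, minimise over times, a closed ball and unit directions. Homogeneity of [rate]
    reduces to unit directions, and [rate_change] brings in values computed in other charts. *)
Lemma attained_locally_min p (v1 : 'rV[R]_n) : a <= b -> v1 != 0 ->
  exists z0, (exists q, attained q z0) /\
     \forall q \near p, forall z, attained q z -> z0 <= z.
Proof.
move=> ab v10; have [c cp] := dom_cover p.
have [B [cB Bc] Bp] := chart_ball_compact cp.
pose K := (`[a, b]%classic `*` B) `*` [set v : 'rV[R]_n | `|v| = 1].
have hK w : K w -> [/\ a <= w.1.1 <= b, img c w.1.2 & w.2 != 0].
  move=> [[/= h1 h2] h3]; split; [by move: h1; rewrite in_itv|exact: Bc|].
  by rewrite -normr_gt0 h3.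
have unit_norm (v : 'rV[R]_n) : v != 0 -> `| `|v|^-1 *: v| = 1.
  by move=> v0; rewrite normrZ normfV normr_id mulVf // normr_eq0.
have K0 : K !=set0.
  exists ((a, coord c p), `|v1|^-1 *: v1); split; last exact: unit_norm.
  by split; [rewrite /= in_itv /= lexx|exact: nbhs_singleton Bp].
have cK : compact K.
  by apply: compact_setX; [apply: compact_setX => //; exact: segment_compact|exact: sphere_compact].
have [w /set_mem Kw wmin] := compact_EVT_min K0 cK (rate_chart_continuous hK).
have [wab wc wv] := hK _ Kw.
exists (rate c w.1.1 (point c w.1.2) w.2 - psi w.1.1); split.
  by exists (point c w.1.2), c, w.1.1, w.2; split => //; exact: dom_point.
have N1 : \forall q \near p, dom c q.
  by apply: open_nbhs_nbhs; split => //; exact: dom_open.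
have N2 : \forall q \near p, B (coord c q) by exact: (coord_continuous cp Bp).
apply: filterS (filterI N1 N2) => q [cq Bq] z [d [t [v [dq tab v0 ->]]]].
have [u u0 ->] := rate_change U1_smooth rho_smooth rho_pos (Jab tab) dq cq v0.
have n0 : `|u|^-1 != 0 by rewrite invr_neq0 ?normr_eq0.
rewrite -(@rateZ R n M U1 rho c t q _ u n0).
have := wmin ((t, coord c q), `|u|^-1 *: u); rewrite /= coordK //; apply.
apply/mem_set; split; last exact: unit_norm.
by split; [rewrite /= in_itv|].
Qed.

Lemma rate_min p (v1 : 'rV[R]_n) : a <= b -> v1 != 0 ->
  exists c0 t0 p0 v0, [/\ dom c0 p0, a <= t0 <= b, v0 != 0 &
    forall c t p v, dom c p -> a <= t <= b -> v != 0 ->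
      rate c0 t0 p0 v0 - psi t0 <= rate c t p v - psi t].
Proof.
move=> ab v10; have [c cp] := dom_cover p.
have [||q [z0 [[c0 [t0 [v0 [cq tab v00 zE]]]] zmin]]] := @compact_attained_min R M attained M_compact.
- exists p, (rate c a p v1 - psi a), c, a, v1; split => //; by rewrite lexx.
- by move=> q; exact: attained_locally_min v10.
exists c0, t0, q, v0; split => // d t r v dr td v_0; rewrite -zE; apply: (zmin r).
by exists d, t, v.
Qed.
End RateMinimum.

(** * Comparison at the minimum *)

Lemma scaled_difference_le (R : realType) (g x y p q : R) : 0 < g ->
  x - p <= y - q -> x * g - g * p <= y * g - g * q.
Proof. by move=> g0; rewrite -(ler_pM2l g0) !mulrBr ![g * _]mulrC. Qed.

Section Comparison.
Variables (R : realType) (n : nat) (M : riemannianManifold R n).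
Hypothesis M_compact : compact [set: M].
Hypothesis sec_ge0 : nonneg_sectional_curvature M.
Hypothesis ric_parallel : parallel_ricci M.
Variables (U1 U2 : M -> R).
Hypothesis U1_smooth : smooth_fun U1.
Hypothesis U2_smooth : smooth_fun U2.
Variable k : R.
Hypothesis k_ge0 : 0 <= k.
Hypothesis hess_le : forall (c : chart M) (p : M), dom c p ->
  form_le
    (hessian_at c
      (fun q => laplacian_at c U1 q
                + 2^-1 * inner (metric_at c q) (grad_at c U1 q) (grad_at c U1 q)
                - 2 * U2 q) p)
    (k ^+ 2 *: metric_at c p).
Variable J : set R.
Hypothesis J_interval : time_interval J.
Variable rho : R -> M -> R.
Hypothesis rho_smooth : smooth_flow J rho.
Hypothesis rho_pos : forall (t : R) (p : M), J t -> 0 < rho t p.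
Hypothesis rho_sol : solves J U1 U2 rho.
Local Notation rate := (rate U1 rho).
Local Notation psi := (fun s => - (kcoth k s / 2)).

Lemma potential_le c x v : img c x ->
  inner (hessian (metric c)
           (potential (metric c) (U1 \o point c) (U2 \o point c)) x) v v
    <= k ^+ 2 * inner (metric c x) v v.
Proof.
move=> cx; have := hess_le (dom_point cx) v; rewrite innerZ /metric_at (pointK cx).
apply: le_trans; rewrite le_eqVlt; apply/orP; left; apply/eqP.
congr (inner _ v v); rewrite /hessian_at (pointK cx); apply: hessian_near_eq.
apply: filterS (open_nbhs_nbhs (conj (@open_img _ _ _ c) cx)) => y cy.
by rewrite /= /laplacian_at /grad_at (pointK cy).
Qed.

Lemma rate_min_time_derive c O F t x v mu : local_flow J rho c O F -> O (t, x) ->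
  J t -> 0 < t -> v != 0 -> rate c t (point c x) v = mu ->
  (forall q u, dom c q -> u != 0 -> mu <= rate c t q u) ->
  (2 * mu ^+ 2 - k ^+ 2 / 2) * inner (metric c x) v v <=
  inner (hessian (metric c) (fun y => 'D_(dir_t R n) F (t, y) / F (t, y)) x) v v.
Proof.
move=> L Ox Jt t0 v0 muE mumin; have [oO sF iO F0 FE] := L.
have cx : img c x by exact: iO Ox.
have G0 y u : O (t, y) -> u != 0 -> 0 < inner (metric c y) u u.
  by move=> Oy u0; exact: (metric_pos (iO _ Oy)).
have sub : [set y | O (t, y)] `<=` img c by move=> y /iO.
have HE y : O (t, y) -> hessian (metric c) (fun y => ln (F (t, y))) y
    + 2^-1 *: hessian (metric c) (U1 \o point c) y = log_hessian U1 rho c t (point c y).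
  move=> Oy; rewrite (log_hessian_flow _ L Oy Jt).
  by rewrite -(hessian_slice _ oO (local_flow_ln L) Oy).
have rE y u : O (t, y) -> rate c t (point c y) u =
    inner (log_hessian U1 rho c t (point c y)) u u / inner (metric c y) u u.
  by move=> Oy; rewrite /rate /metric_at (pointK (iO _ Oy)).
apply: (@hessian_ge_at_min R n [set y | O (t, y)] (open_slice oO) (metric c) _ _ _ _
  (U1 \o point c) (U2 \o point c) (fun y => F (t, y)) (fun y => 'D_(dir_t R n) F (t, y))).
- by move=> i j; apply: smooth_subset sub _; exact: metric_smooth.
- by move=> y /sub; exact: metric_sym.
- by move=> y /sub; exact: metric_pos.
- move=> y /sub cy i j l; rewrite -(pointK cy).
  exact: ric_parallel (dom_point cy) _ _ _.
- by apply: smooth_subset sub _; exact: U1_smooth.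
- by apply: smooth_subset sub _; exact: U2_smooth.
- exact: slice_smooth oO sF.
- exact: slice_smooth oO (smooth_derive _ sF).
- by move=> y; exact: F0.
- by move=> y Oy; exact: (flow_heat J_interval rho_sol L Oy Jt t0).
- exact: Ox.
- move=> u w uw; rewrite -(pointK cx).
  exact: sec_ge0 (dom_point cx) _ _ uw.
- exact: potential_le.
- move=> y Oy u; rewrite HE // innerD innerN innerZ subr_ge0.
  have [->|u0] := eqVneq u 0; first by rewrite !inner0l mulr0.
  by rewrite -ler_pdivlMr ?G0 // -rE //; apply: mumin => //; exact: dom_point (iO _ Oy).
- rewrite HE // innerD innerN innerZ -muE rE // divfK ?subrr //.
  by rewrite gt_eqF // G0.
Qed.

Lemma rate_ge c t p v : J t -> 0 < t -> dom c p -> v != 0 -> psi t <= rate c t p v.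
Proof.
move=> Jt t0 cp v0; rewrite leNgt; apply/negP => lt_rate.
have Js s : 0 <= s <= t -> J s.
  by case: J_interval => iJ J0 _; exact: (iJ _ _ J0 Jt).
(* Minimising with comparison function 0 bounds [rate] below by [m0] on all of [0, t]; smoothness up
   to time 0 enters here. *)
have [||c0 [r0 [p0 [v1 [_ _ _ min0]]]]] :=
  @rate_min R n M M_compact U1 J rho U1_smooth rho_smooth rho_pos 0 t (cst 0) Js _ p v _ v0.
- by move=> s _; exact: cvg_cst.
- exact: ltW.
set m0 := _ - _ in min0.
(* By [kcoth_ge], psi at [dlt] is at most - 1 / (4 dlt) <= - (1 + |m0|) < m0; the bound t / 2 keeps
   [dlt] below [t]. *)
pose dlt := Num.min (t / 2) (4 * (1 + `|m0|))^-1.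
have N0 : 0 < 4 * (1 + `|m0|) by rewrite mulr_gt0 // ltr_pwDl.
have dlt0 : 0 < dlt by rewrite lt_min invr_gt0 N0 andbT divr_gt0.
have dltt : dlt < t.
  have : dlt <= t / 2 by rewrite ge_min lexx.
  by move=> h; apply: le_lt_trans h _; lra.
have psid : psi dlt <= m0.
  have dN : dlt <= (4 * (1 + `|m0|))^-1 by rewrite ge_min lexx orbT.
  have kd := kcoth_ge k_ge0 dlt0.
  have : 4 * (1 + `|m0|) <= dlt^-1 by rewrite -[leLHS]invrK lef_pV2 ?posrE ?invr_gt0.
  have : - `|m0| <= m0 by rewrite lerNl -normrN ler_norm.
  move: kd; rewrite invfM /=; lra.
have Jd s : dlt <= s <= t -> J s.
  by move=> /andP[ds st]; apply: Js; rewrite st (le_trans _ ds) // ltW.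
have [||c1 [s [q [w [c1q /andP[ds st] w0 minw]]]]] :=
  @rate_min R n M M_compact U1 J rho U1_smooth rho_smooth rho_pos dlt t psi Jd _ p v _ v0.
- move=> s /andP[ds _]; have [ds' _] := half_kcoth_derive k_ge0 (lt_le_trans dlt0 ds).
  exact/differentiable_continuous/derivable1_diffP.
- exact: ltW.
set mu := rate c1 s q w in minw.
have s0 : 0 < s by exact: lt_le_trans dlt0 ds.
have mu_psi : mu < psi s.
  have := minw c t p v cp; rewrite (ltW dltt) lexx => /(_ isT v0).
  by move: lt_rate; lra.
(* The minimum is not at the initial time, where [rate] is at least [m0] and hence at least psi; so
   earlier times are available for comparison. *)
have lt_ds : dlt < s.
  rewrite lt_neqAle ds andbT; apply/eqP => dsE.
  have := min0 c1 s q w c1q; rewrite (ltW s0) st => /(_ isT w0).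
  by move: psid mu_psi; rewrite -/mu dsE /cst /=; lra.
have Jss : J s by apply: Jd; rewrite ds.
have [ O [F [L Ox]]] := local_flow_exists rho_smooth rho_pos Jss (img_coord c1q).
have mumin r u : dom c1 r -> u != 0 -> mu <= rate c1 s r u.
  by move=> c1r u0; have := minw c1 s r u c1r; rewrite ds st => /(_ isT u0); lra.
have muE : rate c1 s (point c1 (coord c1 q)) w = mu by rewrite coordK.
have space := rate_min_time_derive L Ox Jss s0 w0 muE mumin.
have [oO sF iO F0 FE] := L.
set x := coord c1 q in Ox space muE.
have g0 : 0 < inner (metric c1 x) w w by exact: metric_at_gt0.
set g := inner (metric c1 x) w w in space g0.
set Dh := inner _ w w in space.
(* Chart, point and direction are frozen and only time varies. The metric is constant in time, so
   the quotient is cleared of its denominator [g], and [h - g \*: psi] is minimal at [s] among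
   earlier times. *)
pose X := 2^-1 *: hessian (metric c1) (U1 \o point c1) x.
pose h r := inner (flow_hessian (metric c1) (fun z => (ln (F z) : R^o)) (r, x) + X) w w.
have hE r : J r -> O (r, x) -> h r = rate c1 r q w * g.
  move=> Jr Or; have E : log_hessian U1 rho c1 r q =
      flow_hessian (metric c1) (fun z => (ln (F z) : R^o)) (r, x) + X.
    by rewrite -(log_hessian_flow _ L Or Jr) coordK.
  by rewrite /h -E; exact: (esym (divfK (lt0r_neq0 g0) _)).
have Dhs : is_derive s (1 : R) h Dh by exact: log_hessian_time L Ox.
have Dpsi := half_kcoth_derive k_ge0 s0.
set dpsi := 2 * _ - _ in Dpsi.
have Dg : is_derive s (1 : R) (h - g \*: psi) (Dh - g *: dpsi).
  by apply: is_deriveB.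
have [e e0 eO] : exists2 e, 0 < e & forall r, `|s - r| < e -> O (r, x).
  by move/nbhs_normP: (near_time_slice oO Ox) => [e /= e0 eO]; exists e.
have left : exists2 e, 0 < e & forall r, s - e < r < s ->
    (h - g \*: psi) s <= (h - g \*: psi) r.
  exists (Num.min e (s - dlt)); first by rewrite lt_min e0 subr_gt0.
  move=> r /andP[er rs]; have := er; rewrite ltrBlDr addrC -ltrBlDr lt_min => /andP[re rd].
  have dr : dlt < r by move: rd; lra.
  have Jr : J r by apply: Jd; rewrite !ltW // (lt_le_trans rs).
  have Or : O (r, x) by apply: eO; rewrite gtr0_norm // subr_gt0.
  rewrite !fctE !hE //.
  have rt : r <= t by rewrite ltW // (lt_le_trans rs).
  have := minw c1 r q w c1q; rewrite (ltW dr) rt -/mu => /(_ isT w0).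
  exact: scaled_difference_le.
have := left_min_derive Dg left.
suff : g * dpsi < (2 * mu ^+ 2 - k ^+ 2 / 2) * g by move: space; rewrite /GRing.scale /=; lra.
rewrite mulrC ltr_pM2r // /dpsi ltrD2r ltr_pM2l //.
have kp := kcoth_gt0 k_ge0 s0.
(* Both [mu] and psi are negative, so the squares are compared after changing signs, and mu < psi
   makes mu^2 the larger one. *)
rewrite -[mu ^+ 2]sqrrN ltr_pXn2r // ?nnegrE.
- by move: mu_psi; lra.
- by move: kp; lra.
- by move: kp mu_psi; lra.
Qed.
End Comparison.

Unset Implicit Arguments.

Theorem theorem1p8 (R : realType) (n : nat) (M : riemannianManifold R n)
    (M_compact : compact [set: M])
    (sec_ge0 : nonneg_sectional_curvature M)
    (ric_parallel : parallel_ricci M)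
    (U1 U2 : M -> R) (U1_smooth : smooth_fun U1) (U2_smooth : smooth_fun U2)
    (k : R) (k_ge0 : 0 <= k)
    (hess_le : forall (c : chart M) (p : M), dom c p ->
      form_le
        (hessian_at c
          (fun q => laplacian_at c U1 q
                    + 2^-1 * inner (metric_at c q) (grad_at c U1 q) (grad_at c U1 q)
                    - 2 * U2 q) p)
        (k ^+ 2 *: metric_at c p))
    (J : set R) (J_interval : time_interval J)
    (rho : R -> M -> R) (rho_smooth : smooth_flow J rho)
    (rho_pos : forall (t : R) (p : M), J t -> 0 < rho t p)
    (rho_sol : solves J U1 U2 rho) :
  forall t : R, J t -> 0 < t -> forall (c : chart M) (p : M), dom c p ->
    form_le
      (- (kcoth k t / 2) *: metric_at c p)
      (hessian_at c (fun q => ln (rho t q)) p + 2^-1 *: hessian_at c U1 p).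
Proof.
move=> t Jt t0 c p cp v; rewrite innerZ.
have [->|v0] := eqVneq v 0; first by rewrite !inner0l mulr0.
have g0 := metric_at_gt0 cp v0; rewrite -ler_pdivlMr //.
exact: (rate_ge M_compact sec_ge0 ric_parallel U1_smooth U2_smooth k_ge0 hess_le
  J_interval rho_smooth rho_pos rho_sol Jt t0 cp v0).
Qed.
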